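(* Let $h\in C_0^\infty(\mathbb{R}_+)'$ be real, i.e. $\overline{\langle h,F\rangle}=\langle h,\overline F\rangle$ for all $F\in C_0^\infty(\mathbb{R}_+)$. Suppose that its sigma-function $\sigma$ satisfies $\operatorname{supp}\sigma\subset[0,\infty)$ and $\sigma\in\mathcal{S}_0'$. (1) If $\pm\sigma\ge0$, then $\pm\langle h,\bar f\star f\rangle\ge0$ for all $f\in C_0^\infty(\mathbb{R}_+)$. (2) If $\sigma\in L^1_{\rm loc}(\Delta)$ for some interval $\Delta\subset\mathbb{R}$ and $\pm\sigma(\lambda)\ge\sigma_0>0$ for almost all $\lambda\in\Delta$, then $N_\pm(h;C_0^\infty(\mathbb{R}_+))=\infty$. (In each part the statement holds with all upper signs and with all lower signs.)
   Context: $\mathbb{R}_+=(0,\infty)$. For a space of test functions $X$, $X'$ denotes the space of continuous antilinear functionals on $X$; the duality $\langle h,F\rangle$ is linear in the first and antilinear in the second argument, so that $\langle h,F\rangle=\int h(t)\overline{F(t)}\,dt$ when $h$ is a locally integrable function. The space $\mathcal{Y}$ consists of entire functions $\varphi(\lambda)$ satisfying, for all $\lambda\in\mathbb{C}$, the bounds $|\varphi(\lambda)|\le C_n(1+|\lambda|)^{-n}e^{r_\pm|\operatorname{Re}\lambda|}$ for $\pm\operatorname{Re}\lambda\ge 0$, for all $n$, with some $r_+=r_+(\varphi)<0$ and some $r_-=r_-(\varphi)\in\mathbb{R}$; $\varphi_k\to0$ in $\mathcal{Y}$ if all $\varphi_k$ satisfy these bounds with the same constants and $\varphi_k\to0$ uniformly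 on compact subsets of $\mathbb{C}$. The Laplace transform $(\mathsf{L}f)(\lambda)=\int_0^\infty e^{-t\lambda}f(t)\,dt$ is an isomorphism $C_0^\infty(\mathbb{R}_+)\to\mathcal{Y}$, hence $\mathsf{L}^*:\mathcal{Y}'\to C_0^\infty(\mathbb{R}_+)'$, $\langle\mathsf{L}^*\sigma,F\rangle=\langle\sigma,\mathsf{L}F\rangle$, is an isomorphism. The sigma-function of $h$ is $\sigma=(\mathsf{L}^* )^{-1}h\in\mathcal{Y}'$. $\mathcal{S}_0$ is the space of $g\in C^\infty(\mathbb{R}_+)$ satisfying $|g^{(k)}(\lambda)|\le C_{\varkappa,k}\lambda^{-1/2-k}(1+|\ln\lambda|)^{-\varkappa}$ for all $k=0,1,2,\dots$ and all $\varkappa\in\mathbb{R}$, with the corresponding natural topology (so $g\in\mathcal{S}_0$ iff $x\mapsto e^{x/2}g(e^x)$ is in the Schwartz space $\mathcal{S}(\mathbb{R})$). Restrictions of functions from $\mathcal{Y}$ to $\mathbb{R}_+$ belong to $\mathcal{S}_0$ and form a dense subset; $\operatorname{supp}\sigma\subset[0,\infty)$, $\sigma\in\mathcal{S}_0'$ means that $\sigma$ acts on $w\in\mathcal{Y}$ through the restriction $w|_{\mathbb{R}_+}$ as a continuous antilinear functional on $\mathcal{S}_0$ (also denoted $\sigma$). In particular $\sigma$ is a distribution on $\mathbb{R}_+$, and $\pm\sigma\ge0$ is understood in the sense of distributions. The Laplace convolution is $(\bar f_1\star f_2)(t)=\int_0^t\overline{f_1(s)}f_2(t-s)\,ds$.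 $N_\pm(h;C_0^\infty(\mathbb{R}_+))\in\{0,1,\dots,\infty\}$ is the maximal dimension of linear sets $\mathcal{M}_\pm\subset C_0^\infty(\mathbb{R}_+)$ such that $\pm\langle h,\bar f\star f\rangle>0$ for all $0\ne f\in\mathcal{M}_\pm$. *)

(* Defs.v *)
From HB Require Import structures.
From mathcomp Require Import all_boot all_order all_algebra.
From mathcomp Require Import all_classical all_reals all_analysis.
From mathcomp Require Import complex.
Set Implicit Arguments.
Unset Strict Implicit.
Unset Printing Implicit Defensive.
Import Order.TTheory GRing.Theory Num.Theory.
Import numFieldNormedType.Exports.
Import ComplexField.
Local Open Scope classical_set_scope.
Local Open Scope ring_scope.
Local Open Scope complex_scope.

Notation Re := complex.Re.
Notation Im := complex.Im.

Section Defs.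
Context {R : realType}.
Local Notation C := R[i].
Local Notation mu := (@lebesgue_measure R).

Definition Rplus : set R := `]0, +oo[%classic.

(** Complex-valued calculus. R[i] is a normed space over itself only, so the
    calculus of functions R -> R[i] is done componentwise. *)

Definition cabs (z : C) : R := Num.sqrt (Re z ^+ 2 + Im z ^+ 2).

Definition cexp (z : C) : C :=
  (expR (Re z) * cos (Im z)) +i* (expR (Re z) * sin (Im z)).

Definition cint (D : set R) (f : R -> C) : C :=
  (\int[mu]_(t in D) Re (f t)) +i* (\int[mu]_(t in D) Im (f t)).

Definition cderiv (k : nat) (f : R -> C) (t : R) : C :=
  derive1n k (fun x => Re (f x)) t +i* derive1n k (fun x => Im (f x)) t.

Definition csmooth_on (U : set R) (f : R -> C) : Prop :=
  forall (k : nat) (t : R), U t ->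
    derivable (derive1n k (fun x => Re (f x))) t 1 /\
    derivable (derive1n k (fun x => Im (f x))) t 1.

(** Function spaces are predicates on total functions, each with the predicate
    of sequences tending to zero in it.  Continuity of functionals is sequential
    continuity at zero, which for antilinear functionals on C_0^oo (an
    LF-space) and on S_0 (a Frechet space) is the same as continuity. *)

Definition antilinear_on (T : Type) (D : set (T -> C)) (F : (T -> C) -> C) :=
  forall (a : C) (f g : T -> C), D f -> D g ->
    F (fun x => a * f x + g x) = a^* * F f + F g.

Definition antidual (T : Type) (D : set (T -> C)) (null : set (nat -> T -> C))
    (F : (T -> C) -> C) : Prop :=
  antilinear_on D F /\
  (forall u : nat -> T -> C, (forall j, D (u j)) -> null u ->
     cabs (F (u j)) @[j --> \oo] --> (0 : R)).

(** C_0^oo(U) for an open set U, functions being extended by zero to R. *)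
Definition Ccinfty (U : set R) (f : R -> C) : Prop :=
  csmooth_on setT f /\
  exists K : set R, [/\ compact K, K `<=` U & forall t, ~ K t -> f t = 0].

Definition Ccinfty_null (U : set R) (u : nat -> R -> C) : Prop :=
  (exists K : set R, [/\ compact K, K `<=` U &
     forall j t, ~ K t -> u j t = 0]) /\
  (forall (k : nat) (e : R), 0 < e ->
     \forall j \near \oo, forall t, cabs (cderiv k (u j) t) <= e).

Definition Ccinfty_dual (U : set R) : set ((R -> C) -> C) :=
  antidual (Ccinfty U) (Ccinfty_null U).

Definition entire (phi : C -> C) : Prop :=
  forall z : C, derivable (phi : C^o -> C^o) z 1.

Definition Ybound (rp rm : R) (c : nat -> R) (phi : C -> C) : Prop :=
  forall (n : nat) (z : C),
    (0 <= Re z ->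
       cabs (phi z) <= c n * (1 + cabs z) ^- n * expR (rp * `|Re z|)) /\
    (Re z <= 0 ->
       cabs (phi z) <= c n * (1 + cabs z) ^- n * expR (rm * `|Re z|)).

Definition Yspace (phi : C -> C) : Prop :=
  entire phi /\
  exists (rp rm : R) (c : nat -> R), rp < 0 /\ Ybound rp rm c phi.

Definition Ynull (u : nat -> C -> C) : Prop :=
  (exists (rp rm : R) (c : nat -> R),
     rp < 0 /\ forall j, Ybound rp rm c (u j)) /\
  (forall K : set C^o, compact K -> forall e : R, 0 < e ->
     \forall j \near \oo, forall z, K z -> cabs (u j z) <= e).

Definition Ydual : set ((C -> C) -> C) := antidual Yspace Ynull.

Definition S0weight (kappa : R) (k : nat) (t : R) : R :=
  t `^ (- (1 / 2) - k%:R) * (1 + `|ln t|) `^ (- kappa).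

(** Only the values of g on R_+ matter; in particular a functional in the dual
    S_0' depends on g only through its restriction to R_+. *)
Definition S0space (g : R -> C) : Prop :=
  csmooth_on Rplus g /\
  forall (kappa : R) (k : nat), exists c : R,
    forall t, 0 < t -> cabs (cderiv k g t) <= c * S0weight kappa k t.

Definition S0null (u : nat -> R -> C) : Prop :=
  forall (kappa : R) (k : nat) (e : R), 0 < e ->
    \forall j \near \oo, forall t, 0 < t ->
      cabs (cderiv k (u j) t) <= e * S0weight kappa k t.

Definition S0dual : set ((R -> C) -> C) := antidual S0space S0null.

Definition laplace (f : R -> C) (z : C) : C :=
  cint Rplus (fun t => cexp (- (t%:C * z)) * f t).

Definition laplace_adj (sigma : (C -> C) -> C) (F : R -> C) : C :=
  sigma (laplace F).

(** sigma = (L^* )^{-1} h. *)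
Definition is_sigma_function (h : (R -> C) -> C) (sigma : (C -> C) -> C) :=
  Ydual sigma /\ forall F, Ccinfty Rplus F -> laplace_adj sigma F = h F.

(** supp sigma in [0, oo) and sigma in S_0': the functional sigma on Y is given
    by the functional sigma0 on S_0 through restriction to R_+. *)
Definition represented_in_S0dual (sigma : (C -> C) -> C)
    (sigma0 : (R -> C) -> C) : Prop :=
  S0dual sigma0 /\
  forall w, Yspace w -> sigma w = sigma0 (fun t => w t%:C).

Definition real_distribution (h : (R -> C) -> C) : Prop :=
  forall F, Ccinfty Rplus F -> (h F)^* = h (fun t => (F t)^*).

(** [x <= y] in R[i] means that y - x is real and nonnegative. *)
Definition nonneg_distribution (U : set R) (T : (R -> C) -> C) : Prop :=
  forall phi, Ccinfty U phi -> (forall t, 0 <= phi t) -> 0 <= T phi.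

(** The distribution T coincides on the open set U with the locally integrable
    function s. *)
Definition is_L1loc_on (U : set R) (T : (R -> C) -> C) (s : R -> C) : Prop :=
  [/\ locally_integrable U (fun t => Re (s t)),
      locally_integrable U (fun t => Im (s t)) &
      forall phi, Ccinfty U phi -> T phi = cint U (fun t => s t * (phi t)^*)].

(** (conj f1 * f2)(t) = int_0^t conj(f1 s) f2(t - s) ds; for t < 0 the
    interval is empty and the value is 0. *)
Definition lconv (f1 f2 : R -> C) (t : R) : C :=
  cint `[0, t]%classic (fun s => (f1 s)^* * f2 (t - s)).

Definition linear_set (M : set (R -> C)) : Prop :=
  M (fun=> 0) /\
  forall (a : C) (f g : R -> C), M f -> M g -> M (fun t => a * f t + g t).

Definition lin_indep (n : nat) (f : 'I_n -> R -> C) : Prop :=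
  forall c : 'I_n -> C, (forall t, \sum_(i < n) c i * f i t = 0) ->
    forall i, c i = 0.

Definition ldim (M : set (R -> C)) : \bar R :=
  ereal_sup [set (n%:R)%:E | n in [set n : nat |
    exists f : 'I_n -> R -> C, (forall i, M (f i)) /\ lin_indep f]].

(** N_+ for [minus = false], N_- for [minus = true]. *)
Definition Nsign (minus : bool) (h : (R -> C) -> C) : \bar R :=
  ereal_sup [set ldim M | M in [set M : set (R -> C) |
    [/\ linear_set M, M `<=` Ccinfty Rplus &
        forall f, M f -> f <> (fun=> 0) ->
          0 < (-1) ^+ minus * h (lconv f f)]]].

End Defs.

(* Main.v *)
(** Write [L] for the Laplace transform. Since [L (conj f * f) = |L f|^2] on the
    real line, the form of [h] at [f] is [sigma0 (|L f|^2)], which is the pairing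
    of [sigma] with a nonnegative function.

    Part (1): [|L f|^2] is not compactly supported in the open half-line, but
    [t^(1/2) (1 + |ln t|)^k = O(1 + t)] for every [k], so cutting it off smoothly
    near [0] and [+oo] on a logarithmic scale approximates it in [S_0] by
    nonnegative test functions.

    Part (2): choose disjoint bumps [psi_i] inside [Delta]. The Post-Widder
    operators
      [w_N(x) = x^(N+1)/N! int e^(-xt) t^N psi((N+1)/t) dt]
    are Laplace transforms of test functions, because multiplication by
    [x^(N+1)] amounts to differentiating [N + 1] times under the integral. They
    average [psi] against a Gamma density of variance [1/(N+1)] and commute with
    [x d/dx], so [w_N -> psi] with all derivatives. Hence the Gram matrix of the
    form on the corresponding test functions tends to the diagonal matrix with
    entries [int sigma psi_i^2], and is eventually definite. *)

Require Import Defs.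
From mathcomp Require Import all_boot all_order all_algebra.
From mathcomp Require Import all_classical all_reals all_analysis.
From mathcomp Require Import measurable_realfun complex.
From mathcomp Require Import ring lra.
Import Order.TTheory GRing.Theory Num.Theory.
Import numFieldNormedType.Exports.
Local Open Scope classical_set_scope.
Local Open Scope ring_scope.
Local Open Scope complex_scope.

Local Notation Re := complex.Re.
Local Notation Im := complex.Im.

(** Convergence in [S0space] is tested through one majorant instead of its family of weights.
    Functions are measured by the Euler quantities [t^i |g^(i)(t)|], which respect dilations and
    therefore suit both the logarithmic cutoffs and the Post-Widder averages. In this sense Laplace
    transforms of test functions are [O(1 / (1 + t))], while [(1 + |ln t|) / (1 + t)] still lies
    below every weight of [S0space]. The surplus logarithm pays for a cutoff at scale [c]: wherever
    the cutoff differs from 1, [1 + |ln t|] is at least [1 + ln (c / 2)]. Test functions live on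
    compact segments of the open half-line, so their integrals become integrals over segments, and
    derivatives under the integral sign come from quadratic remainder bounds. The Gamma density has
    no compact support; it is truncated at [T], with errors of order [1 / T]. *)

(** * Differentiation and integration over a compact segment *)

Section SegmentCalculus.
Set Implicit Arguments.
Unset Strict Implicit.
Context {R : realType}.
Local Notation mu := (@lebesgue_measure R).
Implicit Types (f g F : R -> R) (a b c d x t h C : R).

Lemma is_derive_continuous f f' :
  (forall t, is_derive t 1 f (f' t)) -> continuous f.
Proof.
move=> df t; apply: differentiable_continuous; apply/derivable1_diffP.
by have [] := df t.
Qed.

Lemma is_derive_derive1 f f' :
  (forall t, is_derive t 1 f (f' t)) -> derive1 f = f'.
Proof.
by move=> df; apply/funext => t; rewrite derive1E; have [_ ->] := df t.
Qed.

Lemma derivable_is_derive1 f t :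
  derivable f t 1 -> is_derive t 1 f (derive1 f t).
Proof. by move=> df; rewrite derive1E; exact/derivableP. Qed.

(** A quadratic remainder survives integration over a segment, so [is_derive_segint] can
    differentiate under the integral sign without exchanging limits. *)
Lemma is_derive_quadratic f x d C :
  (forall h, `|h| <= 1 -> `|f (x + h) - f x - h * d| <= C * h ^+ 2) ->
  is_derive x 1 f d.
Proof.
move=> H.
have C0 : 0 <= C.
  by have := H 1; rewrite normr1 expr1n mulr1 => /(_ (lexx _)); exact: le_trans.
have L : h^-1 *: ((f \o shift x) (h *: (1 : R)) - f x) @[h --> 0^'] --> d.
  apply/cvgrPdist_le => e e0.
  have e1 : 0 < Num.min 1 (e / (C + 1)).
    by rewrite lt_min ltr01/= divr_gt0// ltr_wpDl.
  near=> h.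
  have h0 : h != 0 by near: h; exact: nbhs_dnbhs_neq.
  have hs : `|h| < Num.min 1 (e / (C + 1)).
    by near: h; exact: dnbhs0_lt.
  move: hs; rewrite lt_min => /andP[h1 h2].
  have -> : d - h^-1 *: ((f \o shift x) (h *: 1) - f x) =
      - (h^-1 * (f (x + h) - f x - h * d)).
    rewrite /= -[h *: 1]/(h * 1) mulr1 [h + x]addrC /GRing.scale/=.
    by field.
  rewrite normrN normrM normfV ler_pdivrMl ?normr_gt0//.
  apply: (le_trans (H _ (ltW h1))).
  rewrite -real_normK ?num_real// expr2 mulrCA ler_wpM2l//.
  apply: (@le_trans _ _ ((C + 1) * `|h|)).
    by rewrite ler_wpM2r// lerDl.
  by rewrite mulrC -ler_pdivlMr ?ltr_wpDl// ltW.
split; first by apply/cvg_ex; exists d.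
by apply: cvg_lim.
Unshelve. all: by end_near. Qed.

(** The mean value theorem, applied to [f] and then to [f'], loses the factor 1/2 of Taylor's
    formula but allows [h] of either sign. *)
Lemma taylor2_le f f' f'' x h C :
  (forall t, is_derive t 1 f (f' t)) -> (forall t, is_derive t 1 f' (f'' t)) ->
  (forall t, `|t - x| <= `|h| -> `|f'' t| <= C) ->
  `|f (x + h) - f x - h * f' x| <= C * h ^+ 2.
Proof.
move=> df df' fC.
have mvt (u u' : R -> R) y : (forall t, is_derive t 1 u (u' t)) ->
    exists2 c, `|c - x| <= `|y| & u (x + y) - u x = u' c * y.
  move=> du; have cu := is_derive_continuous du.
  have [y0|y0] := leP 0 y.
    have xy : x <= x + y by rewrite lerDl.
    have [c] := MVT_segment xy (fun t _ => du t) (continuous_subspaceT cu).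
    rewrite in_itv/= => /andP[c1 c2] ->; exists c; last by rewrite addrC addKr.
    by rewrite !ger0_norm ?subr_ge0// lerBlDl.
  have xy : x + y <= x by rewrite gerDl ltW.
  have [c] := MVT_segment xy (fun t _ => du t) (continuous_subspaceT cu).
  rewrite in_itv/= => /andP[c1 c2] E; exists c.
    by rewrite ler0_norm ?subr_le0// ltr0_norm// opprB lerBlDr -lerBlDl opprK.
  by rewrite -[LHS]opprB E; ring.
have [c cx ->] := mvt _ _ h df.
have [c' cx' E] := mvt _ _ (c - x) df'.
rewrite mulrC -mulrBr -[in f' c](subrK x c) [c - x + x]addrC E.
rewrite normrM normrM.
have h0 := normr_ge0 h.
have B : `|f'' c'| <= C by apply: fC; exact: le_trans cx.
rewrite -[h ^+ 2]real_normK ?num_real// expr2.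
rewrite [leLHS](_ : _ = `|f'' c'| * (`|c - x| * `|h|)); last by ring.
by rewrite ler_pM ?mulr_ge0// ler_wpM2r.
Qed.

(** Not the oriented integral: for [b < a] the segment is empty and the value is 0, as the
    convolution [rconv] requires at negative times. *)
Definition segint a b f : R := \int[mu]_(t in `[a, b]) f t.

Lemma segint_integrable a b f : continuous f ->
  mu.-integrable `[a, b] (EFin \o f).
Proof.
move=> cf; apply: continuous_compact_integrable; first exact: segment_compact.
exact: continuous_subspaceT.
Qed.
Local Hint Resolve segint_integrable : core.

Lemma segintD a b f g : continuous f -> continuous g ->
  segint a b (fun t => f t + g t) = segint a b f + segint a b g.
Proof. by move=> cf cg; rewrite /segint RintegralD//; exact: segint_integrable. Qed.

Lemma segintB a b f g : continuous f -> continuous g ->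
  segint a b (fun t => f t - g t) = segint a b f - segint a b g.
Proof. by move=> cf cg; rewrite /segint RintegralB//; exact: segint_integrable. Qed.

Lemma segintZ a b f c : continuous f ->
  segint a b (fun t => c * f t) = c * segint a b f.
Proof. by move=> cf; rewrite /segint RintegralZl//; exact: segint_integrable. Qed.

Lemma eq_segint a b f g : (forall t, a <= t <= b -> f t = g t) ->
  segint a b f = segint a b g.
Proof. by move=> fg; apply: eq_Rintegral => t; rewrite inE/= in_itv/=; exact: fg. Qed.

Lemma le_segint a b f g : continuous f -> continuous g ->
  (forall t, a <= t <= b -> f t <= g t) -> segint a b f <= segint a b g.
Proof.
move=> cf cg fg; apply: le_Rintegral; rewrite //=.
- exact: segint_integrable.
- exact: segint_integrable.
Qed.

Lemma segint_cst a b c : a <= b -> segint a b (fun=> c) = c * (b - a).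
Proof.
move=> ab; rewrite /segint Rintegral_cst//= lebesgue_measure_itv/= lte_fin.
case: ltP => //= ba; have -> : a = b by apply/eqP; rewrite eq_le ab.
by rewrite subrr mulr0.
Qed.

Lemma segint_bound a b f M : a <= b -> continuous f ->
  (forall t, a <= t <= b -> `|f t| <= M) -> `|segint a b f| <= M * (b - a).
Proof.
move=> ab cf fM; rewrite -segint_cst//.
have cM (m : R) : continuous (fun _ : R => m) by move=> ?; exact: cvg_cst.
rewrite ler_norml; apply/andP; split.
  rewrite segint_cst// -mulNr -segint_cst//; apply: le_segint => // t.
  by move/fM; rewrite ler_norml => /andP[].
by apply: le_segint => // t /fM; exact: le_trans (ler_norm _).
Qed.

Lemma segint_FTC a b F f : a <= b -> (forall t, is_derive t 1 F (f t)) ->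
  continuous f -> segint a b f = F b - F a.
Proof.
rewrite le_eqVlt => /predU1P[<- _ _|ab dF cf].
  by rewrite /segint set_itv1 Rintegral_set1 subrr.
have cF := is_derive_continuous dF.
rewrite /segint /Rintegral (@continuous_FTC2 R f F)//.
- exact: continuous_subspaceT.
- split; first by move=> t _; have [] := dF t.
    exact/cvg_at_right_filter/cF.
  exact/cvg_at_left_filter/cF.
- by move=> t _; rewrite (is_derive_derive1 dF).
Qed.

Lemma segint_supp (D : set R) a b f : `[a, b] `<=` D ->
  (forall t, D t -> ~~ (a <= t <= b) -> f t = 0) ->
  \int[mu]_(t in D) f t = segint a b f.
Proof.
move=> abD f0; rewrite /segint Rintegral_mkcond [RHS]Rintegral_mkcond.
apply: eq_Rintegral => t _; rewrite /patch.
have [tab|tab] := boolP (t \in `[a, b]%classic).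
  by rewrite mem_set//; apply: abD; rewrite inE in tab.
case: ifPn => // tD; apply: f0; first by rewrite inE in tD.
by move: tab; rewrite mem_setE in_itv.
Qed.

Lemma is_derive_segint (k dk : R -> R -> R) x a b C : a <= b ->
  (forall y, continuous (k y)) -> continuous (dk x) ->
  (forall h s, `|h| <= 1 -> a <= s <= b ->
     `|k (x + h) s - k x s - h * dk x s| <= C * h ^+ 2) ->
  is_derive x 1 (fun y => segint a b (k y)) (segint a b (dk x)).
Proof.
move=> ab ck cdk H; apply: (@is_derive_quadratic _ _ _ (C * (b - a))) => h h1.
have cB (u v : R -> R) : continuous u -> continuous v ->
    continuous (fun t => u t - v t).
  by move=> cu cv t; apply: cvgB; [exact: cu|exact: cv].
have cZ : continuous (fun s => h * dk x s).
  by move=> t; apply: cvgMr; exact: cdk.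
rewrite -segintZ// -!segintB//; last exact: cB.
rewrite mulrAC; apply: segint_bound => //.
  by apply: (cB) => //; exact: cB.
by move=> t; exact: H.
Qed.

End SegmentCalculus.

(** * Smooth real functions and Euler-weighted derivative bounds *)

Section SmoothFunctions.
Set Implicit Arguments.
Unset Strict Implicit.
Context {R : realType}.
Implicit Types (f g F m : R -> R) (a b c d x t h C : R).

Lemma is_derive_addf f g t a b : is_derive t 1 f a -> is_derive t 1 g b ->
  is_derive t 1 (fun x => f x + g x) (a + b).
Proof. by move=> df dg; exact: is_deriveD. Qed.

Lemma is_derive_mulf f g t a b : is_derive t 1 f a -> is_derive t 1 g b ->
  is_derive t 1 (fun x => f x * g x) (a * g t + f t * b).
Proof.
move=> df dg; apply: (is_derive_eq (is_deriveM df dg)).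
by rewrite addrC [X in X + _]mulrC.
Qed.

Lemma is_derive_scalef f t a c : is_derive t 1 f a ->
  is_derive t 1 (fun x => c * f x) (c * a).
Proof. by move=> df; exact: is_deriveZ. Qed.

Lemma is_derive_exprn (n : nat) t : is_derive t 1 (fun x : R => x ^+ n) (n%:R * t ^+ n.-1).
Proof.
have H := @is_deriveX _ _ (fun x : R => x) n t 1 _ (@is_derive_id _ _ t (1 : R)).
rewrite -[X in is_derive _ _ _ X]mulr1.
by have <- : (fun x : R => x) ^+ n = (fun x => x ^+ n) by apply/funext => x; rewrite fctE.
Qed.

Lemma is_derive_affine f t a c d : is_derive (c * t + d) 1 f a ->
  is_derive t 1 (fun x => f (c * x + d)) (c * a).
Proof.
move=> df.
have dg : is_derive t 1 (fun x => c * x + d) (c * 1 + 0).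
  by apply: (@is_derive_addf _ (cst d)); apply: is_derive_scalef; exact: is_derive_id.
have -> : c * a = a * (c * 1 + 0) by rewrite mulr1 addr0 mulrC.
exact: (@is_derive1_comp _ f (fun x => c * x + d) t _ _ df dg).
Qed.

Record rsmooth f : Prop :=
  RSmooth { rsmooth_derivable : forall k t, derivable (derive1n k f) t 1 }.

(** Iterated derivatives never leave such a class. Smoothness proofs thus only have to name a class
    stable under one differentiation, with no formula for higher derivatives. *)
Lemma rsmooth_class (P : (R -> R) -> Prop) :
  (forall f, P f -> exists2 f', P f' & forall t, is_derive t 1 f (f' t)) ->
  forall f, P f -> rsmooth f.
Proof.
move=> HP f Pf; split=> k.
suff : P (derive1n k f) by move=> /HP[f' _ df] t; have [] := df t.
elim: k => [//|k /HP[f' Pf' df]].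
by rewrite derive1nS (is_derive_derive1 df).
Qed.

Lemma rsmooth_derive1n f k : rsmooth f -> rsmooth (derive1n k f).
Proof.
by move=> [sf]; split=> l; have := sf (l + k)%N; rewrite /derive1n iterD.
Qed.

Lemma rsmooth_derive1 f : rsmooth f -> rsmooth (derive1 f).
Proof. exact: (@rsmooth_derive1n f 1). Qed.

Lemma rsmooth_is_derive f t : rsmooth f -> is_derive t 1 f (derive1 f t).
Proof. by move=> [sf]; apply: derivable_is_derive1; exact: (sf 0). Qed.

Lemma rsmooth_continuous f : rsmooth f -> continuous f.
Proof.
by move=> sf; apply: is_derive_continuous => t; exact: rsmooth_is_derive.
Qed.

(** The derivative of a product is a sum of products, so a class stable under differentiation must
    admit sums and products together. *)
Inductive smooth_alg : (R -> R) -> Prop :=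
| smooth_alg_base f : rsmooth f -> smooth_alg f
| smooth_alg_cst c : smooth_alg (fun=> c)
| smooth_alg_id : smooth_alg (fun t => t)
| smooth_alg_add f g : smooth_alg f -> smooth_alg g ->
    smooth_alg (fun t => f t + g t)
| smooth_alg_mul f g : smooth_alg f -> smooth_alg g ->
    smooth_alg (fun t => f t * g t).

Lemma smooth_algP f : smooth_alg f -> rsmooth f.
Proof.
apply: rsmooth_class => {}f; elim => [{}f sf|c||{}f g|{}f g].
- exists (derive1 f) => [|t]; last exact: rsmooth_is_derive.
  by apply: smooth_alg_base; exact: rsmooth_derive1.
- by exists (fun=> 0) => [|t]; [exact: smooth_alg_cst|exact: is_derive_cst].
- by exists (fun=> 1) => [|t]; [exact: smooth_alg_cst|exact: is_derive_id].
- move=> _ [f' sf' df] _ [g' sg' dg]; exists (fun t => f' t + g' t) => [|t].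
    exact: smooth_alg_add.
  exact: is_derive_addf.
- move=> sf [f' sf' df] sg [g' sg' dg].
  exists (fun t => f' t * g t + f t * g' t) => [|t]; last exact: is_derive_mulf.
  by apply: smooth_alg_add; exact: smooth_alg_mul.
Qed.

Lemma rsmooth_cst c : rsmooth (fun=> c).
Proof. by apply: smooth_algP; exact: smooth_alg_cst. Qed.

Lemma rsmooth_id : rsmooth (fun t => t).
Proof. by apply: smooth_algP; exact: smooth_alg_id. Qed.

Lemma rsmoothD f g : rsmooth f -> rsmooth g -> rsmooth (fun t => f t + g t).
Proof.
by move=> sf sg; apply: smooth_algP; apply: smooth_alg_add; exact: smooth_alg_base.
Qed.

Lemma rsmoothM f g : rsmooth f -> rsmooth g -> rsmooth (fun t => f t * g t).
Proof.
by move=> sf sg; apply: smooth_algP; apply: smooth_alg_mul; exact: smooth_alg_base.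
Qed.

Lemma rsmoothZ c f : rsmooth f -> rsmooth (fun t => c * f t).
Proof. by move=> sf; apply: rsmoothM => //; exact: rsmooth_cst. Qed.

Lemma rsmoothB f g : rsmooth f -> rsmooth g -> rsmooth (fun t => f t - g t).
Proof.
move=> sf sg; rewrite [X in rsmooth X](_ : _ = fun t => f t + (-1) * g t).
  by apply: rsmoothD => //; exact: rsmoothZ.
by apply/funext => t; rewrite mulN1r.
Qed.

Lemma rsmoothX n f : rsmooth f -> rsmooth (fun t => f t ^+ n).
Proof.
move=> sf; elim: n => [|n IH]; first exact: rsmooth_cst.
rewrite [X in rsmooth X](_ : _ = fun t => f t * f t ^+ n); first exact: rsmoothM.
by apply/funext => t; rewrite exprS.
Qed.

Lemma derive1f_D f g : rsmooth f -> rsmooth g ->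
  derive1 (fun t => f t + g t) = (fun t => derive1 f t + derive1 g t).
Proof.
move=> sf sg; apply: is_derive_derive1 => t.
by apply: is_derive_addf; exact: rsmooth_is_derive.
Qed.

Lemma derive1f_M f g : rsmooth f -> rsmooth g ->
  derive1 (fun t => f t * g t) = (fun t => derive1 f t * g t + f t * derive1 g t).
Proof.
move=> sf sg; apply: is_derive_derive1 => t.
by apply: is_derive_mulf; exact: rsmooth_is_derive.
Qed.

Lemma derive1nSr k f : derive1n k.+1 f = derive1n k (derive1 f).
Proof. exact: iterSr. Qed.

Lemma derive1nD k f g : rsmooth f -> rsmooth g ->
  derive1n k (fun t => f t + g t) = (fun t => derive1n k f t + derive1n k g t).
Proof.
elim: k f g => [//|k IH] f g sf sg.
by rewrite !derive1nSr derive1f_D// IH//; exact: rsmooth_derive1.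
Qed.

Lemma derive1nZ k f c : rsmooth f ->
  derive1n k (fun t => c * f t) = (fun t => c * derive1n k f t).
Proof.
move=> sf; elim: k => [//|k IH]; rewrite derive1nS IH derive1nS.
apply: is_derive_derive1 => t; apply: is_derive_scalef.
by apply: rsmooth_is_derive; exact: rsmooth_derive1n.
Qed.

Lemma derive1nB k f g : rsmooth f -> rsmooth g ->
  derive1n k (fun t => f t - g t) = (fun t => derive1n k f t - derive1n k g t).
Proof.
move=> sf sg.
rewrite [X in derive1n k X](_ : _ = fun t => f t + (-1) * g t).
  rewrite derive1nD//; last exact: rsmoothZ.
  by rewrite derive1nZ//; apply/funext => t; rewrite mulN1r.
by apply/funext => t; rewrite mulN1r.
Qed.

Lemma derive1n_affine k f c d : rsmooth f ->
  derive1n k (fun t => f (c * t + d)) =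
  (fun t => c ^+ k * derive1n k f (c * t + d)).
Proof.
move=> sf; elim: k => [|k IH]; first by apply/funext => t; rewrite mul1r.
rewrite derive1nS IH derive1nS.
apply: is_derive_derive1 => t; rewrite exprSr -mulrA.
apply: is_derive_scalef; apply: is_derive_affine.
by apply: rsmooth_is_derive; exact: rsmooth_derive1n.
Qed.

Lemma rsmooth_affine f c d : rsmooth f -> rsmooth (fun t => f (c * t + d)).
Proof.
move=> sf; split=> k t; rewrite derive1n_affine//.
suff [] : is_derive t 1 (fun x => c ^+ k * derive1n k f (c * x + d))
    (c ^+ k * (c * derive1 (derive1n k f) (c * t + d))) by [].
apply: is_derive_scalef; apply: is_derive_affine.
by apply: rsmooth_is_derive; exact: rsmooth_derive1n.
Qed.

Lemma derive1n_cst k c : derive1n k.+1 (fun _ : R => c) = (fun=> 0).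
Proof.
elim: k => [|k IH]; first by apply: is_derive_derive1 => t; exact: is_derive_cst.
by rewrite derive1nS IH; apply: is_derive_derive1 => t; exact: is_derive_cst.
Qed.

Lemma eq_open_derive1n k f g (U : set R) t : open U -> U t ->
  (forall x, U x -> f x = g x) -> derive1n k f t = derive1n k g t.
Proof.
move=> oU Ut fg; elim: k t Ut => [|k IH] t Ut; first exact: fg.
rewrite !derive1nS !derive1E; apply: near_eq_derive.
by near=> x; apply: IH; near: x; exact: open_nbhs_nbhs.
Unshelve. all: by end_near. Qed.

Lemma derive1n_eq0 k f (U : set R) t : open U -> U t ->
  (forall x, U x -> f x = 0) -> derive1n k f t = 0.
Proof.
move=> oU Ut f0; rewrite (@eq_open_derive1n k f (fun=> 0) U)//.
by case: k => [//|k]; rewrite derive1n_cst.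
Qed.

(* The Euler weights [t ^+ i] make these bounds multiplicative: each derivative costs one factor [1 / t]. *)
Definition euler_bound k f m : Prop :=
  forall i, (i <= k)%N -> forall t, 0 < t -> t ^+ i * `|derive1n i f t| <= m t.

Lemma euler_bound_ge0 k f m t : euler_bound k f m -> 0 < t -> 0 <= m t.
Proof. by move=> fm t0; apply: le_trans (fm 0%N _ _ t0); rewrite // mul1r. Qed.

(** Leibniz rule: the weight [t^i] splits between the two factors, and the binomial coefficients sum
    to [2^i], at most [2^k]. *)
Lemma euler_boundM k f g m m' : rsmooth f -> rsmooth g ->
  euler_bound k f m -> euler_bound k g m' ->
  euler_bound k (fun t => f t * g t) (fun t => 2 ^+ k * (m t * m' t)).
Proof.
move=> sf sg fm gm i ik t t0.
have m0 := euler_bound_ge0 fm t0; have m'0 := euler_bound_ge0 gm t0.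
apply: (@le_trans _ _ (2 ^+ i * (m t * m' t))); last first.
  by rewrite ler_wpM2r ?mulr_ge0// ler_weXn2l// ler1n.
have {}fm : euler_bound i f m by move=> j ji; apply: fm; exact: leq_trans ik.
have {}gm : euler_bound i g m' by move=> j ji; apply: gm; exact: leq_trans ik.
elim: i f g m m' sf sg fm gm {m0 m'0 ik} => [|i IH] f g m m' sf sg fm gm.
  rewrite !mul1r normrM ler_pM//.
  - by have := fm 0%N isT t t0; rewrite mul1r.
  - by have := gm 0%N isT t t0; rewrite mul1r.
(* The derivative of [u] obeys the bound [v x / x]. The factor [t] set aside from [t^(i+1)] cancels
   this division in both terms of the product rule. *)
have bS u v : euler_bound i.+1 u v -> euler_bound i (derive1 u) (fun x => v x / x).
  move=> uv j ji x x0; rewrite -derive1nSr ler_pdivlMr// mulrAC -exprSr.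
  exact: uv.
have bW u v : euler_bound i.+1 u v -> euler_bound i u v.
  by move=> uv j ji; apply: uv; rewrite ltnW.
have sf' := rsmooth_derive1 sf; have sg' := rsmooth_derive1 sg.
rewrite derive1nSr derive1f_M// derive1nD; [|exact: rsmoothM..].
have H1 := IH _ _ _ _ sf' sg (bS _ _ fm) (bW _ _ gm).
have H2 := IH _ _ _ _ sf sg' (bW _ _ fm) (bS _ _ gm).
set A := derive1n i _ t in H1 *; set B := derive1n i _ t in H2 *.
apply: (@le_trans _ _ (t * (t ^+ i * `|A| + t ^+ i * `|B|))).
  by rewrite -mulrDr mulrA -exprS ler_pM2l ?exprn_gt0// ler_normD.
apply: (@le_trans _ _ (t * (2 ^+ i * (m t / t * m' t) + 2 ^+ i * (m t * (m' t / t))))).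
  by rewrite ler_pM2l// lerD.
rewrite le_eqVlt; apply/orP; left; apply/eqP; rewrite exprS; field.
by rewrite gt_eqF.
Qed.

End SmoothFunctions.

(** * Flat functions, bumps and a smooth step *)

Section FlatFunctions.
Set Implicit Arguments.
Unset Strict Implicit.
Context {R : realType}.
Implicit Types (f g : R -> R) (P : {poly R}) (t x y h : R).

(** The [n]-th power of [y / n <= 1 + y / n <= exp (y / n)]. *)
Lemma exprn_le_expR n y : 0 <= y -> y ^+ n <= n%:R ^+ n * expR y.
Proof.
move=> y0; case: n => [|n].
  by rewrite !expr0 mul1r -expR0 ler_expR.
have n0 : (0 : R) < n.+1%:R by rewrite ltr0n.
have E : y = n.+1%:R * (y / n.+1%:R) by rewrite mulrCA divff ?gt_eqF// mulr1.
rewrite {1 2}E expRM_natl exprMn ler_pM2l ?exprn_gt0//.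
apply: lerXn2r; rewrite ?nnegrE ?expR_ge0 ?divr_ge0 ?(ltW n0)//.
by apply: le_trans (expR_ge1Dx _); rewrite lerDr.
Qed.

Lemma horner_le_exprn P : exists2 A : R, 0 <= A &
  forall y, 1 <= y -> `|P.[y]| <= A * y ^+ size P.
Proof.
exists (\sum_(i < size P) `|P`_i|) => [|y y1]; first exact: sumr_ge0.
rewrite horner_coef; apply: (le_trans (ler_norm_sum _ _ _)).
rewrite mulr_suml ler_sum// => i _; rewrite normrM ler_wpM2l//.
by rewrite normrX ger0_norm ?(le_trans ler01 y1)// ler_weXn2l// ltnW.
Qed.

(** The polynomial in [1 / t] makes the family stable under differentiation, which sends [P] to
    [X^2 (P - P')]. *)
Definition flat P t : R := if 0 < t then P.[t^-1] * expR (- t^-1) else 0.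

Lemma flat_le0 P t : t <= 0 -> flat P t = 0.
Proof. by rewrite /flat leNgt => /negbTE ->. Qed.

Lemma is_derive_flat P t :
  is_derive t 1 (flat P) (flat ('X^2 * (P - P^`())) t).
Proof.
have [t0|t0|->] := ltgtP t 0.
- rewrite [flat ('X^2 * _) t]flat_le0 ?ltW//.
  apply: (@near_eq_is_derive _ R R (fun=> 0)).
  near=> x; rewrite flat_le0// ltW//; near: x; exact: lt_nbhsl.
- have tn0 : t != 0 by rewrite gt_eqF.
  apply: (@near_eq_is_derive _ R R (fun x => P.[x^-1] * expR (- x^-1))).
    by near=> x; rewrite /flat ifT//; near: x; exact: lt_nbhsr.
  have dV : is_derive t 1 (fun x : R => x^-1) (- t ^- 2).
    by apply: is_derive_eq; [exact: is_deriveV|rewrite /GRing.scale/= mulr1].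
  have dP : is_derive t 1 (fun x : R => P.[x^-1]) (P^`().[t^-1] * - t ^- 2).
    exact: (@is_derive1_comp _ (horner P) (fun x => x^-1) t _ _ _ dV).
  have dE : is_derive t 1 (fun x : R => expR (- x^-1)) (expR (- t^-1) * - - t ^- 2).
    have dN : is_derive t 1 (fun x : R => - x^-1) (- - t ^- 2) by exact: is_deriveN dV.
    exact: (@is_derive1_comp _ expR (fun x => - x^-1) t _ _ _ dN).
  apply: (is_derive_eq (is_derive_mulf dP dE)).
  by rewrite /flat t0 hornerM hornerXn hornerD hornerN exprVn; ring.
- rewrite [flat ('X^2 * _) 0]flat_le0//.
  have [A A0 HA] := horner_le_exprn P.
  (* [size P] powers of [1 / h] dominate the polynomial; the two extra ones yield the [h^2] of the
     quadratic remainder at the origin. *)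
  pose n := (size P + 2)%N.
  apply: (@is_derive_quadratic _ _ _ _ (A * n%:R ^+ n)) => h h1.
  rewrite add0r [flat P 0]flat_le0// subr0 mulr0 subr0.
  have [h0|h0] := leP h 0.
    by rewrite flat_le0// normr0 mulr_ge0 ?sqr_ge0// mulr_ge0// exprn_ge0.
  rewrite /flat h0 normrM [`|expR _|]ger0_norm ?expR_ge0//.
  rewrite expRN ler_pdivrMr ?expR_gt0// mulrAC -ler_pdivrMr ?exprn_gt0//.
  have h1' : 1 <= h^-1 by rewrite invf_ge1// (le_trans (ler_norm _)).
  apply: (@le_trans _ _ (A * (h^-1) ^+ n)).
    rewrite /n exprD mulrA -exprVn ler_pM2r ?invr_gt0 ?exprn_gt0 ?invr_gt0//.
    exact: HA.
  by rewrite -mulrA ler_wpM2l// exprn_le_expR// invr_ge0 ltW.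
Unshelve. all: by end_near. Qed.

Lemma rsmooth_flat P : rsmooth (flat P).
Proof.
apply: (@rsmooth_class _ (fun f => exists Q, f = flat Q)); last by exists P.
move=> _ [Q ->]; exists (flat ('X^2 * (Q - Q^`()))); first by eexists.
by move=> t; exact: is_derive_flat.
Qed.

Lemma rsmoothV f : rsmooth f -> (forall t, f t != 0) ->
  rsmooth (fun t => (f t)^-1).
Proof.
move=> sf f0.
(* The quotients [g / f^n] are stable under differentiation; the reciprocal alone is not. *)
apply: (@rsmooth_class _ (fun u => exists g n, rsmooth g /\
  u = fun t => g t * (f t) ^- n)); last first.
  exists (fun=> 1), 1%N; split; first exact: rsmooth_cst.
  by apply/funext => t; rewrite expr1 mul1r.
move=> _ [g [n [sg ->]]].
exists (fun t => (derive1 g t * f t - n%:R * (g t * derive1 f t)) * (f t) ^- n.+1).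
  eexists _, n.+1; split; last reflexivity.
  apply: rsmoothB; first by apply: rsmoothM => //; exact: rsmooth_derive1.
  by apply: rsmoothZ; apply: rsmoothM => //; exact: rsmooth_derive1.
move=> t.
have dX : is_derive t 1 (fun x => f x ^+ n) (n%:R * f t ^+ n.-1 * derive1 f t).
  have H := @is_deriveX _ _ f n t 1 _ (rsmooth_is_derive t sf).
  by have <- : f ^+ n = (fun x => f x ^+ n) by apply/funext => x; rewrite fctE.
have dV : is_derive t 1 (fun x => (f x) ^- n)
    (- (f t ^+ n) ^- 2 * (n%:R * f t ^+ n.-1 * derive1 f t)).
  exact: (@is_deriveV _ (fun x => f x ^+ n) t _ 1 (expf_neq0 n (f0 t)) dX).
apply: (is_derive_eq (is_derive_mulf (rsmooth_is_derive t sg) dV)).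
have ft := f0 t; case: n {dX dV} => [|n]; first by rewrite !expr0 expr1; field.
by rewrite !exprS /=; field; rewrite ft expf_neq0.
Qed.

Definition bump t : R := flat 1 t.

Lemma bump_gt0 t : 0 < t -> 0 < bump t.
Proof. by move=> t0; rewrite /bump /flat t0 hornerC mul1r expR_gt0. Qed.

Lemma bump_le0 t : t <= 0 -> bump t = 0.
Proof. exact: flat_le0. Qed.

Lemma bump_ge0 t : 0 <= bump t.
Proof. by have [/bump_le0 ->//|/bump_gt0/ltW] := leP t 0. Qed.

Lemma rsmooth_bump c d : rsmooth (fun t => bump (c * t + d)).
Proof. by apply: rsmooth_affine; exact: rsmooth_flat. Qed.

Lemma smooth_step_exists : exists alpha : R -> R,
  [/\ rsmooth alpha, forall t, 0 <= alpha t <= 1,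
      forall t, t <= 1 -> alpha t = 0 & forall t, 2 <= t -> alpha t = 1].
Proof.
pose u t := bump (1 * t + - 1); pose v t := bump (- 1 * t + 2).
have uv0 t : 0 < u t + v t.
  have [t1|t1] := leP t 1.
    by rewrite ltr_wpDl ?bump_ge0// bump_gt0// mulN1r addrC subr_gt0 (le_lt_trans t1)// ltr1n.
  by rewrite ltr_pwDl ?bump_ge0// bump_gt0// mul1r subr_gt0.
have su : rsmooth u by exact: rsmooth_bump.
have sv : rsmooth v by exact: rsmooth_bump.
exists (fun t => u t * (u t + v t)^-1); split.
- apply: rsmoothM => //; apply: rsmoothV; first exact: rsmoothD.
  by move=> t; rewrite gt_eqF.
- move=> t; rewrite divr_ge0 ?(ltW (uv0 t)) ?bump_ge0//=.
  by rewrite ler_pdivrMr// mul1r lerDl bump_ge0.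
- by move=> t t1; rewrite /u bump_le0 ?mul0r// mul1r subr_le0.
- move=> t t2; rewrite [v t]bump_le0 ?addr0; last by rewrite mulN1r addrC subr_le0.
  by rewrite divff// /u gt_eqF// bump_gt0// mul1r subr_gt0 (lt_le_trans _ t2)// ltr1n.
Qed.

End FlatFunctions.

(** * The real Laplace transform of real test functions *)

Section RealLaplace.
Set Implicit Arguments.
Unset Strict Implicit.
Context {R : realType}.
Local Notation mu := (@lebesgue_measure R).
Implicit Types (f g : R -> R) (a b c x y t h M : R).

Definition supp_in a b f : Prop := forall t, ~~ (a <= t <= b) -> f t = 0.

Definition rtest_on a b f : Prop := [/\ rsmooth f, 0 < a, a <= b & supp_in a b f].

Definition rtest f : Prop := exists a b, rtest_on a b f.

Lemma rtest_smooth f : rtest f -> rsmooth f.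
Proof. by move=> [a [b []]]. Qed.

Lemma segment_bounded a b f : continuous f ->
  exists2 M, 0 <= M & forall t, a <= t <= b -> `|f t| <= M.
Proof.
move=> cf; have [ab|ba] := leP a b; last first.
  by exists 0 => // t /andP[at_ tb]; have := le_lt_trans (le_trans at_ tb) ba; rewrite ltxx.
have cn : continuous (fun t => `|f t|).
  by move=> t; apply: continuous_comp; [exact: cf|exact: norm_continuous].
have [c _ H] := EVT_max ab (continuous_subspaceT cn).
by exists `|f c| => // t tab; apply: H; rewrite in_itv.
Qed.

Lemma supp_in_widen a b c d f : c <= a -> b <= d -> supp_in a b f -> supp_in c d f.
Proof.
move=> ca bd sf t /negP tcd; apply: sf; apply/negP => /andP[at_ tb]; apply: tcd.
by rewrite (le_trans ca)// (le_trans tb).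
Qed.

Lemma rtest_common f g : rtest f -> rtest g ->
  exists a b, rtest_on a b f /\ rtest_on a b g.
Proof.
move=> [a1 [b1 [sf a10 ab1 f0]]] [a2 [b2 [sg a20 ab2 g0]]].
exists (Num.min a1 a2), (Num.max b1 b2); split; split=> //.
- by rewrite lt_min a10.
- by rewrite ge_min le_max ab1.
- by apply: supp_in_widen f0; rewrite ?ge_min ?le_max lexx.
- by rewrite lt_min a10.
- by rewrite ge_min le_max ab1.
- by apply: supp_in_widen g0; rewrite ?ge_min ?le_max lexx orbT.
Qed.

Lemma supp_in_derive1n a b f k : supp_in a b f -> supp_in a b (derive1n k f).
Proof.
move=> sf t; rewrite negb_and -!ltNge => /orP[ta|bt].
  apply: (@derive1n_eq0 _ _ _ [set x : R | x < a]) => //.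
  by move=> x xa; apply: sf; rewrite negb_and -ltNge xa.
apply: (@derive1n_eq0 _ _ _ [set x : R | b < x]) => //.
by move=> x bx; apply: sf; rewrite negb_and -!ltNge bx orbT.
Qed.

Lemma supp_inM a b f g : supp_in a b f -> supp_in a b (fun t => g t * f t).
Proof. by move=> sf t tab; rewrite sf// mulr0. Qed.

Lemma rtest_on_derive1n a b f k : rtest_on a b f -> rtest_on a b (derive1n k f).
Proof. by move=> [sf a0 ab /supp_in_derive1n]; split=> //; exact: rsmooth_derive1n. Qed.

Lemma rtest_onM a b f g : rsmooth g -> rtest_on a b f ->
  rtest_on a b (fun t => g t * f t).
Proof. by move=> sg [sf a0 ab /supp_inM]; split=> //; exact: rsmoothM. Qed.

Lemma rtest_derive1n f k : rtest f -> rtest (derive1n k f).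
Proof. by move=> [a [b /rtest_on_derive1n H]]; exists a, b. Qed.

Lemma rtestM f g : rsmooth g -> rtest f -> rtest (fun t => g t * f t).
Proof. by move=> sg [a [b /(rtest_onM sg) H]]; exists a, b. Qed.

Lemma rtest_bounded f : rtest f -> exists2 M, 0 <= M & forall t, `|f t| <= M.
Proof.
move=> [a [b [sf a0 ab f0]]].
have [M M0 H] := @segment_bounded a b _ (rsmooth_continuous sf).
exists M => // t; have [/H//|/f0 ->] := boolP (a <= t <= b).
by rewrite normr0.
Qed.

Definition rlap f x : R := \int[mu]_(t in Rplus) (expR (- (t * x)) * f t).

Lemma segment_subRplus a b : 0 < a -> `[a, b] `<=` (@Rplus R).
Proof.
move=> a0 t /=; rewrite in_itv/= => /andP[at_ _].
by rewrite /Rplus/= in_itv/= andbT (lt_le_trans a0).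
Qed.

Lemma rlap_segint a b f x : rtest_on a b f ->
  rlap f x = segint a b (fun t => expR (- (t * x)) * f t).
Proof.
move=> [sf a0 ab f0]; apply: segint_supp; first exact: segment_subRplus.
by move=> t _ /f0 ->; rewrite mulr0.
Qed.

Lemma is_derive_expR_scale c t :
  is_derive t 1 (fun s => expR (- (s * c))) (- c * expR (- (t * c))).
Proof.
have dl : is_derive t 1 (fun s => - (s * c)) (- c).
  rewrite [X in is_derive _ _ X](_ : _ = fun s => - c * s); last first.
    by apply/funext => s; rewrite mulNr mulrC.
  by rewrite -[X in is_derive _ _ _ X]mulr1; apply: is_derive_scalef; exact: is_derive_id.
rewrite mulrC; exact: (@is_derive1_comp _ expR (fun s => - (s * c)) t _ _ _ dl).
Qed.

Lemma rsmooth_expR_scale c : rsmooth (fun t => expR (- (t * c))).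
Proof.
apply: (@rsmooth_class _ (fun f => exists e, f = fun t => e * expR (- (t * c)))).
  move=> _ [e ->]; exists (fun t => e * (- c * expR (- (t * c)))).
    by exists (e * - c); apply/funext => t; rewrite mulrA.
  by move=> t; apply: is_derive_scalef; exact: is_derive_expR_scale.
by exists 1; apply/funext => t; rewrite mul1r.
Qed.

Lemma rlap_integrand_continuous f x : rsmooth f ->
  continuous (fun t => expR (- (t * x)) * f t).
Proof.
move=> sf; apply: rsmooth_continuous; apply: rsmoothM => //.
exact: rsmooth_expR_scale.
Qed.

Lemma rsmooth_opp : rsmooth (fun t : R => - t).
Proof.
have E : (fun t : R => (-1) * t) = (fun t => - t).
  by apply/funext => t; rewrite mulN1r.
by have := rsmoothZ (-1) (@rsmooth_id R); rewrite E.
Qed.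

Lemma is_derive_rlap f x : rtest f ->
  is_derive x 1 (rlap f) (rlap (fun t => - t * f t) x).
Proof.
move=> [a [b T]]; have [sf a0 ab f0] := T.
have sN := rsmooth_opp.
have T' := rtest_onM sN T; have [sf' _ _ _] := T'.
rewrite (rlap_segint _ T').
rewrite (_ : rlap f = fun y => segint a b (fun t => expR (- (t * y)) * f t)); last first.
  by apply/funext => y; exact: rlap_segint.
have [M M0 HM] := @segment_bounded a b _ (rsmooth_continuous sf).
(* Bounds [exp (- s y)] for [s] in the support and [|y - x| <= 1]; with [s^2 <= b^2] it controls the
   second derivative in [y]. *)
pose E := expR (b * (`|x| + 1)).
apply: (@is_derive_segint _ (fun y t => expR (- (t * y)) * f t)
  (fun y t => expR (- (t * y)) * (- t * f t)) _ _ _ (b ^+ 2 * E * M)) => //.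
- by move=> y; exact: rlap_integrand_continuous.
- exact: rlap_integrand_continuous.
move=> h s h1 sab; have /andP[as_ sb] := sab.
have s0 : 0 <= s by rewrite (le_trans (ltW a0)).
rewrite [X in `|X|](_ : _ = (expR (- (s * (x + h))) - expR (- (s * x))
   - h * (- s * expR (- (s * x)))) * f s); last by ring.
rewrite normrM [leRHS]mulrAC ler_pM ?HM//.
rewrite (mulrC s x) (mulrC s (x + h)).
apply: (@taylor2_le _ (fun y => expR (- (y * s))) (fun y => - s * expR (- (y * s)))
  (fun y => - s * (- s * expR (- (y * s))))) => t.
- exact: is_derive_expR_scale.
- by apply: is_derive_scalef; exact: is_derive_expR_scale.
move=> tx; rewrite mulrA mulrNN -expr2 normrM ger0_norm ?sqr_ge0//.
rewrite ger0_norm ?expR_ge0// ler_pM ?sqr_ge0 ?expR_ge0//.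
  by rewrite lerXn2r ?nnegrE ?(le_trans s0).
rewrite ler_expR -mulNr mulrC; apply: (le_trans (ler_norm _)).
rewrite normrM normrN (ger0_norm s0) ler_pM//.
by rewrite -[t](subrK x) (le_trans (ler_normD _ _))// addrC lerD2l (le_trans tx).
Qed.

Lemma rsmooth_rlap f : rtest f -> rsmooth (rlap f).
Proof.
move=> tf; apply: (@rsmooth_class _ (fun u => exists2 g, rtest g & u = rlap g)).
  move=> _ [g tg ->]; exists (rlap (fun t => - t * g t)).
    exists (fun t => - t * g t) => //; apply: rtestM tg.
    exact: rsmooth_opp.
  by move=> t; exact: is_derive_rlap.
by exists f.
Qed.

(** [supp_in] says nothing about the endpoints themselves. On a wider segment the function vanishes
    there, which removes the boundary terms of an integration by parts. *)
Lemma rtest_on_boundary a b f : rtest_on a b f ->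
  exists a' b', [/\ rtest_on a' b' f, f a' = 0 & f b' = 0].
Proof.
move=> [sf a0 ab f0]; exists (a / 2), (b + 1).
have a2 : a / 2 < a by rewrite ltr_pdivrMr// ltr_pMr// ltr1n.
have b1 : b < b + 1 by rewrite ltrDl.
split.
- split=> //; first by rewrite divr_gt0.
    by rewrite (le_trans (ltW a2))// (le_trans ab) ?ltW.
  by apply: supp_in_widen f0; rewrite ltW.
- by apply: f0; rewrite negb_and -ltNge a2.
- by apply: f0; rewrite negb_and -!ltNge b1 orbT.
Qed.

Lemma rlap_derive1 f x : rtest f -> rlap (derive1 f) x = x * rlap f x.
Proof.
move=> [a0 [b0 /rtest_on_boundary [a [b [T fa fb]]]]]; have [sf _ ab _] := T.
have T' : rtest_on a b (derive1 f) := rtest_on_derive1n 1 T.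
rewrite (rlap_segint _ T) (rlap_segint _ T').
apply/eqP; rewrite -subr_eq0; apply/eqP.
have sf' := rsmooth_derive1 sf.
rewrite -segintZ; last exact: rlap_integrand_continuous.
rewrite -segintB; last 2 first.
- exact: rlap_integrand_continuous.
- apply: rsmooth_continuous; apply: rsmoothZ; apply: rsmoothM => //.
  exact: rsmooth_expR_scale.
transitivity (expR (- (b * x)) * f b - expR (- (a * x)) * f a); last first.
  by rewrite fa fb !mulr0 subrr.
apply: (@segint_FTC _ a b (fun t => expR (- (t * x)) * f t)) => //.
- move=> t; apply: (is_derive_eq (is_derive_mulf (is_derive_expR_scale x t)
    (rsmooth_is_derive t sf))); ring.
- apply: rsmooth_continuous; apply: rsmoothB.
    by apply: rsmoothM => //; exact: rsmooth_expR_scale.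
  by apply: rsmoothZ; apply: rsmoothM => //; exact: rsmooth_expR_scale.
Qed.

Lemma rlap_derive1n k f x : rtest f -> rlap (derive1n k f) x = x ^+ k * rlap f x.
Proof.
move=> tf; elim: k => [|k IH]; first by rewrite mul1r.
by rewrite derive1nS rlap_derive1 ?IH ?exprS ?mulrA//; exact: rtest_derive1n.
Qed.

Lemma rlap_bounded f : rtest f ->
  exists2 C, 0 <= C & forall x, 0 <= x -> `|rlap f x| <= C.
Proof.
move=> [a [b T]]; have [sf a0 ab f0] := T.
have [M M0 HM] := @segment_bounded a b _ (rsmooth_continuous sf).
exists (M * (b - a)) => [|x x0]; first by rewrite mulr_ge0// subr_ge0.
rewrite (rlap_segint _ T); apply: segint_bound => //.
  exact: rlap_integrand_continuous.
move=> t tab; have /andP[at_ tb] := tab.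
rewrite normrM -[M]mul1r ler_pM// ?HM// ger0_norm ?expR_ge0//.
by rewrite -expR0 ler_expR oppr_le0 mulr_ge0// (le_trans (ltW a0)).
Qed.

Lemma rlap_derive1n_exists k f : rtest f ->
  exists2 g, rtest g & derive1n k (rlap f) = rlap g.
Proof.
move=> tf; elim: k => [|k [g tg E]]; first by exists f.
exists (fun t => - t * g t).
  by apply: rtestM tg; exact: rsmooth_opp.
by rewrite derive1nS E; apply: is_derive_derive1 => t; exact: is_derive_rlap.
Qed.

(** A derivative of a Laplace transform is the transform of another test function, and powers of [x]
    in front of it are derivatives of that function. Using [i] and [i + 1] powers gives the decay
    [1 / (1 + t)]. *)
Lemma rlap_euler_bound k f : rtest f ->
  exists2 C, 0 <= C & euler_bound k (rlap f) (fun t => C / (1 + t)).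
Proof.
move=> tf.
have H i : exists2 C, 0 <= C & forall t, 0 < t ->
    t ^+ i * `|derive1n i (rlap f) t| <= C / (1 + t).
  have [g tg ->] := rlap_derive1n_exists i tf.
  have [C1 C10 H1] := rlap_bounded (rtest_derive1n i tg).
  have [C2 C20 H2] := rlap_bounded (rtest_derive1n i.+1 tg).
  exists (C1 + C2) => [|t t0]; first exact: addr_ge0.
  have t0' := ltW t0.
  rewrite ler_pdivlMr; last by rewrite addr_gt0.
  rewrite mulrDr mulr1 lerD//.
    by have := H1 _ t0'; rewrite rlap_derive1n// normrM (ger0_norm (exprn_ge0 _ t0')).
  have := H2 _ t0'; rewrite rlap_derive1n// normrM (ger0_norm (exprn_ge0 _ t0')).
  by rewrite exprSr mulrAC.
elim: k => [|k [C C0 HC]].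
  by have [C C0 HC] := H 0%N; exists C => // i; rewrite leqn0 => /eqP -> t /HC.
have [C' C'0 HC'] := H k.+1; exists (C + C') => [|i]; first exact: addr_ge0.
rewrite leq_eqVlt => /predU1P[->|ik] t t0.
  apply: (le_trans (HC' _ t0)).
  by rewrite ler_pM2r ?lerDr// invr_gt0 addr_gt0.
apply: (le_trans (HC i ik _ t0)).
by rewrite ler_pM2r ?lerDl// invr_gt0 addr_gt0.
Qed.

End RealLaplace.

(** * Modulus, exponential and segment integrals of complex-valued functions *)

Section ComplexBasics.
Set Implicit Arguments.
Unset Strict Implicit.
Context {R : realType}.
Local Notation C := R[i].
Implicit Types (z w : C) (f g F : R -> C) (a b c x y t h M : R).

Lemma cReM z w : Re (z * w) = Re z * Re w - Im z * Im w.
Proof. by case: z => ? ?; case: w. Qed.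

Lemma cImM z w : Im (z * w) = Re z * Im w + Im z * Re w.
Proof. by case: z => ? ?; case: w => ? ? /=; ring. Qed.

Lemma cReD z w : Re (z + w) = Re z + Re w.
Proof. by case: z => ? ?; case: w. Qed.

Lemma cImD z w : Im (z + w) = Im z + Im w.
Proof. by case: z => ? ?; case: w. Qed.

Lemma cReN z : Re (- z) = - Re z. Proof. by case: z. Qed.

Lemma cImN z : Im (- z) = - Im z. Proof. by case: z. Qed.

Definition cE := (cReD, cImD, cReN, cImN, cReM, cImM).

Lemma cabs_norm z : (cabs z)%:C = `|z|.
Proof. by case: z => p q; rewrite normc_def. Qed.

Lemma cabs_ge0 z : 0 <= cabs z. Proof. exact: sqrtr_ge0. Qed.

Lemma cabsM z w : cabs (z * w) = cabs z * cabs w.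
Proof. by apply: complexI; rewrite rmorphM/= !cabs_norm normrM. Qed.

Lemma cabsN z : cabs (- z) = cabs z.
Proof. by apply: complexI; rewrite !cabs_norm normrN. Qed.

Lemma cabsX z n : cabs (z ^+ n) = cabs z ^+ n.
Proof. by apply: complexI; rewrite rmorphXn/= !cabs_norm normrX. Qed.

Lemma le_cabsD z w : cabs (z + w) <= cabs z + cabs w.
Proof. by rewrite -lecR rmorphD/= !cabs_norm ler_normD. Qed.

Lemma cabs_real x : cabs x%:C = `|x|.
Proof. by rewrite /cabs /= expr0n/= addr0 sqrtr_sqr. Qed.

Lemma Re_le_cabs z : `|Re z| <= cabs z.
Proof. by rewrite -sqrtr_sqr ler_wsqrtr// lerDl sqr_ge0. Qed.

Lemma Im_le_cabs z : `|Im z| <= cabs z.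
Proof. by rewrite -sqrtr_sqr ler_wsqrtr// lerDr sqr_ge0. Qed.

Lemma cabs_le_ReIm z : cabs z <= `|Re z| + `|Im z|.
Proof.
case: z => p q; rewrite (_ : p +i* q = p%:C + 'i%C * q%:C); last first.
  by apply/eqP; rewrite eq_complex/= !(mul0r, mul1r, subr0, mulr0, add0r, addr0, subrr)//= !eqxx.
apply: (le_trans (le_cabsD _ _)); rewrite cabsM !cabs_real.
rewrite [cabs 'i%C](_ : _ = 1); last by rewrite /cabs/= expr0n/= add0r expr1n sqrtr1.
by rewrite mul1r !(cReD, cReM, cImD, cImM)/= !(mul0r, mul1r, subr0, mulr0, add0r, addr0).
Qed.

Lemma sqr_cabs z : cabs z ^+ 2 = Re z ^+ 2 + Im z ^+ 2.
Proof. by rewrite /cabs sqr_sqrtr// addr_ge0 ?sqr_ge0. Qed.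

Lemma cexpD z w : cexp (z + w) = cexp z * cexp w.
Proof.
apply/eqP; rewrite eq_complex cReM cImM /= cReD cImD expRD cosD sinD.
by apply/andP; split; apply/eqP; ring.
Qed.

Lemma cabs_cexp z : cabs (cexp z) = expR (Re z).
Proof.
rewrite /cabs /cexp /= !exprMn -mulrDr cos2Dsin2 mulr1 sqrtr_sqr.
by rewrite ger0_norm// expR_ge0.
Qed.

(** Real and imaginary part each split into two terms bounded by [exp B |z|^2] through the real
    Taylor bounds, whence the constant 4. *)
Lemma cexp_quadratic z B : cabs z <= B ->
  cabs (cexp z - 1 - z) <= 4 * expR B * cabs z ^+ 2.
Proof.
move=> zB; have B0 : 0 <= B := le_trans (cabs_ge0 z) zB.
have pz := Re_le_cabs z; have qz := Im_le_cabs z.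
set p := Re z in pz *; set q := Im z in qz *; set r := cabs z in zB pz qz *.
have r0 : 0 <= r := cabs_ge0 z.
have E1 : 1 <= expR B by rewrite -expR0 ler_expR.
have dE t : is_derive t 1 (@expR R) (expR t) by exact: is_derive_expR.
have Hexp : `|expR p - 1 - p| <= expR B * p ^+ 2.
  have := @taylor2_le _ expR expR expR 0 p (expR B) dE dE.
  rewrite add0r expR0 mulr1; apply => t; rewrite subr0 => tp.
  rewrite ger0_norm ?expR_ge0// ler_expR (le_trans (ler_norm _))//.
  by rewrite (le_trans tp)// (le_trans pz).
have dc t : is_derive t 1 (@cos R) (- sin t) by exact: is_derive_cos.
have ds t : is_derive t 1 (@sin R) (cos t) by exact: is_derive_sin.
have dNs t : is_derive t 1 (fun x => - sin x) (- cos t : R) by exact: is_deriveN.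
have Hcos : `|cos q - 1| <= q ^+ 2.
  have := @taylor2_le _ cos (fun x => - sin x) (fun x => - cos x) 0 q 1 dc dNs.
  rewrite add0r cos0 sin0 oppr0 mulr0 subr0 mul1r; apply => t _.
  by rewrite normrN ler_norml cos_geN1 cos_le1.
have Hsin : `|sin q - q| <= q ^+ 2.
  have := @taylor2_le _ sin cos (fun x => - sin x) 0 q 1 ds dc.
  rewrite add0r cos0 sin0 mulr1 subr0 mul1r; apply => t _.
  by rewrite normrN ler_norml sin_geN1 sin_le1.
have Hexp1 : `|expR p - 1| <= expR B * r.
  have [c cB E] : exists2 c, `|c| <= `|p| & expR p - 1 = expR c * p.
    have cE := is_derive_continuous dE.
    have [p0|p0] := leP 0 p.
      have [c] := MVT_segment p0 (fun t _ => dE t) (continuous_subspaceT cE).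
      rewrite in_itv/= expR0 subr0 => /andP[c0 cp] E; exists c => //.
      by rewrite !ger0_norm.
    have [c] := MVT_segment (ltW p0) (fun t _ => dE t) (continuous_subspaceT cE).
    rewrite in_itv/= expR0 => /andP[c0 cp] E; exists c.
      by rewrite !ler0_norm// ?lerN2// ltW.
    by rewrite -[LHS]opprB E; ring.
  rewrite E normrM ger0_norm ?expR_ge0// ler_pM ?expR_ge0//.
  by rewrite ler_expR (le_trans (ler_norm _))// (le_trans cB)// (le_trans pz).
have eB : expR p <= expR B by rewrite ler_expR (le_trans (ler_norm _))// (le_trans pz).
have p2 : p ^+ 2 <= r ^+ 2 by rewrite -real_normK ?num_real// lerXn2r ?nnegrE.
have q2 : q ^+ 2 <= r ^+ 2 by rewrite -real_normK ?num_real// lerXn2r ?nnegrE.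
have e0 := expR_ge0 p; have eB0 := expR_ge0 B.
apply: (le_trans (cabs_le_ReIm _)); rewrite !cE /= -/p -/q.
rewrite (_ : 4 * expR B * r ^+ 2 = 2 * (expR B * r ^+ 2) + 2 * (expR B * r ^+ 2)); last by ring.
apply: lerD.
  rewrite [X in `|X|](_ : _ = expR p * (cos q - 1) + (expR p - 1 - p)); last by ring.
  apply: (le_trans (ler_normD _ _)); rewrite mulr_natl mulr2n lerD//.
    rewrite normrM (ger0_norm e0) ler_pM// (le_trans Hcos)//.
  by rewrite (le_trans Hexp)// ler_wpM2l.
rewrite [X in `|X|](_ : _ = expR p * (sin q - q) + (expR p - 1) * q); last by ring.
apply: (le_trans (ler_normD _ _)); rewrite mulr_natl mulr2n lerD//.
  by rewrite normrM (ger0_norm e0) ler_pM// (le_trans Hsin).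
by rewrite normrM expr2 mulrA ler_pM.
Qed.

Definition ccontinuous f : Prop :=
  continuous (fun t => Re (f t)) /\ continuous (fun t => Im (f t)).

Lemma ccontinuousM f g : ccontinuous f -> ccontinuous g ->
  ccontinuous (fun t => f t * g t).
Proof.
move=> [cf1 cf2] [cg1 cg2]; split.
  rewrite (_ : (fun t => _) = fun t => Re (f t) * Re (g t) - Im (f t) * Im (g t)).
    by move=> t; apply: cvgB; apply: cvgM; [exact: cf1|exact: cg1|exact: cf2|exact: cg2].
  by apply/funext => t; rewrite cReM.
rewrite (_ : (fun t => _) = fun t => Re (f t) * Im (g t) + Im (f t) * Re (g t)).
  by move=> t; apply: cvgD; apply: cvgM; [exact: cf1|exact: cg2|exact: cf2|exact: cg1].
by apply/funext => t; rewrite cImM.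
Qed.

Lemma ccontinuousD f g : ccontinuous f -> ccontinuous g ->
  ccontinuous (fun t => f t + g t).
Proof.
move=> [cf1 cf2] [cg1 cg2]; split.
  rewrite (_ : (fun t => _) = fun t => Re (f t) + Re (g t)).
    by move=> t; apply: cvgD; [exact: cf1|exact: cg1].
  by apply/funext => t; rewrite cReD.
rewrite (_ : (fun t => _) = fun t => Im (f t) + Im (g t)).
  by move=> t; apply: cvgD; [exact: cf2|exact: cg2].
by apply/funext => t; rewrite cImD.
Qed.

Lemma ccontinuous_cst z : ccontinuous (fun=> z).
Proof. by split => t; exact: cvg_cst. Qed.

Lemma ccontinuous_real (f : R -> R) : continuous f -> ccontinuous (fun t => (f t)%:C).
Proof. by move=> cf; split => // t; exact: cvg_cst. Qed.

Lemma cint_segint a b f : cint `[a, b]%classic f =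
  segint a b (fun t => Re (f t)) +i* segint a b (fun t => Im (f t)).
Proof. by []. Qed.

Lemma cint_segD a b f g : ccontinuous f -> ccontinuous g ->
  cint `[a, b]%classic (fun t => f t + g t) =
  cint `[a, b]%classic f + cint `[a, b]%classic g.
Proof.
move=> [cf1 cf2] [cg1 cg2]; apply/eqP; rewrite eq_complex cReD cImD !cint_segint /=.
rewrite -!segintD//.
by apply/andP; split; apply/eqP; apply: eq_segint => t _; rewrite ?cReD ?cImD.
Qed.

Lemma cint_segZ a b z f : ccontinuous f ->
  cint `[a, b]%classic (fun t => z * f t) = z * cint `[a, b]%classic f.
Proof.
move=> [cf1 cf2]; apply/eqP; rewrite eq_complex cReM cImM !cint_segint /=.
have cZ (u : R -> R) c : continuous u -> continuous (fun t => c * u t).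
  by move=> cu t; apply: cvgMr; exact: cu.
have c1 := cZ _ (Re z) cf1; have c2 := cZ _ (Im z) cf2.
have c3 := cZ _ (Re z) cf2; have c4 := cZ _ (Im z) cf1.
rewrite -!segintZ// -segintB// -segintD//.
by apply/andP; split; apply/eqP; apply: eq_segint => t _; rewrite ?cReM ?cImM.
Qed.

Lemma cint_seg_bound a b f M : a <= b -> ccontinuous f ->
  (forall t, a <= t <= b -> cabs (f t) <= M) ->
  cabs (cint `[a, b]%classic f) <= 2 * (M * (b - a)).
Proof.
move=> ab [cf1 cf2] H; apply: (le_trans (cabs_le_ReIm _)) => /=.
rewrite -!/(segint _ _ _) mulr_natl mulr2n lerD//; apply: segint_bound => // t tab.
  by rewrite (le_trans (Re_le_cabs _))// H.
by rewrite (le_trans (Im_le_cabs _))// H.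
Qed.

Lemma cint_supp (D : set R) a b f : `[a, b] `<=` D ->
  (forall t, D t -> ~~ (a <= t <= b) -> f t = 0) ->
  cint D f = cint `[a, b]%classic f.
Proof.
by move=> abD f0; congr (_ +i* _); apply: segint_supp => // t Dt /(f0 _ Dt) ->.
Qed.

End ComplexBasics.

(** * The Laplace transform in the complex plane and its membership in [Yspace] *)

Section ComplexLaplace.
Set Implicit Arguments.
Unset Strict Implicit.
Context {R : realType}.
Local Notation C := R[i].
Implicit Types (z w : C) (f g F : R -> C) (a b c x y t h M : R).

Definition ctest_on a b F : Prop :=
  rtest_on a b (fun t => Re (F t)) /\ rtest_on a b (fun t => Im (F t)).

Lemma complex_eq0 z : Re z = 0 -> Im z = 0 -> z = 0.
Proof. by case: z => p q /= -> ->. Qed.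

Lemma ctest_on_eq0 a b F t : ctest_on a b F -> ~~ (a <= t <= b) -> F t = 0.
Proof. by move=> [[_ _ _ H1] [_ _ _ H2]] tab; apply: complex_eq0; [exact: H1|exact: H2]. Qed.

Lemma ctest_on_ccontinuous a b F : ctest_on a b F -> ccontinuous F.
Proof. by move=> [[s1 _ _ _] [s2 _ _ _]]; split; exact: rsmooth_continuous. Qed.

Lemma compact_Rplus_segment (K : set R) : compact K -> K `<=` Rplus ->
  exists a b, [/\ 0 < a, a <= b & K `<=` `[a, b]].
Proof.
move=> cK K0.
have : closed K by apply: compact_closed => //; exact: Rhausdorff.
move=> /closed_openC oK.
have nK : (~` K) 0 by move=> /K0; rewrite /Rplus/= in_itv/= ltxx.
have /nbhs_ballP[e /= e0 He] : nbhs 0 (~` K) by exact: open_nbhs_nbhs.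
have [M [_ HM]] := compact_bounded cK.
have {}HM : forall t, K t -> `|t| <= `|M| + 1.
  by move=> t Kt; apply: HM => //; rewrite (le_lt_trans (ler_norm _))// ltrDl.
(* The maximum keeps the endpoints ordered even when [K] is empty. *)
exists e, (Num.max e (`|M| + 1)); split=> //; first by rewrite le_max lexx.
move=> t Kt; rewrite /= in_itv/=; apply/andP; split; last first.
  by rewrite le_max (le_trans (ler_norm _) (HM _ Kt)) orbT.
have t0 : 0 < t by have := K0 _ Kt; rewrite /Rplus/= in_itv/= andbT.
rewrite leNgt; apply/negP => te; apply: (He t) => //.
by rewrite /ball/= sub0r normrN gtr0_norm.
Qed.

Lemma Ccinfty_RplusP F : Ccinfty Rplus F <-> exists a b, ctest_on a b F.
Proof.
split=> [[sF [K [cK K0 F0]]]|[a [b [[s1 a0 ab f1] [s2 _ _ f2]]]]].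
  have [a [b [a0 ab Kab]]] := compact_Rplus_segment cK K0.
  have H t : ~~ (a <= t <= b) -> F t = 0.
    by move=> tab; apply: F0 => /Kab /=; rewrite in_itv/=; exact/negP.
  exists a, b; split; split => //.
  - by split=> k t; have [] := sF k t I.
  - by move=> t /H ->.
  - by split=> k t; have [] := sF k t I.
  - by move=> t /H ->.
split; first by move=> k t _; split; apply: rsmooth_derivable.
exists `[a, b]%classic; split.
- exact: segment_compact.
- exact: segment_subRplus.
- move=> t; rewrite /= in_itv/= => /negP tab.
  by apply: complex_eq0; [exact: f1|exact: f2].
Qed.

Lemma laplace_seg a b F z : ctest_on a b F ->
  laplace F z = cint `[a, b]%classic (fun t => cexp (- (t%:C * z)) * F t).
Proof.
move=> T; have [[_ a0 _ _] _] := T.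
apply: cint_supp => [|t _ tab]; first exact: segment_subRplus.
by rewrite (ctest_on_eq0 T tab) mulr0.
Qed.

Definition lapA z t : R := expR (- (t * Re z)) * cos (t * Im z).

Definition lapB z t : R := expR (- (t * Re z)) * sin (t * Im z).

Lemma cexp_lap z t : cexp (- (t%:C * z)) = lapA z t -i* lapB z t.
Proof.
apply/eqP; rewrite eq_complex /cexp /lapA /lapB !cE/= !mul0r addr0 subr0.
by rewrite cosN sinN mulrN !eqxx.
Qed.

Lemma is_derive_mulr_cst y t : is_derive t 1 (fun s : R => s * y) y.
Proof.
have E : (fun s : R => y * s) = (fun s => s * y) by apply/funext => s; rewrite mulrC.
have := is_derive_scalef y (@is_derive_id _ _ t 1).
by rewrite E mulr1.
Qed.

Lemma is_derive_lapA z t :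
  is_derive t 1 (lapA z) (- Re z * lapA z t - Im z * lapB z t).
Proof.
have dc : is_derive t 1 (fun s : R => cos (s * Im z)) (- sin (t * Im z) * Im z).
  exact: (@is_derive1_comp _ cos (fun s => s * Im z) t _ _ _ (is_derive_mulr_cst _ _)).
apply: (is_derive_eq (is_derive_mulf (is_derive_expR_scale (Re z) t) dc)).
by rewrite /lapA /lapB; ring.
Qed.

Lemma is_derive_lapB z t :
  is_derive t 1 (lapB z) (- Re z * lapB z t + Im z * lapA z t).
Proof.
have dc : is_derive t 1 (fun s : R => sin (s * Im z)) (cos (t * Im z) * Im z).
  exact: (@is_derive1_comp _ sin (fun s => s * Im z) t _ _ _ (is_derive_mulr_cst _ _)).
apply: (is_derive_eq (is_derive_mulf (is_derive_expR_scale (Re z) t) dc)).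
by rewrite /lapA /lapB; ring.
Qed.

Lemma lapA_continuous z : continuous (lapA z).
Proof. exact: is_derive_continuous (is_derive_lapA z). Qed.

Lemma lapB_continuous z : continuous (lapB z).
Proof. exact: is_derive_continuous (is_derive_lapB z). Qed.

Lemma cexp_ccontinuous z : ccontinuous (fun t => cexp (- (t%:C * z))).
Proof.
split.
  rewrite (_ : (fun t => _) = lapA z); first exact: lapA_continuous.
  by apply/funext => t; rewrite cexp_lap.
rewrite (_ : (fun t => _) = fun t => - lapB z t); last first.
  by apply/funext => t; rewrite cexp_lap.
by move=> t; apply: cvgN; exact: lapB_continuous.
Qed.

Lemma ctest_on_bounded a b F : ctest_on a b F ->
  exists2 M, 0 <= M & forall t, a <= t <= b -> cabs (F t) <= M.
Proof.
move=> [[s1 _ _ _] [s2 _ _ _]].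
have [M1 M10 H1] := @segment_bounded _ a b _ (rsmooth_continuous s1).
have [M2 M20 H2] := @segment_bounded _ a b _ (rsmooth_continuous s2).
exists (M1 + M2) => [|t tab]; first exact: addr_ge0.
by rewrite (le_trans (cabs_le_ReIm _))// lerD// ?H1 ?H2.
Qed.

(** After [exp (- t z)] is factored out of the increment, what remains is [exp (- t h) - 1 + t h],
    quadratic in the complex number [h] uniformly for [t] in the support. The derivative is the
    transform of [- t F]. *)
Lemma laplace_quadratic F z : Ccinfty Rplus F ->
  exists d K, forall h : C, cabs h <= 1 ->
    cabs (laplace F (h + z) - laplace F z - h * d) <= K * cabs h ^+ 2.
Proof.
move=> /Ccinfty_RplusP[a [b T]]; have [[_ a0 ab _] _] := T.
have [M M0 HM] := ctest_on_bounded T.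
pose k (w : C) t := cexp (- (t%:C * w)) * F t.
have ck w : ccontinuous (k w).
  by apply: ccontinuousM; [exact: cexp_ccontinuous|exact: ctest_on_ccontinuous T].
pose kd t := - t%:C * k z t.
have ckd : ccontinuous kd.
  apply: ccontinuousM => //; rewrite (_ : (fun t => - t%:C) = fun t => (-1) * t%:C).
    by apply: ccontinuousM; [exact: ccontinuous_cst|apply: ccontinuous_real => t; exact: cvg_id].
  by apply/funext => t; rewrite mulN1r.
have b0 : 0 <= b := le_trans (ltW a0) ab.
pose Q := expR (b * `|Re z|) * (4 * expR b * b ^+ 2) * M.
exists (cint `[a, b]%classic kd), (2 * (Q * (b - a))) => h h1.
rewrite !(laplace_seg _ T).
have -> : cint `[a, b]%classic (k (h + z)) - cint `[a, b]%classic (k z) -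
    h * cint `[a, b]%classic kd =
    cint `[a, b]%classic (fun t => k (h + z) t + (-1 * k z t + - h * kd t)).
  have c1 : ccontinuous (fun t => -1 * k z t).
    by apply: ccontinuousM => //; exact: ccontinuous_cst.
  have c2 : ccontinuous (fun t => - h * kd t).
    by apply: ccontinuousM => //; exact: ccontinuous_cst.
  rewrite cint_segD//; last exact: ccontinuousD.
  by rewrite cint_segD// !cint_segZ// mulN1r mulNr addrA.
rewrite (_ : 2 * (Q * (b - a)) * cabs h ^+ 2 = 2 * (Q * cabs h ^+ 2 * (b - a))); last by ring.
apply: cint_seg_bound => //.
  apply: ccontinuousD => //; apply: ccontinuousD; apply: ccontinuousM => //;
  exact: ccontinuous_cst.
move=> t tab; have /andP[at_ tb] := tab.
have t0 : 0 <= t := le_trans (ltW a0) at_.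
rewrite [X in cabs X](_ : _ = cexp (- (t%:C * z)) *
   (cexp (- (t%:C * h)) - 1 - (- (t%:C * h))) * F t); last first.
  rewrite /kd /k; have -> : - (t%:C * (h + z)) = - (t%:C * h) + - (t%:C * z).
    by rewrite mulrDr opprD.
  by rewrite cexpD; ring.
rewrite !cabsM cabs_cexp.
have E1 : expR (Re (- (t%:C * z))) <= expR (b * `|Re z|).
  rewrite ler_expR !cE/= mul0r subr0 (le_trans (ler_norm _))// normrN normrM.
  by rewrite ger0_norm// ler_wpM2r.
have th : cabs (- (t%:C * h)) = t * cabs h.
  by rewrite cabsN cabsM cabs_real ger0_norm.
have E2 : cabs (cexp (- (t%:C * h)) - 1 - (- (t%:C * h))) <=
    4 * expR b * b ^+ 2 * cabs h ^+ 2.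
  have := @cexp_quadratic R (- (t%:C * h)) b; rewrite th => H.
  apply: (le_trans (H _)).
    by rewrite -[b]mulr1 ler_pM// cabs_ge0.
  rewrite -[leRHS]mulrA ler_wpM2l// ?mulr_ge0 ?expR_ge0//.
  by rewrite exprMn ler_wpM2r ?sqr_ge0// lerXn2r.
rewrite /Q [leRHS]mulrAC; apply: ler_pM => //.
- by rewrite mulr_ge0 ?expR_ge0 ?cabs_ge0.
- exact: cabs_ge0.
- by rewrite -[leRHS]mulrA; apply: ler_pM => //; rewrite ?expR_ge0 ?cabs_ge0.
- exact: HM.
Qed.

Lemma entire_laplace F : Ccinfty Rplus F -> entire (laplace F).
Proof.
move=> cF z; have [d [K H]] := laplace_quadratic z cF.
have K0 : 0 <= K.
  have := H 1; rewrite /cabs/= expr0n/= addr0 expr1n sqrtr1 expr1n mulr1.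
  by move=> /(_ (lexx _)); apply: le_trans; exact: sqrtr_ge0.
apply/cvg_ex; exists d; apply/cvgrPdist_le => /= e e0.
(* The norm on [R[i]] takes values in [R[i]], so the tolerance is itself a complex number; being
   positive, it is real. *)
have eE : e = (Re e)%:C.
  by move: e0; rewrite ltcE/= => /andP[/eqP eI _]; case: e eI => ? ? /= ->.
have r0 : 0 < Re e by rewrite -ltcR -eE.
have e1 : 0 < Num.min 1 (Re e / (K + 1)).
  by rewrite lt_min ltr01/= divr_gt0// ltr_wpDl.
near=> h.
have h0 : h != 0 by near: h; exact: (@nbhs_dnbhs_neq (R[i])^o 0).
have hs : `|h| < (Num.min 1 (Re e / (K + 1)))%:C.
  by near: h; apply: (@dnbhs0_lt _ (R[i])^o); rewrite ltcR.
rewrite -cabs_norm ltcR lt_min in hs; move: hs => /andP[h1 h2].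
have hp : 0 < cabs h by rewrite -ltcR cabs_norm normr_gt0.
have -> : d - h^-1 *: (laplace F (h *: 1 + z) - laplace F z) =
    - (h^-1 * (laplace F (h + z) - laplace F z - h * d)).
  rewrite -[h *: 1]/(h * 1) mulr1 /GRing.scale/=.
  by field.
rewrite normrN normrM normfV -!cabs_norm eE -fmorphV -rmorphM/= lecR.
rewrite ler_pdivrMl//; apply: (le_trans (H _ (ltW h1))).
rewrite expr2 mulrCA ler_pM2l//.
apply: (@le_trans _ _ ((K + 1) * cabs h)).
  by rewrite ler_wpM2r ?cabs_ge0// lerDl.
by rewrite mulrC -ler_pdivlMr ?ltr_wpDl// ltW.
Unshelve. all: by end_near. Qed.

Definition cdiff F t : C := derive1 (fun s => Re (F s)) t +i* derive1 (fun s => Im (F s)) t.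

Lemma ctest_on_cdiff a b F : ctest_on a b F -> ctest_on a b (cdiff F).
Proof. by move=> [T1 T2]; split; exact: (rtest_on_derive1n 1). Qed.

(** Integration by parts on an enlarged segment, done in components: the antiderivatives are the
    real and imaginary parts of [exp (- t z) F], and both vanish at the ends. *)
Lemma laplace_cdiff F z : Ccinfty Rplus F -> laplace (cdiff F) z = z * laplace F z.
Proof.
move=> /Ccinfty_RplusP[a0 [b0 [T1 T2]]].
pose a := a0 / 2; pose b := b0 + 1.
have [s1 a00 ab0 f1] := T1; have [s2 _ _ f2] := T2.
have aa0 : a < a0 by rewrite ltr_pdivrMr// ltr_pMr// ltr1n.
have bb0 : b0 < b by rewrite ltrDl.
have ab : a <= b by rewrite (le_trans (ltW aa0))// (le_trans ab0) ?ltW.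
have a1 : 0 < a by rewrite divr_gt0.
have T : ctest_on a b F.
  split; split=> //; first by apply: supp_in_widen f1; rewrite ltW.
  by apply: supp_in_widen f2; rewrite ltW.
have na : ~~ (a0 <= a <= b0) by rewrite negb_and -ltNge aa0.
have nb : ~~ (a0 <= b <= b0) by rewrite negb_and -!ltNge bb0 orbT.
rewrite !(laplace_seg _ T) (laplace_seg _ (ctest_on_cdiff T)) !cint_segint.
set u := fun t => Re (F t) in s1 f1; set v := fun t => Im (F t) in s2 f2.
pose A := lapA z; pose B := lapB z.
have cA : continuous A := @lapA_continuous z.
have cB : continuous B := @lapB_continuous z.
have cu := rsmooth_continuous s1; have cv := rsmooth_continuous s2.
have cu' := rsmooth_continuous (rsmooth_derive1 s1).
have cv' := rsmooth_continuous (rsmooth_derive1 s2).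
have cM (p q : R -> R) : continuous p -> continuous q -> continuous (fun t => p t * q t).
  by move=> cp cq t; apply: cvgM; [exact: cp|exact: cq].
have cD (p q : R -> R) : continuous p -> continuous q -> continuous (fun t => p t + q t).
  by move=> cp cq t; apply: cvgD; [exact: cp|exact: cq].
have cS (p q : R -> R) : continuous p -> continuous q -> continuous (fun t => p t - q t).
  by move=> cp cq t; apply: cvgB; [exact: cp|exact: cq].
have cZ (p : R -> R) c : continuous p -> continuous (fun t => c * p t).
  by move=> cp t; apply: cvgMr; exact: cp.
have E1 : (fun t => Re (cexp (- (t%:C * z)) * F t)) = (fun t => A t * u t + B t * v t).
  by apply/funext => t; rewrite cReM cexp_lap/= mulNr opprK.
have E2 : (fun t => Im (cexp (- (t%:C * z)) * F t)) = (fun t => A t * v t - B t * u t).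
  by apply/funext => t; rewrite cImM cexp_lap/= mulNr.
have E3 : (fun t => Re (cexp (- (t%:C * z)) * cdiff F t)) =
    (fun t => A t * derive1 u t + B t * derive1 v t).
  by apply/funext => t; rewrite cReM cexp_lap/= mulNr opprK.
have E4 : (fun t => Im (cexp (- (t%:C * z)) * cdiff F t)) =
    (fun t => A t * derive1 v t - B t * derive1 u t).
  by apply/funext => t; rewrite cImM cexp_lap/= mulNr.
rewrite E1 E2 E3 E4.
have c1 : continuous (fun t => A t * u t + B t * v t) by apply: cD; exact: cM.
have c2 : continuous (fun t => A t * v t - B t * u t) by apply: cS; exact: cM.
have c3 : continuous (fun t => A t * derive1 u t + B t * derive1 v t).
  by apply: cD; exact: cM.
have c4 : continuous (fun t => A t * derive1 v t - B t * derive1 u t).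
  by apply: cS; exact: cM.
have ua : u a = 0 by exact: f1.
have ub : u b = 0 by exact: f1.
have va : v a = 0 by exact: f2.
have vb : v b = 0 by exact: f2.
apply/eqP; rewrite eq_complex cReM cImM /=; apply/andP; split; apply/eqP.
  rewrite -!segintZ// -segintB; [|exact: cZ..].
  apply/eqP; rewrite -subr_eq0 -segintB//; last by apply: cS; exact: cZ.
  apply/eqP; transitivity (A b * u b + B b * v b - (A a * u a + B a * v a)); last first.
    by rewrite ua ub va vb !mulr0 addr0 subrr.
  apply: (@segint_FTC _ a b (fun t => A t * u t + B t * v t)) => //.
    move=> t; apply: (is_derive_eq (is_derive_addf
      (is_derive_mulf (is_derive_lapA z t) (rsmooth_is_derive t s1))
      (is_derive_mulf (is_derive_lapB z t) (rsmooth_is_derive t s2)))).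
    by rewrite /A /B; ring.
  by apply: (cS) => //; apply: cS; exact: cZ.
rewrite -!segintZ// -segintD; [|exact: cZ..].
apply/eqP; rewrite -subr_eq0 -segintB//; last by apply: cD; exact: cZ.
apply/eqP; transitivity (A b * v b - B b * u b - (A a * v a - B a * u a)); last first.
  by rewrite ua ub va vb !mulr0 subr0 subrr.
apply: (@segint_FTC _ a b (fun t => A t * v t - B t * u t)) => //.
  move=> t; have dN : is_derive t 1 (fun s => - (B s * u s)) _ := is_deriveN
    (is_derive_mulf (is_derive_lapB z t) (rsmooth_is_derive t s1)).
  apply: (is_derive_eq (is_derive_addf
    (is_derive_mulf (is_derive_lapA z t) (rsmooth_is_derive t s2)) dN)).
  by rewrite /A /B; ring.
by apply: cS => //; apply: cD; exact: cZ.
Qed.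

Lemma laplace_exp_bound a b F : ctest_on a b F ->
  exists2 K, 0 <= K & forall z,
    (0 <= Re z -> cabs (laplace F z) <= K * expR (- a * `|Re z|)) /\
    (Re z <= 0 -> cabs (laplace F z) <= K * expR (b * `|Re z|)).
Proof.
move=> T; have [[_ a0 ab _] _] := T.
have [M M0 HM] := ctest_on_bounded T.
exists (2 * (M * (b - a))) => [|z]; first by rewrite !mulr_ge0// subr_ge0.
have ck : ccontinuous (fun t => cexp (- (t%:C * z)) * F t).
  by apply: ccontinuousM; [exact: cexp_ccontinuous|exact: ctest_on_ccontinuous T].
have Rt t : Re (- (t%:C * z)) = - (t * Re z) by rewrite !cE/= mul0r subr0.
rewrite (laplace_seg _ T).
split=> z0.
  rewrite (_ : _ * expR _ = 2 * (M * expR (- a * `|Re z|) * (b - a))); last by ring.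
  apply: cint_seg_bound => // t tab; have /andP[at_ tb] := tab.
  rewrite cabsM cabs_cexp Rt mulrC ler_pM ?cabs_ge0 ?expR_ge0 ?HM//.
  by rewrite ler_expR mulNr lerN2 ger0_norm// ler_wpM2r.
rewrite (_ : _ * expR _ = 2 * (M * expR (b * `|Re z|) * (b - a))); last by ring.
apply: cint_seg_bound => // t tab; have /andP[at_ tb] := tab.
rewrite cabsM cabs_cexp Rt mulrC ler_pM ?cabs_ge0 ?expR_ge0 ?HM//.
by rewrite ler_expR ler0_norm// mulrN lerN2 ler_wnM2r.
Qed.

Lemma laplace_iter_cdiff a b F n z : ctest_on a b F ->
  ctest_on a b (iter n cdiff F) /\ laplace (iter n cdiff F) z = z ^+ n * laplace F z.
Proof.
move=> T; elim: n => [|n [IH1 IH2]]; first by rewrite mul1r.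
split=> /=; first exact: ctest_on_cdiff.
rewrite laplace_cdiff ?IH2 ?exprS ?mulrA//.
by apply/Ccinfty_RplusP; exists a, b.
Qed.

(** A support in [[a, b]] gives the exponents [- a < 0] and [b]. Decay of order [n] comes from the
    transform of the [n]-th derivative and [(1 + |z|)^n <= 2^n (1 + |z|^n)]. *)
Lemma Yspace_laplace F : Ccinfty Rplus F -> Yspace (laplace F).
Proof.
move=> cF; split; first exact: entire_laplace.
move/Ccinfty_RplusP: cF => [a [b T]]; have [[_ a0 ab _] _] := T.
have H n : exists K, forall z,
    (0 <= Re z -> cabs (laplace F z) * (1 + cabs z) ^+ n <= K * expR (- a * `|Re z|)) /\
    (Re z <= 0 -> cabs (laplace F z) * (1 + cabs z) ^+ n <= K * expR (b * `|Re z|)).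
  have [K0 K00 H0] := laplace_exp_bound T.
  have [Tn _] := laplace_iter_cdiff n 0 T.
  have [Kn Kn0 Hn] := laplace_exp_bound Tn.
  exists (2 ^+ n * (K0 + Kn)) => z.
  have B : (1 + cabs z) ^+ n <= 2 ^+ n * (1 + cabs z ^+ n).
    have z0 := cabs_ge0 z.
    have [z1|z1] := leP (cabs z) 1.
      apply: (@le_trans _ _ (2 ^+ n * 1)); last first.
        by rewrite ler_wpM2l ?exprn_ge0// lerDl exprn_ge0.
      by rewrite mulr1 lerXn2r ?nnegrE ?addr_ge0// -[2]/(1 + 1 : R) lerD2l.
    apply: (@le_trans _ _ (2 ^+ n * cabs z ^+ n)); last first.
      by rewrite ler_wpM2l ?exprn_ge0// lerDr.
    rewrite -exprMn lerXn2r ?nnegrE ?addr_ge0 ?mulr_ge0//.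
    by rewrite mulr_natl mulr2n lerD2r ltW.
  have E : cabs (laplace F z) * (1 + cabs z) ^+ n <=
      2 ^+ n * (cabs (laplace F z) + cabs (laplace (iter n cdiff F) z)).
    apply: (le_trans (ler_wpM2l (cabs_ge0 _) B)).
    have [_ ->] := laplace_iter_cdiff n z T.
    by rewrite cabsM cabsX le_eqVlt; apply/orP; left; apply/eqP; ring.
  have [p0 n0] := H0 z; have [pn nn] := Hn z.
  split=> z0; apply: (le_trans E); rewrite -mulrA ler_wpM2l ?exprn_ge0// mulrDl lerD//.
  - exact: p0.
  - exact: pn.
  - exact: n0.
  - exact: nn.
have /choice[c Hc] := H.
exists (- a), b, c; split; first by rewrite oppr_lt0.
move=> n z; have [Hp Hm] := Hc n z.
have P : 0 < (1 + cabs z) ^+ n by rewrite exprn_gt0// ltr_pwDl// cabs_ge0.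
by split=> z0; rewrite mulrAC ler_pdivlMr//; [exact: Hp|exact: Hm].
Qed.

End ComplexLaplace.

(** * Fubini on a rectangle and the convolution of real test functions *)

Section Convolution.
Set Implicit Arguments.
Unset Strict Implicit.
Context {R : realType}.
Local Notation C := R[i].
Local Notation mu := (@lebesgue_measure R).
Implicit Types (f g u v : R -> R) (a b c d x s t h M : R).

Lemma EFin_segint a b f : continuous f ->
  (segint a b f)%:E = (\int[mu]_(t in `[a, b]) (f t)%:E)%E.
Proof.
move=> cf; rewrite fineK//; apply: integrable_fin_num => //.
exact: segint_integrable.
Qed.

(** Extended by zero off the rectangle, the bounded measurable [g] is integrable for the product
    measure. Separate continuity turns the inner integrals back into [segint]. *)
Lemma segint_swap a b c d M (g : R * R -> R) : a <= b -> c <= d ->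
  measurable_fun setT g ->
  (forall s, continuous (fun t => g (s, t))) ->
  (forall t, continuous (fun s => g (s, t))) ->
  (forall s t, a <= s <= b -> c <= t <= d -> `|g (s, t)| <= M) ->
  segint a b (fun s => segint c d (fun t => g (s, t))) =
  segint c d (fun t => segint a b (fun s => g (s, t))).
Proof.
move=> ab cd mg cg1 cg2 gM.
have mu_seg p q : p <= q -> mu `[p, q]%classic = (q - p)%:E.
  move=> pq; rewrite lebesgue_measure_itv/= lte_fin; case: ltP => //.
  by rewrite le_eqVlt ltNge pq orbF => /eqP ->; rewrite subrr.
have muA := mu_seg _ _ ab; have muB := mu_seg _ _ cd.
have mA : measurable (`[a, b]%classic : set R) by exact: measurable_itv.
have mB : measurable (`[c, d]%classic : set R) by exact: measurable_itv.
set A : set R := `[a, b]%classic in mA muA *; set B : set R := `[c, d]%classic in mB muB *.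
pose f : R * R -> \bar R := (EFin \o g) \_ (A `*` B).
have fE s t : f (s, t) = if s \in A then if t \in B then (g (s, t))%:E else 0%E else 0%E.
  rewrite /f /patch; have [sA|sA] := boolP (s \in A); last first.
    rewrite ifN//; apply/negP; rewrite inE => -[/= sA' _].
    by move/negP: sA; apply; rewrite inE.
  have [tB|tB] := boolP (t \in B).
    by rewrite ifT//; rewrite inE in sA; rewrite inE in tB; rewrite inE.
  rewrite ifN//; apply/negP; rewrite inE => -[/= _ tB'].
  by move/negP: tB; apply; rewrite inE.
have mf : measurable_fun setT f.
  have mAB : measurable (A `*` B) by exact: measurableX.
  apply/(measurable_restrictT _ mAB).
  by apply/measurable_EFinP; apply: measurable_funTS.
have F1 s : (\int[mu]_t f (s, t) = ((EFin \o (fun s => segint c d (fun t => g (s, t)))) \_ A) s)%E.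
  rewrite /patch; have [sA|sA] := boolP (s \in A).
    rewrite /= EFin_segint// [RHS]integral_mkcond; apply: eq_integral => t _.
    by rewrite fE sA /patch.
  by apply: integral0_eq => t _; rewrite fE (negbTE sA).
have F2 t : (\int[mu]_s f (s, t) = ((EFin \o (fun t => segint a b (fun s => g (s, t)))) \_ B) t)%E.
  rewrite /patch; have [tB|tB] := boolP (t \in B).
    rewrite /= EFin_segint// [RHS]integral_mkcond; apply: eq_integral => s _.
    by rewrite fE tB /patch.
  by apply: integral0_eq => s _; rewrite fE (negbTE tB); case: ifP.
have intf : (mu \x mu)%E.-integrable setT f.
  apply/integrable12ltyP => //.
  apply: (@le_lt_trans _ _ (\int[mu]_(s in A) ((M * (d - c))%:E))%E); last first.
    by rewrite integral_cst// [X in (_ * X)%E]muA -EFinM ltry.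
  rewrite [leRHS]integral_mkcond; apply: ge0_le_integral => //.
  - by move=> s _; apply: integral_ge0.
  - apply: (@measurable_fun_fubini_tonelli_F _ _ _ _ R mu (fun z => `|f z|%E)) => //.
    exact: measurableT_comp.
  - by apply/(measurable_restrictT _ mA); exact: measurable_cst.
  - move=> s _; rewrite /patch; have [sA|sA] := boolP (s \in A); last first.
      by rewrite (@integral0_eq _ _ _ mu)// => t _; rewrite fE (negbTE sA) abse0.
    apply: (@le_trans _ _ (\int[mu]_(t in B) M%:E)%E); last first.
      by rewrite integral_cst// [X in (_ * X)%E]muB -EFinM lexx.
    rewrite [leRHS]integral_mkcond; apply: ge0_le_integral => //.
    + apply: measurableT_comp => //.
      by apply: (@measurableT_comp _ _ _ _ _ _ f) => //; exact: pair1_measurable.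
    + by apply/(measurable_restrictT _ mB); exact: measurable_cst.
    + move=> t _; rewrite fE sA /patch; case: ifPn => tB; last by rewrite abse0.
      rewrite /= lee_fin; move: (set_mem sA) (set_mem tB).
      by rewrite /A /B /= !in_itv/=; exact: gM.
have := Fubini intf.
under eq_integral do rewrite F1.
under [in RHS]eq_integral do rewrite F2.
by rewrite -!integral_mkcond => /(congr1 fine).
Qed.

Lemma segint_shift a b s f : a <= b -> continuous f ->
  segint (a - s) (b - s) f = segint a b (fun t => f (t - s)).
Proof.
move=> ab cf; rewrite /segint /Rintegral.
have dF t : is_derive t 1 (fun x : R => x - s) 1.
  have := is_derive_addf (@is_derive_id _ _ t (1 : R)) (@is_derive_cst _ _ _ (- s) t (1 : R)).
  by rewrite addr0.
have cF := is_derive_continuous dF.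
have E := is_derive_derive1 dF.
rewrite (@integration_by_substitution_increasing R (fun x => x - s) f a b)//.
- by congr fine; apply: eq_integral => t _; rewrite E !fctE mulr1.
- by move=> x y _ _ xy; rewrite ltrD2r.
- by move=> t _; rewrite E; exact: cst_continuous.
- by rewrite E; exact: is_cvg_cst.
- by rewrite E; exact: is_cvg_cst.
- split; first by move=> t _; have [] := dF t.
    exact/cvg_at_right_filter/cF.
  exact/cvg_at_left_filter/cF.
- exact: continuous_subspaceT.
Qed.

Lemma eq_segint_supp a b c d f :
  (forall s, a <= s <= b -> ~~ (c <= s <= d) -> f s = 0) ->
  (forall s, c <= s <= d -> ~~ (a <= s <= b) -> f s = 0) ->
  segint a b f = segint c d f.
Proof.
move=> H1 H2; rewrite /segint Rintegral_mkcond [RHS]Rintegral_mkcond.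
apply: eq_Rintegral => s _; rewrite /patch !mem_setE !in_itv/=.
by case: ifPn => [sab|sab]; case: ifPn => [scd|scd] //; [exact: H1|rewrite H2].
Qed.

Definition rconv f g t : R := segint 0 t (fun s => f s * g (t - s)).

Lemma rsmooth_flip f t : rsmooth f -> rsmooth (fun s => f (t - s)).
Proof.
move=> sf; have E : (fun s => f (-1 * s + t)) = (fun s => f (t - s)).
  by apply/funext => s; rewrite mulN1r addrC.
by rewrite -E; exact: rsmooth_affine.
Qed.

Lemma rconv_integrand_continuous f g t : rsmooth f -> rsmooth g ->
  continuous (fun s => f s * g (t - s)).
Proof.
by move=> sf sg; apply: rsmooth_continuous; apply: rsmoothM => //; exact: rsmooth_flip.
Qed.

(** Since [a > 0], [g (t - s)] vanishes for [s > t], so the moving interval [[0, t]] may be replaced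
    by the support of [f]. With fixed limits one can differentiate under the integral. *)
Lemma rconv_seg a b f g t : rtest_on a b f -> rtest_on a b g ->
  rconv f g t = segint a b (fun s => f s * g (t - s)).
Proof.
move=> [_ a0 ab f0] [_ _ _ g0]; apply: eq_segint_supp => s.
  by move=> _ /f0 ->; rewrite mul0r.
rewrite negb_and -!ltNge => /andP[as_ sb] /orP[s0|ts].
  by have := lt_trans s0 (lt_le_trans a0 as_); rewrite ltxx.
rewrite g0 ?mulr0// negb_and -ltNge (lt_trans _ a0)//.
by rewrite subr_lt0.
Qed.

Lemma is_derive_rconv a b f g t : rtest_on a b f -> rtest_on a b g ->
  is_derive t 1 (rconv f g) (rconv f (derive1 g) t).
Proof.
move=> Tf Tg; have Tg' : rtest_on a b (derive1 g) := rtest_on_derive1n 1 Tg.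
rewrite (rconv_seg _ Tf Tg').
rewrite (_ : rconv f g = fun t => segint a b (fun s => f s * g (t - s))); last first.
  by apply/funext => y; exact: (rconv_seg _ Tf Tg).
have [sf _ ab _] := Tf; have [sg _ _ _] := Tg; have sg' := rsmooth_derive1 sg.
have sg'' := rsmooth_derive1 sg'.
have [M1 M10 H1] : exists2 M, 0 <= M & forall s, `|f s| <= M.
  by apply: rtest_bounded; exists a, b.
have [M2 M20 H2] : exists2 M, 0 <= M & forall s, `|derive1 (derive1 g) s| <= M.
  by apply: rtest_bounded; exists a, b; exact: (rtest_on_derive1n 2).
apply: (@is_derive_segint _ (fun t s => f s * g (t - s))
  (fun t s => f s * derive1 g (t - s)) _ _ _ (M1 * M2)) => //.
- by move=> y; exact: rconv_integrand_continuous.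
- exact: rconv_integrand_continuous.
move=> h s h1 _.
rewrite [X in `|X|](_ : _ = f s * (g ((t - s) + h) - g (t - s) - h * derive1 g (t - s))).
  rewrite normrM -mulrA; apply: ler_pM => //.
  exact: (taylor2_le (fun y => rsmooth_is_derive y sg)
    (fun y => rsmooth_is_derive y sg') (fun y _ => H2 y)).
by rewrite [t - s + h]addrAC; ring.
Qed.

Lemma rtest_on_rconv a b f g : rtest_on a b f -> rtest_on a b g ->
  rtest_on (a + a) (b + b) (rconv f g).
Proof.
move=> Tf Tg; have [sf a0 ab f0] := Tf; have [sg _ _ g0] := Tg; split.
- apply: (@rsmooth_class _ (fun u => exists2 v, rtest_on a b v & u = rconv f v)).
    move=> _ [v Tv ->]; exists (rconv f (derive1 v)).
      by exists (derive1 v) => //; exact: (rtest_on_derive1n 1).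
    by move=> t; exact: is_derive_rconv Tf Tv.
  by exists g.
- exact: addr_gt0.
- exact: lerD.
move=> t tn; rewrite (rconv_seg _ Tf Tg).
rewrite (@eq_segint _ _ _ _ (fun=> 0)) ?segint_cst ?mul0r// => s /andP[as_ sb].
rewrite g0 ?mulr0//; apply: contra tn => /andP[h1 h2].
rewrite -[t](subrK s); apply/andP; split; exact: lerD.
Qed.

Lemma rlap_rconv f g x : rtest f -> rtest g ->
  rlap (rconv f g) x = rlap f x * rlap g x.
Proof.
move=> tf tg; have [a [b [Tf Tg]]] := rtest_common tf tg.
have [sf a0 ab f0] := Tf; have [sg _ _ g0] := Tg.
rewrite (rlap_segint _ (rtest_on_rconv Tf Tg)) (rlap_segint _ Tf) (rlap_segint _ Tg).
pose e (t : R) := expR (- (t * x)).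
have se : rsmooth e by exact: rsmooth_expR_scale.
pose G (z : R * R) : R := f z.1 * (g (z.2 - z.1) * e z.2).
have cG1 s : continuous (fun t => G (s, t)).
  rewrite /G/=; apply: rsmooth_continuous; apply: rsmoothZ; apply: rsmoothM => //.
  have E : (fun t => g (1 * t + - s)) = (fun t => g (t - s)).
    by apply/funext => t; rewrite mul1r.
  by rewrite -E; exact: rsmooth_affine.
have cG2 t : continuous (fun s => G (s, t)).
  rewrite /G/=; apply: rsmooth_continuous; apply: rsmoothM => //.
  by apply: rsmoothM; [exact: rsmooth_flip|exact: rsmooth_cst].
have [M1 M10 H1] : exists2 M, 0 <= M & forall s, `|f s| <= M.
  by apply: rtest_bounded; exists a, b.
have [M2 M20 H2] : exists2 M, 0 <= M & forall s, `|g s| <= M.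
  by apply: rtest_bounded; exists a, b.
have [M3 M30 H3] := @segment_bounded _ (a + a) (b + b) _ (rsmooth_continuous se).
have mf (u : R -> R) : rsmooth u -> measurable_fun setT u.
  by move=> su; apply: continuous_measurable_fun; exact: rsmooth_continuous.
have mG : measurable_fun setT G.
  apply: measurable_funM.
    by apply: (@measurableT_comp _ _ _ _ _ _ f); [exact: mf|exact: measurable_fst].
  apply: measurable_funM; last first.
    by apply: (@measurableT_comp _ _ _ _ _ _ e); [exact: mf|exact: measurable_snd].
  apply: (@measurableT_comp _ _ _ _ _ _ g); first exact: mf.
  by apply: measurable_funB; [exact: measurable_snd|exact: measurable_fst].
transitivity (segint (a + a) (b + b) (fun t => segint a b (fun s => G (s, t)))).
  apply: eq_segint => t _; rewrite (rconv_seg _ Tf Tg) -segintZ.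
    by apply: eq_segint => s _; rewrite /G/= /e; ring.
  exact: rconv_integrand_continuous.
rewrite -(@segint_swap _ _ _ _ (M1 * (M2 * M3)))//; first last.
- by move=> s t _ t2; rewrite !normrM; apply: ler_pM => //; apply: ler_pM => //; exact: H3.
- exact: lerD.
transitivity (segint a b (fun s => segint a b (fun r => e r * g r) * (e s * f s))); last first.
  by rewrite segintZ; [rewrite /e mulrC|exact: rlap_integrand_continuous].
apply: eq_segint => s /andP[as_ sb].
have ceg : continuous (fun r => e r * g r) by exact: rlap_integrand_continuous.
transitivity (f s * e s * segint (a + a) (b + b) (fun t => e (t - s) * g (t - s))).
  rewrite -segintZ.
    apply: eq_segint => t _; rewrite /G/= -[RHS]mulrA [e s * _]mulrA -expRD mulrC.
    rewrite (_ : - (s * x) + - ((t - s) * x) = - (t * x)); last by ring.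
    by rewrite /e; ring.
  move=> t; apply: (@continuous_comp _ _ _ (fun t => t - s) (fun r => e r * g r)).
    by apply: cvgB; [exact: cvg_id|exact: cvg_cst].
  exact: ceg.
rewrite -(@segint_shift _ _ s (fun r => e r * g r))//; last exact: lerD.
(* For [s] in [[a, b]] the shifted segment [[2a - s, 2b - s]] contains [[a, b]], where [g] lives. *)
rewrite (@eq_segint_supp _ _ a b).
- by ring.
- by move=> u _ /g0 ->; rewrite mulr0.
move=> u /andP[au ub] /negP; case; apply/andP; split.
  by rewrite lerBlDr lerD.
by rewrite lerBrDr lerD.
Qed.

End Convolution.

(** * Complex test functions through their real and imaginary parts *)

Section LaplaceOfConvolution.
Set Implicit Arguments.
Unset Strict Implicit.
Context {R : realType}.
Local Notation C := R[i].
Implicit Types (u v : R -> R) (f g F : R -> C) (a b c x s t : R).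

Lemma rtestD u v : rtest u -> rtest v -> rtest (fun t => u t + v t).
Proof.
move=> tu tv; have [a [b [[su a0 ab u0] [sv _ _ v0]]]] := rtest_common tu tv.
exists a, b; split=> //; first exact: rsmoothD.
by move=> t tab; rewrite u0// v0// addr0.
Qed.

Lemma rtestZ c u : rtest u -> rtest (fun t => c * u t).
Proof. by apply: rtestM; exact: rsmooth_cst. Qed.

Lemma rlapD u v x : rtest u -> rtest v ->
  rlap (fun t => u t + v t) x = rlap u x + rlap v x.
Proof.
move=> tu tv; have [a [b [Tu Tv]]] := rtest_common tu tv.
have Tuv : rtest_on a b (fun t => u t + v t).
  have [su a0 ab u0] := Tu; have [sv _ _ v0] := Tv.
  by split=> //; [exact: rsmoothD|move=> t tab; rewrite u0// v0// addr0].
rewrite (rlap_segint _ Tu) (rlap_segint _ Tv) (rlap_segint _ Tuv).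
have su := rtest_smooth tu; have sv := rtest_smooth tv.
rewrite -segintD; [|exact: rlap_integrand_continuous..].
by apply: eq_segint => t _; rewrite mulrDr.
Qed.

Lemma rlapZ c u x : rtest u -> rlap (fun t => c * u t) x = c * rlap u x.
Proof.
move=> [a [b T]]; have [su _ _ _] := T.
have T' : rtest_on a b (fun t => c * u t) by apply: rtest_onM T; exact: rsmooth_cst.
rewrite (rlap_segint _ T) (rlap_segint _ T') -segintZ; last exact: rlap_integrand_continuous.
by apply: eq_segint => t _; rewrite mulrCA.
Qed.

Lemma rtest_rconv u v : rtest u -> rtest v -> rtest (rconv u v).
Proof.
move=> tu tv; have [a [b [Tu Tv]]] := rtest_common tu tv.
by exists (a + a), (b + b); exact: rtest_on_rconv.
Qed.

Lemma Ccinfty_Rplus_rtest F : Ccinfty Rplus F <->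
  rtest (fun t => Re (F t)) /\ rtest (fun t => Im (F t)).
Proof.
split=> [/Ccinfty_RplusP[a [b [T1 T2]]]|[T1 T2]].
  by split; exists a, b.
by apply/Ccinfty_RplusP; exact: rtest_common.
Qed.

Lemma laplace_real F x :
  laplace F x%:C = rlap (fun t => Re (F t)) x +i* rlap (fun t => Im (F t)) x.
Proof.
have E t : cexp (- (t%:C * x%:C)) = (expR (- (t * x)))%:C.
  by rewrite cexp_lap /lapA /lapB /= !mulr0 cos0 sin0 mulr1 mulr0 oppr0.
congr (_ +i* _); apply: eq_Rintegral => t _.
  by rewrite E cReM/= mul0r subr0.
by rewrite E cImM/= mul0r addr0.
Qed.

Lemma lconv_rconv f g t : Ccinfty Rplus f -> Ccinfty Rplus g ->
  lconv f g t =
    (rconv (fun s => Re (f s)) (fun s => Re (g s)) t +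
     rconv (fun s => Im (f s)) (fun s => Im (g s)) t) +i*
    (rconv (fun s => Re (f s)) (fun s => Im (g s)) t -
     rconv (fun s => Im (f s)) (fun s => Re (g s)) t).
Proof.
move=> /Ccinfty_Rplus_rtest[/rtest_smooth s1 /rtest_smooth s2].
move=> /Ccinfty_Rplus_rtest[/rtest_smooth s3 /rtest_smooth s4].
have c1 := @rconv_integrand_continuous _ _ _ t s1 s3.
have c2 := @rconv_integrand_continuous _ _ _ t s2 s4.
have c3 := @rconv_integrand_continuous _ _ _ t s1 s4.
have c4 := @rconv_integrand_continuous _ _ _ t s2 s3.
rewrite /lconv cint_segint /rconv -segintD// -segintB//.
congr (_ +i* _); apply: eq_segint => s _; rewrite ?cReM ?cImM;
  by case: (f s) => p q /=; rewrite mulNr ?opprK.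
Qed.

Lemma Ccinfty_lconv f g : Ccinfty Rplus f -> Ccinfty Rplus g ->
  Ccinfty Rplus (lconv f g).
Proof.
move=> cf cg; apply/Ccinfty_Rplus_rtest.
have /Ccinfty_Rplus_rtest[f1 f2] := cf; have /Ccinfty_Rplus_rtest[g1 g2] := cg.
split.
  rewrite (_ : (fun t => _) = fun t => rconv (fun s => Re (f s)) (fun s => Re (g s)) t +
     rconv (fun s => Im (f s)) (fun s => Im (g s)) t).
    by apply: rtestD; exact: rtest_rconv.
  by apply/funext => t; rewrite lconv_rconv.
rewrite (_ : (fun t => _) = fun t => rconv (fun s => Re (f s)) (fun s => Im (g s)) t +
     (-1) * rconv (fun s => Im (f s)) (fun s => Re (g s)) t).
  by apply: rtestD; [exact: rtest_rconv|exact: (rtestZ (-1) (rtest_rconv f2 g1))].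
by apply/funext => t; rewrite lconv_rconv// mulN1r.
Qed.

Lemma laplace_lconv f g x : Ccinfty Rplus f -> Ccinfty Rplus g ->
  laplace (lconv f g) x%:C = (laplace f x%:C)^* * laplace g x%:C.
Proof.
move=> cf cg.
have /Ccinfty_Rplus_rtest[f1 f2] := cf; have /Ccinfty_Rplus_rtest[g1 g2] := cg.
rewrite !laplace_real.
have -> : (fun t => Re (lconv f g t)) =
    fun t => rconv (fun s => Re (f s)) (fun s => Re (g s)) t +
             rconv (fun s => Im (f s)) (fun s => Im (g s)) t.
  by apply/funext => t; rewrite lconv_rconv.
have -> : (fun t => Im (lconv f g t)) =
    fun t => rconv (fun s => Re (f s)) (fun s => Im (g s)) t +
     (-1) * rconv (fun s => Im (f s)) (fun s => Re (g s)) t.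
  by apply/funext => t; rewrite lconv_rconv// mulN1r.
rewrite !rlapD ?rlapZ ?rlap_rconv//; try exact: rtest_rconv; last first.
  by apply: rtestZ; exact: rtest_rconv.
by apply/eqP; rewrite eq_complex cReM cImM /=; apply/andP; split; apply/eqP; ring.
Qed.

End LaplaceOfConvolution.

(** * The weights of [S0space] and the decaying functions *)

Section SchwartzWeights.
Set Implicit Arguments.
Unset Strict Implicit.
Context {R : realType}.
Local Notation C := R[i].
Implicit Types (u v g : R -> R) (c e x t kappa : R).

(** One majorant for all seminorms: up to a constant it lies below every weight, and it exceeds the
    decay [1 / (1 + t)] by the logarithm that a cutoff costs. *)
Definition logw t : R := (1 + `|ln t|) / (1 + t).

Lemma logw_gt0 t : 0 < t -> 0 < logw t.
Proof. by move=> t0; rewrite /logw divr_gt0// ltr_pwDl// ltW. Qed.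

Lemma inv_le_logw t : 0 < t -> (1 + t)^-1 <= logw t.
Proof.
by move=> t0; rewrite -[leLHS]mul1r ler_wpM2r ?invr_ge0 ?addr_ge0 ?(ltW t0)// lerDl.
Qed.

(** With [y = |ln t|], the factor [(1 + y)^kappa] is [O(exp (y / 2))], and [t^(1/2) exp (y / 2)] is
    the maximum of [t] and 1. *)
Lemma powR_log_le kappa : exists2 K, 0 < K & forall t, 0 < t ->
  t `^ (1 / 2) * (1 + `|ln t|) `^ kappa <= K * (1 + t).
Proof.
pose m := Num.bound `|kappa|.
have km : kappa <= m%:R.
  by apply: (le_trans (ler_norm _)); apply: ltW; exact: archi_boundP.
exists (2 ^+ m * (m%:R ^+ m + 1) * expR (1 / 2)) => [|t t0].
  by rewrite mulr_gt0 ?expR_gt0// mulr_gt0 ?exprn_gt0// ltr_wpDl// exprn_ge0.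
set y := `|ln t|; have y0 : 0 <= y by exact: normr_ge0.
have H1 : (1 + y) `^ kappa <= 2 ^+ m * (m%:R ^+ m + 1) * expR (1 / 2) * expR (y / 2).
  apply: (@le_trans _ _ ((1 + y) ^+ m)).
    rewrite -powR_mulrn ?addr_ge0//; apply: ler_powR => //.
    by rewrite lerDl.
  have -> : 1 + y = 2 * ((1 + y) / 2) by field.
  rewrite exprMn -!mulrA ler_pM2l ?exprn_gt0//.
  have h0 : 0 <= (1 + y) / 2 by rewrite divr_ge0// addr_ge0.
  apply: (le_trans (exprn_le_expR m h0)).
  rewrite -expRD -mulrDl; apply: ler_wpM2r; first exact: expR_ge0.
  by rewrite lerDl.
have H2 : t `^ (1 / 2) * expR (y / 2) <= 1 + t.
  rewrite /powR gt_eqF// -expRD.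
  have [l0|l0] := leP 0 (ln t).
    rewrite /y ger0_norm// (_ : _ + _ = ln t); last by field.
    by rewrite lnK ?posrE// lerDr.
  rewrite /y ltr0_norm// (_ : _ + _ = 0); last by field.
  by rewrite expR0 lerDl ltW.
apply: (le_trans (ler_wpM2l (powR_ge0 _ _) H1)).
rewrite mulrCA ler_wpM2l// !mulr_ge0 ?exprn_ge0 ?expR_ge0// addr_ge0// exprn_ge0//.
Qed.

Lemma S0weightE kappa k t : 0 < t ->
  t ^+ k * S0weight kappa k t = (t `^ (1 / 2) * (1 + `|ln t|) `^ kappa)^-1.
Proof.
move=> t0; rewrite /S0weight powRD; last by apply/implyP => _; rewrite gt_eqF.
rewrite (powRN t (1 / 2)) (powRN t k%:R) (powRN _ kappa) powR_mulrn; last exact: ltW.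
rewrite [RHS]invfM mulrA; congr (_ * _).
by rewrite mulrCA divff ?mulr1// expf_neq0// gt_eqF.
Qed.

Lemma logw_le_S0weight kappa : exists2 K, 0 < K & forall k t, 0 < t ->
  logw t <= K * (t ^+ k * S0weight kappa k t).
Proof.
(* The extra power of [1 + |ln t|] is the numerator of [logw]. *)
have [K K0 H] := powR_log_le (kappa + 1).
exists K => // k t t0; have P : 0 < 1 + `|ln t| by rewrite ltr_pwDl.
rewrite S0weightE// ler_pdivrMr ?addr_gt0// mulrAC ler_pdivlMr; last first.
  by rewrite mulr_gt0// powR_gt0.
apply: le_trans (H _ t0); rewrite powRD; last by apply/implyP => _; rewrite gt_eqF.
rewrite powRr1; last exact: ltW.
have -> : t `^ (1 / 2) * ((1 + `|ln t|) `^ kappa * (1 + `|ln t|)) =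
  (1 + `|ln t|) * (t `^ (1 / 2) * (1 + `|ln t|) `^ kappa) by ring.
by rewrite lexx.
Qed.

Lemma cderiv_real k u t : cderiv k (fun x => (u x)%:C) t = (derive1n k u t)%:C.
Proof.
rewrite /cderiv; congr (_ +i* _) => /=.
by case: k => [//|k]; rewrite derive1n_cst.
Qed.

Lemma csmooth_real (U : set R) u : rsmooth u -> csmooth_on U (fun x => (u x)%:C).
Proof.
move=> su k t _; split; first exact: rsmooth_derivable.
exact: (rsmooth_derivable (rsmooth_cst 0)).
Qed.

Lemma S0space_real u : rsmooth u ->
  (forall k, exists c, euler_bound k u (fun t => c * logw t)) ->
  S0space (fun t => (u t)%:C).
Proof.
move=> su H; split; first exact: csmooth_real.
move=> kappa k; have [c Hc] := H k; have [K K0 HK] := logw_le_S0weight kappa.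
exists (`|c| * K) => t t0; rewrite cderiv_real cabs_real.
rewrite -(@ler_pM2l _ (t ^+ k)) ?exprn_gt0//; apply: (le_trans (Hc k (leqnn k) t t0)).
apply: (@le_trans _ _ (`|c| * logw t)).
  by apply: ler_wpM2r; [exact/ltW/logw_gt0|exact: ler_norm].
apply: (le_trans (ler_wpM2l (normr_ge0 c) (HK k t t0))).
by rewrite (_ : `|c| * (K * _) = t ^+ k * (`|c| * K * S0weight kappa k t)) ?lexx//; ring.
Qed.

Lemma S0null_real (u : nat -> R -> R) :
  (forall k e, 0 < e -> \forall j \near \oo,
     euler_bound k (u j) (fun t => e * logw t)) ->
  S0null (fun j t => (u j t)%:C).
Proof.
move=> H kappa k e e0; have [K K0 HK] := logw_le_S0weight kappa.
have eK : 0 < e / K by exact: divr_gt0.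
have := H k _ eK; apply: filterS => j Hj t t0; rewrite cderiv_real cabs_real.
rewrite -(@ler_pM2l _ (t ^+ k)) ?exprn_gt0//; apply: (le_trans (Hj k (leqnn k) t t0)).
apply: (le_trans (ler_wpM2l (ltW eK) (HK k t t0))).
rewrite le_eqVlt; apply/orP; left; apply/eqP; field; exact: lt0r_neq0.
Qed.

Lemma euler_bound_le k u (m m' : R -> R) : (forall t, 0 < t -> m t <= m' t) ->
  euler_bound k u m -> euler_bound k u m'.
Proof. by move=> mm H i ik t t0; exact: le_trans (H i ik t t0) (mm t t0). Qed.

Lemma euler_boundD k u v (m m' : R -> R) : rsmooth u -> rsmooth v ->
  euler_bound k u m -> euler_bound k v m' ->
  euler_bound k (fun t => u t + v t) (fun t => m t + m' t).
Proof.
move=> su sv Hu Hv i ik t t0; rewrite derive1nD//.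
apply: (@le_trans _ _ (t ^+ i * `|derive1n i u t| + t ^+ i * `|derive1n i v t|)).
  by rewrite -mulrDr ler_pM2l ?exprn_gt0// ler_normD.
by rewrite lerD ?Hu ?Hv.
Qed.

(** A class inside [S0space], stable under sums and products, that contains both the test functions
    and their Laplace transforms. *)
Definition decaying u : Prop := rsmooth u /\
  forall k, exists2 c, 0 <= c & euler_bound k u (fun t => c / (1 + t)).

Lemma decaying_rlap u : rtest u -> decaying (rlap u).
Proof. by move=> tu; split; [exact: rsmooth_rlap|move=> k; exact: rlap_euler_bound]. Qed.

Lemma decayingD u v : decaying u -> decaying v -> decaying (fun t => u t + v t).
Proof.
move=> [su Hu] [sv Hv]; split; first exact: rsmoothD.
move=> k; have [c c0 H] := Hu k; have [c' c'0 H'] := Hv k.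
exists (c + c'); first exact: addr_ge0.
by apply: euler_bound_le (euler_boundD su sv H H') => t t0; rewrite mulrDl.
Qed.

Lemma decayingM u v : decaying u -> decaying v -> decaying (fun t => u t * v t).
Proof.
move=> [su Hu] [sv Hv]; split; first exact: rsmoothM.
move=> k; have [c c0 H] := Hu k; have [c' c'0 H'] := Hv k.
exists (2 ^+ k * (c * c')); first by rewrite !mulr_ge0// exprn_ge0.
apply: euler_bound_le (euler_boundM su sv H H') => t t0.
rewrite -mulrA ler_wpM2l ?exprn_ge0// mulrACA ler_wpM2l ?mulr_ge0//.
rewrite -[leRHS]mulr1 ler_wpM2l ?invr_ge0 ?addr_ge0 ?(ltW t0)//.
by rewrite invf_le1 ?addr_gt0// lerDl ltW.
Qed.

Lemma decaying_S0space u : decaying u -> S0space (fun t => (u t)%:C).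
Proof.
move=> [su Hu]; apply: S0space_real => // k; have [c c0 H] := Hu k.
exists c; apply: euler_bound_le H => t t0.
by rewrite ler_wpM2l// inv_le_logw.
Qed.

Lemma decaying_rtest u : rtest u -> decaying u.
Proof.
move=> tu; split; first exact: rtest_smooth.
elim=> [|k [c c0 H]].
  have [M M0 HM] := rtest_bounded (@rtestM _ u (fun t => 1 + t)
    (rsmoothD (rsmooth_cst 1) (@rsmooth_id R)) tu).
  exists M => // i; rewrite leqn0 => /eqP -> t t0.
  rewrite mul1r ler_pdivlMr ?addr_gt0// mulrC -[1 + t]gtr0_norm ?addr_gt0//.
  by rewrite -normrM HM.
have [M M0 HM] := rtest_bounded (@rtestM _ (derive1n k.+1 u) (fun t => (1 + t) * t ^+ k.+1)
    (rsmoothM (rsmoothD (rsmooth_cst 1) (@rsmooth_id R)) (rsmoothX k.+1 (@rsmooth_id R)))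
    (rtest_derive1n k.+1 tu)).
exists (c + M); first exact: addr_ge0.
move=> i; rewrite leq_eqVlt => /predU1P[->|ik] t t0; last first.
  apply: (le_trans (H i ik t t0)).
  by rewrite ler_wpM2r ?lerDl// invr_ge0 addr_ge0// ltW.
apply: (@le_trans _ _ (M / (1 + t))); last first.
  by rewrite ler_wpM2r ?lerDr// invr_ge0 addr_ge0// ltW.
rewrite ler_pdivlMr ?addr_gt0//; apply: le_trans (HM t).
have t1 : 0 < 1 + t by rewrite addr_gt0.
by rewrite !normrM normrX (gtr0_norm t0) (gtr0_norm t1) mulrC mulrA.
Qed.

End SchwartzWeights.

(** * Smooth cutoffs on a logarithmic scale *)

Section LogarithmicCutoffs.
Set Implicit Arguments.
Unset Strict Implicit.
Context {R : realType}.
Implicit Types (u g alpha beta : R -> R) (c e x t y A L : R).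

Lemma rsmooth_dilate c u : rsmooth u -> rsmooth (fun t => u (c * t)).
Proof.
rewrite (_ : (fun t => u (c * t)) = fun t => u (c * t + 0)); first exact: rsmooth_affine.
by apply/funext => t; rewrite addr0.
Qed.

(** Derivatives of positive order vanish off [[1, 2]], where continuity bounds them. *)
Lemma step_euler_bound alpha k : rsmooth alpha ->
  (forall t, t <= 1 -> alpha t = 0) -> (forall t, 2 <= t -> alpha t = 1) ->
  exists2 A, 0 <= A & forall i, (0 < i <= k)%N -> forall y, 0 < y ->
    y ^+ i * `|derive1n i alpha y| <= A.
Proof.
move=> sa a0 a1.
have out i y : (0 < i)%N -> ~~ (1 <= y <= 2) -> derive1n i alpha y = 0.
  move=> i0; rewrite negb_and -!ltNge => /orP[y1|y2].
    apply: (@derive1n_eq0 _ _ _ [set x : R | x < 1]) => //.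
    by move=> x /= x1; rewrite a0// ltW.
  rewrite (@eq_open_derive1n _ i alpha (fun=> 1) [set x : R | 2 < x])//.
    by rewrite -(prednK i0) derive1n_cst.
  by move=> x /= x2; rewrite a1// ltW.
elim: k => [|k [A A0 HA]].
  by exists 0 => // i; case: i.
have [M M0 HM] := @segment_bounded R 1 2 (fun y => y ^+ k.+1 * derive1n k.+1 alpha y)
  (rsmooth_continuous (rsmoothM (rsmoothX k.+1 (@rsmooth_id R)) (rsmooth_derive1n k.+1 sa))).
exists (A + M) => [|i /andP[i0]]; first exact: addr_ge0.
rewrite leq_eqVlt => /predU1P[ik|ik] y y0; last first.
  have Hi : (0 < i <= k)%N by rewrite i0.
  by rewrite (le_trans (HA i Hi y y0))// lerDl.
have [y12|/out ->//] := boolP (1 <= y <= 2); last by rewrite normr0 mulr0 addr_ge0.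
rewrite (@le_trans _ _ M) ?lerDr// ik; apply: le_trans (HM _ y12).
by rewrite normrM normrX gtr0_norm.
Qed.

(** Euler weights are dilation invariant, so [A] serves for every [c]. Where the derivative does not
    vanish, [(1 + |ln t|) / L] is at least 1 and may be inserted as a factor. *)
Lemma euler_bound_dilate k beta c A L : rsmooth beta -> 0 < c -> 0 < L ->
  (forall i, (i <= k)%N -> forall y, 0 < y -> y ^+ i * `|derive1n i beta y| <= A) ->
  (forall i, (i <= k)%N -> forall t, 0 < t ->
     derive1n i beta (c * t) = 0 \/ L <= 1 + `|ln t|) ->
  euler_bound k (fun t => beta (c * t)) (fun t => A * (1 + `|ln t|) / L).
Proof.
move=> sb c0 L0 HA HL i ik t t0.
have -> : (fun t => beta (c * t)) = (fun t => beta (c * t + 0)).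
  by apply/funext => s; rewrite addr0.
rewrite derive1n_affine// addr0 normrM normrX (gtr0_norm c0) mulrA -exprMn [t * c]mulrC.
have A0 : 0 <= A by apply: le_trans (HA 0%N _ 1 ltr01); rewrite // mulr_ge0.
have [->|Lt] := HL i ik t t0.
  by rewrite normr0 mulr0 divr_ge0 ?(ltW L0)// mulr_ge0// addr_ge0.
apply: (le_trans (HA i ik _ (mulr_gt0 c0 t0))).
by rewrite ler_pdivlMr// ler_wpM2l.
Qed.

(** The deviation from 1 has two pieces: [alpha (c t) - 1] lives on [t <= 2 / c] and [alpha (t / c)]
    on [t >= c]. On both, [|ln t| >= ln (c / 2)]. *)
Lemma cutoff_euler_bound alpha k : rsmooth alpha -> (forall t, 0 <= alpha t <= 1) ->
  (forall t, t <= 1 -> alpha t = 0) -> (forall t, 2 <= t -> alpha t = 1) ->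
  exists2 A, 0 <= A & forall c, 2 <= c ->
    euler_bound k (fun t => alpha (c * t) - alpha (c^-1 * t) - 1)
      (fun t => A * (1 + `|ln t|) / (1 + ln (c / 2))).
Proof.
move=> sa a01 a0 a1; have [A A0 HA] := step_euler_bound k sa a0 a1.
exists ((1 + A) + (1 + A)) => [|c c2]; first by rewrite !addr_ge0.
have c0 : 0 < c by exact: lt_le_trans c2.
have lc : 0 <= ln (c / 2) by rewrite ln_ge0// ler_pdivlMr// mul1r.
have L0 : 0 < 1 + ln (c / 2) by rewrite ltr_pwDl.
have s1 : rsmooth (fun y => alpha y - 1) by apply: rsmoothB => //; exact: rsmooth_cst.
have s2 : rsmooth (fun y => (-1) * alpha y) by exact: rsmoothZ.
have E i y : (0 < i)%N -> derive1n i (fun y => alpha y - 1) y = derive1n i alpha y.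
  case: i => // i _; rewrite derive1nB//; last exact: rsmooth_cst.
  by rewrite derive1n_cst subr0.
have E' i y : derive1n i (fun y => (-1) * alpha y) y = - derive1n i alpha y.
  by rewrite derive1nZ// mulN1r.
have H1 : euler_bound k (fun t => (fun y => alpha y - 1) (c * t))
    (fun t => (1 + A) * (1 + `|ln t|) / (1 + ln (c / 2))).
  apply: (@euler_bound_dilate k (fun y => alpha y - 1) c (1 + A)) => // i ik y y0.
    case: i ik => [|i] ik.
      rewrite mul1r ler_wpDr//= ler_norml; have /andP[h1 h2] := a01 y.
      by apply/andP; split; lra.
    by rewrite E// ler_wpDl// HA.
  have [cy|cy] := ltP 2 (c * y).
    left; case: i ik => [|i] ik; first by rewrite /= a1 ?subrr// ltW.
    rewrite (@eq_open_derive1n _ _ _ (fun=> 0) [set x : R | 2 < x])//.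
      by rewrite derive1n_cst.
    by move=> x /= x2; rewrite a1 ?subrr// ltW.
  right; rewrite lerD2l -normrN (le_trans _ (ler_norm _))//.
  rewrite -lnV ?posrE// ler_ln ?posrE ?invr_gt0 ?divr_gt0//.
  by rewrite ler_pdivrMr// mulrC ler_pdivlMr.
have H2 : euler_bound k (fun t => (fun y => (-1) * alpha y) (c^-1 * t))
    (fun t => (1 + A) * (1 + `|ln t|) / (1 + ln (c / 2))).
  apply: (@euler_bound_dilate k (fun y => (-1) * alpha y) c^-1 (1 + A));
    rewrite ?invr_gt0// => i ik y y0.
    case: i ik => [|i] ik.
      rewrite mul1r ler_wpDr//= mulN1r normrN ler_norml; have /andP[h1 h2] := a01 y.
      by apply/andP; split; lra.
    by rewrite E' normrN ler_wpDl// HA.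
  have [cy|cy] := ltP (c^-1 * y) 1.
    left; rewrite E' (@derive1n_eq0 _ _ _ [set x : R | x < 1]) ?oppr0//.
    by move=> x /= x1; rewrite a0// ltW.
  right; rewrite lerD2l (le_trans _ (ler_norm _))//.
  rewrite ler_ln ?posrE ?divr_gt0//.
  move: cy; rewrite mulrC ler_pdivlMr// mul1r; apply: le_trans.
  by rewrite ler_pdivrMr// ler_peMr ?(ltW c0)// ler1n.
have := euler_boundD (rsmooth_dilate c s1) (rsmooth_dilate c^-1 s2) H1 H2.
rewrite (_ : (fun t => _ + _) = fun t => alpha (c * t) - alpha (c^-1 * t) - 1); last first.
  by apply/funext => t; rewrite mulN1r addrAC.
apply: euler_bound_le => t t0.
by rewrite -mulrDl -mulrDl.
Qed.

Lemma decaying_cutoff g : decaying g -> (forall t, 0 <= g t) ->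
  exists phi : nat -> R -> R, [/\ forall j, rtest (phi j), forall j t, 0 <= phi j t &
    S0null (fun j t => (phi j t - g t)%:C)].
Proof.
move=> [sg Hg] g0; have [alpha [sa a01 a0 a1]] := @smooth_step_exists R.
pose c j : R := j.+2%:R.
have c2 j : 2 <= c j by rewrite ler_nat.
have c0 j : 0 < c j by exact: lt_le_trans (c2 j).
have sd d : rsmooth (fun t => alpha (d * t)) by exact: rsmooth_dilate.
pose chi j t := alpha (c j * t) - alpha ((c j)^-1 * t).
have sc j : rsmooth (chi j) by exact: rsmoothB.
exists (fun j t => chi j t * g t); split.
- move=> j; exists (c j)^-1, (2 * c j); split.
  + exact: rsmoothM.
  + by rewrite invr_gt0.
  + rewrite (@le_trans _ _ 1)//; first by rewrite invf_le1// (le_trans _ (c2 j))// ler1n.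
    by have := c2 j; lra.
  + move=> t; rewrite negb_and -!ltNge => /orP[t1|t2]; rewrite /chi.
      rewrite !a0 ?subrr ?mul0r//.
        rewrite mulrC -ler_pdivlMr ?invr_gt0// invrK mul1r (le_trans (ltW t1))//.
        rewrite (@le_trans _ _ 1)//; first by rewrite invf_le1// (le_trans _ (c2 j))// ler1n.
        by have := c2 j; lra.
      by rewrite mulrC -ler_pdivlMr// mul1r ltW.
    have h1 : 2 <= (c j)^-1 * t by rewrite mulrC ler_pdivlMr// ltW.
    have h2 : 2 <= c j * t by have := c2 j; nra.
    by rewrite !a1// subrr mul0r.
- move=> j t; rewrite mulr_ge0// subr_ge0.
  (* The cutoff is nonnegative: up to [c j] the subtracted step is still 0, and beyond it the first
     step is already 1. *)
  have [tc|tc] := leP t (c j).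
    rewrite [leLHS]a0; first by have /andP[] := a01 (c j * t).
    by rewrite mulrC ler_pdivrMr// mul1r.
  rewrite [leRHS]a1; first by have /andP[] := a01 ((c j)^-1 * t).
  have := c2 j; nra.
apply: S0null_real => k e e0.
have [A A0 HA] := cutoff_euler_bound k sa a01 a0 a1.
have [B B0 HB] := Hg k.
(* The product bound is [2^k A B / (1 + ln (c j / 2))] times [logw]; it drops below [e * logw] once
   [1 + ln (c j / 2)] reaches [K]. *)
pose K : R := 2 ^+ k * (A * B) / e.
have K0 : 0 <= K by rewrite divr_ge0 ?(ltW e0)// mulr_ge0 ?exprn_ge0// mulr_ge0.
near=> j.
have Kj : K <= 1 + ln (c j / 2).
  rewrite -[K]expRK; apply: (@le_trans _ _ (ln (c j / 2))); last by rewrite lerDr.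
  rewrite ler_ln ?posrE ?expR_gt0 ?divr_gt0// ler_pdivlMr//.
  apply: (@le_trans _ _ (j%:R)); last by rewrite ler_nat -addn2 leq_addr.
  by near: j; exact: nbhs_infty_ger.
have lc : 0 <= ln (c j / 2) by rewrite ln_ge0// ler_pdivlMr// mul1r.
have L0 : 0 < 1 + ln (c j / 2) by rewrite ltr_pwDl.
have sw : rsmooth (fun t => alpha (c j * t) - alpha ((c j)^-1 * t) - 1).
  exact: (rsmoothB (sc j) (rsmooth_cst 1)).
have := euler_boundM sw sg (HA _ (c2 j)) HB.
rewrite (_ : (fun t => _ * g t) = fun t => chi j t * g t - g t); last first.
  by apply/funext => t; rewrite mulrBl mul1r.
apply: euler_bound_le => t t0.
have t1 : 0 < 1 + t by rewrite addr_gt0.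
rewrite [leLHS](_ : _ = 2 ^+ k * (A * B) / (1 + ln (c j / 2)) * logw t).
  by rewrite ler_pM2r ?logw_gt0// ler_pdivrMr// -ler_pdivrMl// mulrC.
by rewrite /logw; field; rewrite !gt_eqF.
Unshelve. all: by end_near. Qed.

End LogarithmicCutoffs.

(** * The Post-Widder operators and their commutation with [x d/dx] *)

Section PostWidder.
Set Implicit Arguments.
Unset Strict Implicit.
Context {R : realType}.
Implicit Types (u v psi : R -> R) (a b c d e p q s t x y A L T : R) (n k : nat).

(** Valid also for [t <= 0]: [u (c / x)] vanishes for all [x < c / q], so [1 / x] is differentiated
    only away from the origin. *)
Lemma is_derive_inv_scale p q c u t : rtest_on p q u -> 0 < c ->
  is_derive t 1 (fun x => u (c / x))
    (- c^-1 * ((c / t) ^+ 2 * derive1 u (c / t))).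
Proof.
move=> [su p0 pq u0] c0; have q0 : 0 < q by exact: lt_le_trans pq.
have out x : x < c / q -> ~~ (p <= c / x <= q).
  move=> xq; apply/negP => /andP[h1 h2].
  have cx0 : 0 < c / x by exact: lt_le_trans h1.
  have x0 : 0 < x by move: cx0; rewrite pmulr_rgt0// invr_gt0.
  by move: h2; rewrite leNgt => /negP; apply; rewrite ltr_pdivlMr// mulrC -ltr_pdivlMr.
have [tq|tq] := ltP t (c / q).
  have u0' := @supp_in_derive1n _ _ _ _ 1 u0.
  rewrite [derive1 u _](u0' (c / t) (out t tq)) !mulr0.
  apply: (@near_eq_is_derive _ R R (fun=> 0)).
  near=> x; rewrite u0//; apply: out; near: x; exact: lt_nbhsl.
have t0 : 0 < t by apply: lt_le_trans tq; exact: divr_gt0.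
have dV : is_derive t 1 (fun x : R => x^-1) (- t ^- 2 * 1).
  have tn0 : t != 0 by rewrite gt_eqF.
  exact: (@is_deriveV _ (fun x => x) t 1 1 tn0 (is_derive_id _ _)).
have dc := is_derive_scalef c dV.
have -> : - c^-1 * ((c / t) ^+ 2 * derive1 u (c / t)) =
    derive1 u (c / t) * (c * (- t ^- 2 * 1)) by field; rewrite !gt_eqF.
exact: (@is_derive1_comp _ u (fun x => c / x) t _ _ (rsmooth_is_derive (c / t) su) dc).
Unshelve. all: by end_near. Qed.

Lemma rtest_on_inv_scale p q c u : rtest_on p q u -> 0 < c ->
  rtest_on (c / q) (c / p) (fun x => u (c / x)).
Proof.
move=> T c0; have [su p0 pq u0] := T; have q0 : 0 < q by exact: lt_le_trans pq.
split.
(* Differentiation replaces [v] by [s^2 v'] and changes the constant [e], so this class is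
   stable. *)
- apply: (@rsmooth_class _ (fun f => exists v e, rtest_on p q v /\
    f = fun x => e * v (c / x))); last first.
    by exists u, 1; split=> //; apply/funext => x; rewrite mul1r.
  move=> _ [v [e [Tv ->]]]; exists (fun t => e * (- c^-1 * ((c / t) ^+ 2 * derive1 v (c / t)))).
    exists (fun s => s ^+ 2 * derive1 v s), (e * - c^-1); split.
      apply: rtest_onM (rtest_on_derive1n 1 Tv); apply: rsmoothX; exact: rsmooth_id.
    by apply/funext => x; rewrite !mulrA.
  by move=> t; apply: is_derive_scalef; exact: is_derive_inv_scale Tv c0.
- exact: divr_gt0.
- by rewrite ler_pM2l// lef_pV2.
- move=> t tn; apply: u0; apply: contra tn => /andP[h1 h2].
  have cx0 : 0 < c / t by exact: lt_le_trans h1.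
  have x0 : 0 < t by move: cx0; rewrite pmulr_rgt0// invr_gt0.
  rewrite ler_pdivrMr// mulrC -ler_pdivrMr// h2/=.
  by rewrite ler_pdivlMr// mulrC -ler_pdivlMr.
Qed.

Definition pwF n psi t : R := (n`!%:R)^-1 * (t ^+ n * psi (n.+1%:R / t)).

(* Post-Widder: [pw n psi] is the average of [psi] against a Gamma density of mean [1] and variance [1 / n.+1] in the multiplicative variable. *)
Definition pw n psi : R -> R := rlap (derive1n n.+1 (pwF n psi)).

Lemma rtest_on_pwF n p q psi : rtest_on p q psi ->
  rtest_on (n.+1%:R / q) (n.+1%:R / p) (pwF n psi).
Proof.
move=> T; apply: rtest_onM; first exact: rsmooth_cst.
apply: rtest_onM; first by apply: rsmoothX; exact: rsmooth_id.
exact: rtest_on_inv_scale.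
Qed.

Lemma rtest_pwF n psi : rtest psi -> rtest (pwF n psi).
Proof. by move=> [p [q T]]; exists (n.+1%:R / q), (n.+1%:R / p); exact: rtest_on_pwF. Qed.

Lemma pwE n psi x : rtest psi -> pw n psi x = x ^+ n.+1 * rlap (pwF n psi) x.
Proof. by move=> T; rewrite /pw rlap_derive1n//; exact: rtest_pwF. Qed.

Lemma rsmooth_pw n psi : rtest psi -> rsmooth (pw n psi).
Proof. by move=> T; apply: rsmooth_rlap; apply: rtest_derive1n; exact: rtest_pwF. Qed.

Lemma pwD n u v x : rtest u -> rtest v ->
  pw n (fun t => u t + v t) x = pw n u x + pw n v x.
Proof.
move=> tu tv; rewrite !pwE//; last exact: rtestD.
rewrite -mulrDr -rlapD; [|exact: rtest_pwF..].
congr (_ * rlap _ _); apply/funext => t; rewrite /pwF; ring.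
Qed.

Lemma pwZ n c u x : rtest u -> pw n (fun t => c * u t) x = c * pw n u x.
Proof.
move=> tu; rewrite !pwE//; last exact: rtestZ.
rewrite mulrCA -(rlapZ c); last exact: rtest_pwF.
congr (_ * rlap _ _); apply/funext => t; rewrite /pwF; ring.
Qed.

Lemma is_derive_pwF n psi t : rtest psi ->
  is_derive t 1 (pwF n psi) ((n`!%:R)^-1 * (n%:R * t ^+ n.-1 * psi (n.+1%:R / t)
    + t ^+ n * (- n.+1%:R^-1 * ((n.+1%:R / t) ^+ 2 * derive1 psi (n.+1%:R / t))))).
Proof.
move=> [p [q T]]; apply: is_derive_scalef.
have n0 : (0 : R) < n.+1%:R by rewrite ltr0n.
exact: (is_derive_mulf (is_derive_exprn n t) (is_derive_inv_scale t T n0)).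
Qed.

(** In [s = (n + 1) / t] the field [s d/ds] is [- t d/dt]. With [F = pwF n psi] this gives
    [pwF n (s psi') = (n + 1) F - (t F)'], whose Laplace transform times [x^(n+1)] is [x] times the
    derivative of [x^(n+1) L F]. *)
Lemma pw_theta n psi x : rtest psi ->
  x * derive1 (pw n psi) x = pw n (fun s => s * derive1 psi s) x.
Proof.
move=> tp; have tF := rtest_pwF n tp.
have sF := rtest_smooth tF.
have tp' : rtest (fun s => s * derive1 psi s).
  by apply: rtestM (rtest_derive1n 1 tp); exact: rsmooth_id.
have tG : rtest (fun t => - t * pwF n psi t) by apply: rtestM tF; exact: rsmooth_opp.
have dX := is_derive_exprn n.+1 x.
have -> : pw n psi = fun x => x ^+ n.+1 * rlap (pwF n psi) x.
  by apply/funext => y; exact: pwE.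
have dW := is_derive_mulf dX (is_derive_rlap x tF).
have -> : derive1 (fun x => x ^+ n.+1 * rlap (pwF n psi) x) x =
    n.+1%:R * x ^+ n * rlap (pwF n psi) x + x ^+ n.+1 * rlap (fun t => - t * pwF n psi t) x.
  by rewrite derive1E; have [_ ->] := dW.
rewrite pwE//.
have -> : rlap (pwF n (fun s => s * derive1 psi s)) x =
    n.+1%:R * rlap (pwF n psi) x + x * rlap (fun t => - t * pwF n psi t) x.
  rewrite -rlapZ// -rlap_derive1// -rlapD; last exact: (rtest_derive1n 1).
    congr (rlap _ x); apply/funext => t.
    have sN : rsmooth (fun t : R => - t) := rsmooth_opp.
    have -> : derive1 (fun t => - t * pwF n psi t) t =
        - 1 * pwF n psi t + - t * derive1 (pwF n psi) t.
      have dN : is_derive t 1 (fun t : R => - t) (-1) by exact: is_deriveN.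
      by rewrite derive1E; have [_ ->] := is_derive_mulf dN (rsmooth_is_derive t sF).
    rewrite [derive1 (pwF n psi) t]derive1E; have [_ ->] := is_derive_pwF n t tp.
    (* At [t = 0] the inverse is 0 by convention, and [psi] vanishes at 0. *)
    rewrite /pwF; have [->|t0] := eqVneq t 0.
      have [p [q [_ p0 _ psi0]]] := tp.
      have z : psi 0 = 0 by apply: psi0; rewrite negb_and -ltNge p0.
      by rewrite invr0 !mulr0 z !mulr0 mul0r oppr0 !mul0r !mulr0 !addr0.
    have f0 : (n`!%:R : R) != 0 by rewrite pnatr_eq0 -lt0n fact_gt0.
    have n0 : (n.+1%:R : R) != 0 by rewrite pnatr_eq0.
    (* For [n = 0] the exponent [n.-1] is truncated to 0, but the factor [n%:R] vanishes. *)
    have tn : n%:R * t ^+ n.-1 * t = n%:R * t ^+ n.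
      by case: n {tF sF tp' tG dX dW f0 n0} => [|n] /=; rewrite ?mul0r// -mulrA -exprSr.
    have -> : n.+1%:R = n%:R + 1 :> R by rewrite -natr1.
    rewrite -natr1 in n0.
    transitivity (n`!%:R^-1 * (t ^+ n * ((n%:R + 1) / t * derive1 psi ((n%:R + 1) / t)))); first by [].
    transitivity (n`!%:R^-1 * ((n%:R * t ^+ n - n%:R * t ^+ n.-1 * t) * psi ((n%:R + 1) / t) +
      t ^+ n * ((n%:R + 1) / t * derive1 psi ((n%:R + 1) / t)))).
      by rewrite tn subrr mul0r add0r.
    by field; rewrite n0 t0 f0.
  exact: rtestZ.
rewrite !exprS; ring.
Qed.

Lemma rtest_euler psi k : rtest psi -> rtest (fun s => s ^+ k * derive1n k psi s).
Proof.
move=> tp; apply: rtestM (rtest_derive1n k tp).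
by apply: rsmoothX; exact: rsmooth_id.
Qed.

(** With [D = d/dx] one has [x^(k+1) D^(k+1) = (x D - k) x^k D^k], and [pw n] is linear and commutes
    with [x D]. *)
Lemma pw_euler n psi k x : rtest psi ->
  x ^+ k * derive1n k (pw n psi) x = pw n (fun s => s ^+ k * derive1n k psi s) x.
Proof.
move=> tp; elim: k x => [|k IH] x.
  by rewrite mul1r; congr (pw n _ x); apply/funext => s; rewrite mul1r.
have sw := rsmooth_pw n tp; have sp := rtest_smooth tp.
have dE f t : rsmooth f -> t * derive1 (fun s => s ^+ k * derive1n k f s) t =
    k%:R * (t ^+ k * derive1n k f t) + t ^+ k.+1 * derive1n k.+1 f t.
  move=> sf; have dX := is_derive_exprn k t.
  rewrite [derive1 _ t]derive1E.
  have [_ ->] := is_derive_mulf dX (rsmooth_is_derive t (rsmooth_derive1n k sf)).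
  rewrite -derive1nS mulrDr mulrA [t * (_ * _)]mulrC.
  rewrite -[k%:R * _ * t]mulrA -exprSr [t * _]mulrA -exprS.
  by case: k {IH dX} => [|k]; rewrite ?mul0r// mulrA.
have := @pw_theta n (fun s => s ^+ k * derive1n k psi s) x (rtest_euler k tp).
have -> : pw n (fun s => s ^+ k * derive1n k psi s) = fun x => x ^+ k * derive1n k (pw n psi) x.
  by apply/funext => y; rewrite IH.
rewrite (dE _ _ sw).
have -> : (fun s => s * derive1 (fun t => t ^+ k * derive1n k psi t) s) =
    fun s => k%:R * (s ^+ k * derive1n k psi s) + s ^+ k.+1 * derive1n k.+1 psi s.
  by apply/funext => s; exact: (dE _ _ sp).
rewrite pwD; [|by apply: rtestZ; exact: rtest_euler|exact: rtest_euler].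
by rewrite pwZ -?IH; [move/addrI|exact: rtest_euler].
Qed.

End PostWidder.

(** * Quantitative convergence of the Post-Widder operators *)

Section PostWidderEstimate.
Set Implicit Arguments.
Unset Strict Implicit.
Context {R : realType}.
Implicit Types (u v f psi : R -> R) (a b c d e p s t x y A B C L T lam : R) (n k : nat).

Lemma exprn_expRN_le n lam : 0 < lam ->
  exists2 C, 0 <= C & forall T, 0 < T -> T ^+ n * expR (- (T * lam)) <= C / T.
Proof.
move=> l0; exists (n.+1%:R ^+ n.+1 / lam ^+ n.+1) => [|T T0].
  by rewrite divr_ge0 ?exprn_ge0// ltW.
rewrite expRN ler_pdivrMr ?expR_gt0// mulrAC ler_pdivlMr// mulrAC ler_pdivlMr ?exprn_gt0//.
rewrite -exprSr -exprMn; apply: exprn_le_expR.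
by rewrite mulr_ge0 ?ltW.
Qed.

(** [q T] is the tail of the Gamma integral from [T] to infinity. It is built by the recursion of
    integration by parts, so no improper integral has to be handled. *)
Lemma gamma_tail n lam : 0 < lam -> exists (q : R -> R) C, [/\ 0 <= C,
  forall T, is_derive T 1 q (- (expR (- (T * lam)) * T ^+ n)),
  q 0 = n`!%:R / lam ^+ n.+1, forall T, 0 <= T -> 0 <= q T &
  forall T, 0 < T -> q T <= C / T].
Proof.
move=> l0; elim: n => [|n [q [C [C0 dq q0 qp qC]]]].
  have [C C0 HC] := exprn_expRN_le 0 l0.
  exists (fun T => lam^-1 * expR (- (T * lam))), (lam^-1 * C); split.
  - by rewrite mulr_ge0// invr_ge0 ltW.
  - move=> T; have := is_derive_scalef lam^-1 (is_derive_expR_scale lam T).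
    by rewrite mulrA mulrN mulVf ?gt_eqF// mulN1r expr0 mulr1.
  - by rewrite mul0r oppr0 expR0 mulr1 fact0 expr1 mul1r.
  - by move=> T _; rewrite mulr_ge0 ?expR_ge0// invr_ge0 ltW.
  - by move=> T /HC; rewrite mul1r -mulrA ler_pM2l// invr_gt0.
have [D D0 HD] := exprn_expRN_le n.+1 l0.
exists (fun T => lam^-1 * (T ^+ n.+1 * expR (- (T * lam)) + n.+1%:R * q T)),
  (lam^-1 * (D + n.+1%:R * C)); split.
- by rewrite mulr_ge0 ?invr_ge0 ?(ltW l0)// addr_ge0// mulr_ge0.
- move=> T; have := is_derive_scalef lam^-1 (is_derive_addf
    (is_derive_mulf (is_derive_exprn n.+1 T) (is_derive_expR_scale lam T))
    (is_derive_scalef n.+1%:R (dq T))).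
  rewrite [X in is_derive _ _ _ X -> _](_ : _ = - (expR (- (T * lam)) * T ^+ n.+1))//=.
  by field; rewrite gt_eqF.
- rewrite q0 expr0n/= mul0r add0r factS natrM (exprS lam n.+1).
  by field; rewrite expf_neq0 gt_eqF.
- by move=> T T0; rewrite mulr_ge0 ?invr_ge0 ?(ltW l0)// addr_ge0// mulr_ge0 ?exprn_ge0 ?expR_ge0 ?qp.
- move=> T T0; rewrite -mulrA ler_pM2l ?invr_gt0// mulrDl lerD ?HD//.
  by rewrite -mulrA ler_wpM2l ?qC.
Qed.

Definition gker lam n t : R := expR (- (t * lam)) * t ^+ n.

Lemma gker_continuous lam n : continuous (gker lam n).
Proof.
apply: rsmooth_continuous; apply: rsmoothM; first exact: rsmooth_expR_scale.
by apply: rsmoothX; exact: rsmooth_id.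
Qed.

Lemma gamma_moment n lam : 0 < lam ->
  exists2 C, 0 <= C & forall T, 0 < T ->
    n`!%:R / lam ^+ n.+1 - C / T <= segint 0 T (gker lam n) <= n`!%:R / lam ^+ n.+1.
Proof.
move=> l0; have [q [C [C0 dq q0 qp qC]]] := gamma_tail n l0.
exists C => // T T0.
have -> : segint 0 T (gker lam n) = - q T - - q 0.
  apply: (@segint_FTC _ 0 T (fun x => - q x)) => [|t|]; first exact: ltW.
    by have := is_deriveN (dq t); rewrite opprK.
  exact: gker_continuous.
rewrite opprK [- q T + _]addrC q0 gerBl qp ?(ltW T0)// andbT.
by rewrite lerB// qC.
Qed.

Lemma segint_abs_le a b f u : continuous f -> continuous u ->
  (forall t, a <= t <= b -> `|f t| <= u t) -> `|segint a b f| <= segint a b u.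
Proof.
move=> cf cu H; rewrite ler_norml; apply/andP; split.
  rewrite -mulN1r -segintZ//; apply: le_segint => //.
    by move=> t; apply: cvgMr; exact: cu.
  by move=> t /H; rewrite ler_norml mulN1r => /andP[].
by apply: le_segint => // t /H; exact: le_trans (ler_norm _).
Qed.

Lemma rtest_lipschitz psi : rtest psi ->
  exists2 L, 0 <= L & forall x y, `|psi x - psi y| <= L * `|x - y|.
Proof.
move=> tp; have sp := rtest_smooth tp.
have [L L0 HL] := rtest_bounded (rtest_derive1n 1 tp).
exists L => // x y; wlog xy : x y / x <= y => [H|].
  have [/H//|/ltW/H] := leP x y; by rewrite distrC [`|y - x|]distrC.
have [c _ E] := MVT_segment xy (fun t _ => rsmooth_is_derive t sp)
  (continuous_subspaceT (rsmooth_continuous sp)).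
by rewrite distrC E normrM [`|y - x|]distrC ler_wpM2r// HL.
Qed.

(* With [s = lam * t / N], the point [N / t] equals [lam / s]. *)
Lemma pw_pointwise psi : rtest psi -> exists2 A, 0 <= A &
  forall N t lam, 0 < N -> 0 <= t -> 0 < lam ->
    (1 + lam) * `|psi (N / t) - psi lam| <= A * `|(lam * t / N) ^+ 2 - 1|.
Proof.
move=> tp; have [L L0 HL] := rtest_lipschitz tp.
have [p0 [q0 T0]] := tp; have [p [q [[sp p1 pq pz] _ psiq]]] := rtest_on_boundary T0.
have q1 : 0 < q by exact: lt_le_trans pq.
have zq y : q <= y -> psi y = 0.
  rewrite le_eqVlt => /predU1P[<-//|qy]; apply: pz.
  by rewrite negb_and -!ltNge qy orbT.
exists (L * q * (1 + q)) => [|N t lam N0 t0 l0].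
  by rewrite !mulr_ge0 ?addr_ge0// ltW.
set s := lam * t / N; set X := `|_|.
have s0 : 0 <= s by rewrite divr_ge0 ?mulr_ge0 ?(ltW l0)// ltW.
(* In [|s^2 - 1| = |1 - s| (1 + s)] the second factor pays for the weight [1 + lam], by the
   alternative on [lam]. This is why the bound uses [s^2 - 1] rather than [s - 1]. *)
suff [H1 H2] : X <= L * (q * `|1 - s|) /\ (X = 0 \/ lam <= q + q * s).
  have -> : `|s ^+ 2 - 1| = `|1 - s| * (1 + s).
    rewrite -[1 + s]ger0_norm ?addr_ge0// -normrM -[LHS]normrN; congr `|_|; ring.
  case: H2 => [->|H2].
    by rewrite mulr0 !mulr_ge0 ?addr_ge0// ltW.
  rewrite [leRHS](_ : _ = (1 + q) * (1 + s) * (L * (q * `|1 - s|))); last by ring.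
  have l1 : 1 + lam <= (1 + q) * (1 + s) by nra.
  by apply: ler_pM; [rewrite addr_ge0// ltW|exact: normr_ge0| |].
have [/andP[tp0 Nt]|far] := boolP ((0 < t) && (N / t < q)).
  have E : lam = N / t * s by rewrite /s; field; rewrite !gt_eqF.
  have m0 : 0 <= N / t by rewrite divr_ge0 ?ltW.
  split; last by right; rewrite E ler_wpDl ?(ltW q1)// ler_wpM2r// ltW.
  apply: (le_trans (HL _ _)); rewrite ler_wpM2l// {1}E -{1}[N / t]mulr1 -mulrBr.
  by rewrite normrM (ger0_norm m0) ler_wpM2r// ltW.
have psiNt : psi (N / t) = 0.
  move: far; rewrite negb_and -!leNgt => /orP[t0'|/zq//].
  have -> : t = 0 by apply/eqP; rewrite eq_le t0' t0.
  rewrite invr0 mulr0; apply: pz; by rewrite negb_and -ltNge p1.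
have [lq|lq] := leP q lam.
  have X0 : X = 0 by rewrite /X psiNt (zq _ lq) subrr normr0.
  split; last by left.
  by rewrite X0 !mulr_ge0// ltW.
(* Here [psi (N / t) = 0 = psi q], so [psi lam] can be compared with [psi q]; this inequality turns
   [q - lam] into at most [q (1 - s)]. *)
have sq : q * s <= lam.
  move: far; rewrite negb_and -!leNgt => /orP[t0'|Nt].
    have -> : s = 0 by rewrite /s (_ : t = 0) ?mulr0 ?mul0r//; apply/eqP; rewrite eq_le t0' t0.
    by rewrite mulr0 ltW.
  have tp0 : 0 < t.
    rewrite lt_neqAle t0 andbT eq_sym; apply: contraTneq Nt => ->.
    by rewrite invr0 mulr0 -ltNge.
  rewrite /s mulrA ler_pdivrMr// mulrCA ler_pM2l//.
  by move: Nt; rewrite ler_pdivlMr.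
split; last by right; apply: ler_wpDr; [rewrite mulr_ge0// ltW|exact: ltW].
rewrite /X psiNt -(zq q (lexx q)); apply: (le_trans (HL _ _)).
rewrite ler_wpM2l// ger0_norm ?subr_ge0 ?(ltW lq)//.
apply: (@le_trans _ _ (q * (1 - s))); first by rewrite mulrBr mulr1 lerD2l lerN2.
by rewrite ler_wpM2l ?ler_norm// ltW.
Qed.

(** The left side is the mean of [(s^2 - 1)^2] for a Gamma variable of mean 1 and shape [N = n + 1].
    It equals [(4 N^2 + 11 N + 6) / N^3], and 4 + 11 + 6 = 21. *)
Lemma gamma_fourth n :
  (n + 4)`!%:R / (n`!%:R * n.+1%:R ^+ 4) -
  2 * ((n + 2)`!%:R / (n`!%:R * n.+1%:R ^+ 2)) + 1 <= 21 / n.+1%:R :> R.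
Proof.
set N : R := n.+1%:R; have N1 : 1 <= N by rewrite ler1n.
have N0 : 0 < N by exact: lt_le_trans N1.
have f0 : (0 : R) < n`!%:R by rewrite ltr0n fact_gt0.
have E2 : (n + 2)`!%:R = n`!%:R * N * (N + 1) :> R.
  by rewrite addn2 !factS !natrM -(natr1 n.+1) -/N; ring.
have E4 : (n + 4)`!%:R = n`!%:R * N * (N + 1) * (N + 2) * (N + 3) :> R.
  rewrite addn4 !factS !natrM.
  by rewrite -(natr1 n.+3) -(natr1 n.+2) -(natr1 n.+1) -/N; ring.
rewrite E2 E4 (_ : _ + 1 = (4 * N ^+ 2 + 11 * N + 6) / N ^+ 3); last first.
  by field; rewrite !gt_eqF.
rewrite ler_pdivrMr ?exprn_gt0// (_ : 21 / N * N ^+ 3 = 21 * N ^+ 2); last first.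
  by field; rewrite gt_eqF.
nra.
Qed.

(** Average the pointwise bound against the Gamma density, with [|y| <= d + y^2 / d] for
    [y = s^2 - 1] in place of the Cauchy-Schwarz inequality: only the moments of [gamma_fourth]
    enter, and [d] stays free. *)
Lemma pw_estimate psi : rtest psi -> exists2 A, 0 <= A &
  forall n d lam, 0 < d -> 0 < lam ->
    (1 + lam) * `|pw n psi lam - psi lam| <= A * (d + 21 / n.+1%:R / d).
Proof.
move=> tp; have [A A0 HA] := pw_pointwise tp.
exists A => // n d lam d0 l0.
pose N : R := n.+1%:R; have N0 : 0 < N by rewrite ltr0n.
have [p [q Tp]] := tp; have [sp p0 pq psi0] := Tp.
have q0 : 0 < q by exact: lt_le_trans pq.
have f0 : (0 : R) < n`!%:R by rewrite ltr0n fact_gt0.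
pose K := lam ^+ n.+1 / n`!%:R.
have K0 : 0 < K by rewrite divr_gt0// exprn_gt0.
have [C0 C00 HC0] := gamma_moment n l0.
have [C2 C20 HC2] := gamma_moment (n + 2) l0.
have [C4 _ HC4] := gamma_moment (n + 4) l0.
pose a := lam / N; have a0 : 0 < a by rewrite divr_gt0.
pose B := A * (K * (2 * a ^+ 2 * C2) / d) + (1 + lam) * `|psi lam| * (K * C0).
have B0 : 0 <= B.
  rewrite addr_ge0 ?mulr_ge0 ?invr_ge0 ?exprn_ge0 ?addr_ge0// ?ltW//.
(* The left side does not depend on [T], so the truncation errors collected in [B / T] disappear as
   [T] grows. [N / p <= T] puts the support of [pwF n psi] below [T]. *)
suff main T : 0 < T -> N / p <= T ->
    (1 + lam) * `|pw n psi lam - psi lam| <= A * (d + 21 / N / d) + B / T.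
  apply/ler_addgt0Pr => e e0.
  pose T := Num.max (N / p) (B / e + 1).
  have T0 : 0 < T by rewrite lt_max divr_gt0.
  apply: (le_trans (main T T0 _)); first by rewrite le_max lexx.
  rewrite lerD2l ler_pdivrMr// mulrC -ler_pdivrMr// le_max; apply/orP; right.
  by rewrite lerDl.
move=> T0 NT.
have psiNc : continuous (fun t => gker lam n t * psi (N / t)).
  have [sN _ _ _] := rtest_on_inv_scale Tp N0.
  apply: rsmooth_continuous; apply: rsmoothM => //; apply: rsmoothM.
    exact: rsmooth_expR_scale.
  by apply: rsmoothX; exact: rsmooth_id.
have gc m : continuous (gker lam m) by exact: gker_continuous.
have gZ m e : continuous (fun t => e * gker lam m t).
  by move=> t; apply: cvgMr; exact: gc.
have gp m t : 0 <= t -> 0 <= gker lam m t.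
  by move=> t0; rewrite mulr_ge0 ?expR_ge0 ?exprn_ge0.
have pwI : pw n psi lam = K * segint 0 T (fun t => gker lam n t * psi (N / t)).
  rewrite pwE// (rlap_segint _ (rtest_on_pwF n Tp)) /K -mulrA; congr (_ * _).
  rewrite -segintZ//; transitivity (segint 0 T (fun t => expR (- (t * lam)) * pwF n psi t)).
    apply: eq_segint_supp => t.
      move=> /andP[h1 h2] /negP; case; rewrite (le_trans h2 NT) andbT.
      by rewrite (le_trans _ h1)// divr_ge0// ltW.
    move=> _ tn; have [_ _ _ ->] := rtest_on_pwF n Tp; rewrite ?mulr0//.
  by apply: eq_segint => t _; rewrite /pwF /gker -/N; ring.
pose D := segint 0 T (fun t => gker lam n t * psi (N / t) - psi lam * gker lam n t).
(* [K * gker lam n] has mass 1 on the half-line; the last term is the mass lost beyond [T]. *)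
have DE : pw n psi lam - psi lam = K * D + psi lam * (K * segint 0 T (gker lam n) - 1).
  by rewrite pwI /D segintB// segintZ//; ring.
(* This is the kernel times [d + y^2 / d], expanded so that its integral is a combination of the
   moments of order [n], [n + 2] and [n + 4]. *)
pose P t := d * gker lam n t + d^-1 *
  (a ^+ 4 * gker lam (n + 4) t + (- (2 * a ^+ 2) * gker lam (n + 2) t + gker lam n t)).
have cadd (u v : R -> R) : continuous u -> continuous v -> continuous (fun t => u t + v t).
  by move=> cu cv t; apply: cvgD; [exact: cu|exact: cv].
have c1 : continuous (fun t => - (2 * a ^+ 2) * gker lam (n + 2) t + gker lam n t).
  by apply: cadd.
have c2 : continuous (fun t => a ^+ 4 * gker lam (n + 4) t +
    (- (2 * a ^+ 2) * gker lam (n + 2) t + gker lam n t)).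
  exact: (cadd _ _ (gZ _ _) c1).
have c3 : continuous (fun t => d^-1 * (a ^+ 4 * gker lam (n + 4) t +
    (- (2 * a ^+ 2) * gker lam (n + 2) t + gker lam n t))).
  by move=> t; apply: cvgMr; exact: c2.
have cP : continuous P by exact: (cadd _ _ (gZ _ _) c3).
have cD : continuous (fun t => gker lam n t * psi (N / t) - psi lam * gker lam n t).
  by move=> t; apply: cvgB; [exact: psiNc|exact: gZ].
have lam1 : 0 < 1 + lam by rewrite addr_gt0.
have DP : (1 + lam) * `|D| <= A * segint 0 T P.
  rewrite -[1 + lam]gtr0_norm// -normrM -!segintZ//.
  apply: segint_abs_le.
  - by move=> t; apply: cvgMr; exact: cD.
  - by move=> t; apply: cvgMr; exact: cP.
  move=> t /andP[t0 _].
  rewrite (_ : _ * psi (N / t) - _ = gker lam n t * (psi (N / t) - psi lam)); last by ring.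
  rewrite normrM gtr0_norm// normrM (ger0_norm (gp n t t0)) mulrCA.
  set y := (lam * t / N) ^+ 2 - 1.
  have yd : `|y| <= d + d^-1 * y ^+ 2.
    rewrite -subr_ge0 -(@pmulr_lge0 _ d)// -[y ^+ 2]real_normK ?num_real//.
    rewrite (_ : _ * d = (d - `|y| / 2) ^+ 2 + 3 / 4 * `|y| ^+ 2); last first.
      by field; rewrite gt_eqF.
    by rewrite addr_ge0 ?sqr_ge0// mulr_ge0// ?sqr_ge0// divr_ge0.
  have -> : A * P t = gker lam n t * (A * (d + d^-1 * y ^+ 2)).
    by rewrite /P /gker /y /a !exprD; field; rewrite !gt_eqF.
  rewrite ler_wpM2l ?gp//; apply: (le_trans (HA N t lam N0 t0 l0)).
  by rewrite ler_wpM2l.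
have PE : segint 0 T P = d * segint 0 T (gker lam n) + d^-1 *
    (a ^+ 4 * segint 0 T (gker lam (n + 4)) +
    (- (2 * a ^+ 2) * segint 0 T (gker lam (n + 2)) + segint 0 T (gker lam n))).
  by rewrite segintD// !segintZ// segintD// segintZ// segintD// segintZ.
have /andP[m0l m0u] := HC0 T T0; have /andP[m2l _] := HC2 T T0.
have /andP[_ m4u] := HC4 T T0.
set G0 := segint 0 T (gker lam n) in DE PE m0l m0u.
set G2 := segint 0 T (gker lam (n + 2)) in PE m2l.
set G4 := segint 0 T (gker lam (n + 4)) in PE m4u.
have KG0 : K * G0 <= 1.
  rewrite (_ : 1 = K * (n`!%:R / lam ^+ n.+1)); first by rewrite ler_pM2l.
  by rewrite /K; field; rewrite !gt_eqF ?exprn_gt0.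
have KG0' : 1 - K * G0 <= K * C0 / T.
  rewrite (_ : 1 = K * (n`!%:R / lam ^+ n.+1)); last first.
    by rewrite /K; field; rewrite !gt_eqF ?exprn_gt0.
  by rewrite -mulrBr -mulrA ler_pM2l// lerBlDr -lerBlDl.
have KP : K * segint 0 T P <= d + 21 / N / d + K * (2 * a ^+ 2 * C2) / d / T.
  rewrite PE (_ : K * _ = d * (K * G0) + d^-1 * (K * (a ^+ 4 * G4 - 2 * a ^+ 2 * G2 + G0))); last by ring.
  rewrite -[leRHS]addrA; apply: lerD; first by rewrite ler_piMr// ltW.
  rewrite (_ : 21 / N / d + _ = d^-1 * (21 / N + K * (2 * a ^+ 2 * C2) / T)); last by ring.
  rewrite ler_pM2l ?invr_gt0//.
  apply: (@le_trans _ _ (K * (a ^+ 4 * ((n + 4)`!%:R / lam ^+ (n + 4).+1) -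
      2 * a ^+ 2 * ((n + 2)`!%:R / lam ^+ (n + 2).+1 - C2 / T) + n`!%:R / lam ^+ n.+1))).
    rewrite ler_pM2l// lerD// lerB//.
      by rewrite ler_pM2l ?exprn_gt0.
    by rewrite ler_pM2l// mulr_gt0 ?exprn_gt0.
  apply: le_trans (lerD (gamma_fourth n) (lexx _)).
  rewrite le_eqVlt; apply/orP; left; apply/eqP.
  rewrite /K /a -/N -!addSn !exprD; field.
  by rewrite !gt_eqF ?exprn_gt0.
rewrite DE; apply: (le_trans (ler_wpM2l (ltW lam1) (ler_normD _ _))).
rewrite mulrDr /B [X in _ <= _ + X]mulrDl addrA; apply: lerD.
  rewrite normrM (gtr0_norm K0) mulrCA.
  apply: (le_trans (ler_wpM2l (ltW K0) DP)).
  rewrite mulrCA -[_ * _ / T]mulrA -mulrDr ler_wpM2l//.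
have KG1 : 0 <= 1 - K * G0 by rewrite subr_ge0.
rewrite normrM distrC (ger0_norm KG1) mulrA -[leRHS]mulrA ler_wpM2l//.
by rewrite mulr_ge0// ltW.
Qed.

Lemma pw_cvg psi k e : rtest psi -> 0 < e -> \forall n \near \oo,
  euler_bound k (fun x => pw n psi x - psi x) (fun x => e / (1 + x)).
Proof.
move=> tp e0.
have one i : \forall n \near \oo, forall x, 0 < x ->
    x ^+ i * `|derive1n i (fun x => pw n psi x - psi x) x| <= e / (1 + x).
  have [A A0 HA] := pw_estimate (rtest_euler i tp).
  (* For large [n] the term [21 / n.+1 / d] is at most [d] too, and [A * (d + d) <= e]. *)
  pose d := e / (2 * (A + 1)).
  have A1 : 0 < A + 1 by rewrite ltr_wpDl.
  have d0 : 0 < d by rewrite divr_gt0 ?mulr_gt0.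
  near=> n.
  have nd : 21 / n.+1%:R / d <= d.
    have dd : 0 < d * d by exact: mulr_gt0.
    rewrite ler_pdivrMr// ler_pdivrMr ?ltr0n// -ler_pdivrMl//.
    apply: (@le_trans _ _ n%:R); last by rewrite ler_nat.
    by near: n; exact: nbhs_infty_ger.
  move=> x x0; have x1 : 0 < 1 + x by rewrite addr_gt0.
  rewrite derive1nB; [|exact: rsmooth_pw|exact: rtest_smooth].
  rewrite -[X in X * _](ger0_norm (exprn_ge0 i (ltW x0))) -normrM mulrBr pw_euler//.
  rewrite ler_pdivlMr// mulrC; apply: (le_trans (HA n d x d0 x0)).
  apply: (@le_trans _ _ (A * (d + d))); first by rewrite ler_wpM2l// lerD2l.
  apply: (@le_trans _ _ ((A + 1) * (d + d))).
    by rewrite ler_wpM2r ?lerDl// addr_ge0// ltW.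
  by rewrite /d le_eqVlt; apply/orP; left; apply/eqP; field; rewrite gt_eqF.
elim: k => [|k IH].
  by have := one 0%N; apply: filterS => n H i; rewrite leqn0 => /eqP ->.
near=> n => i; rewrite leq_eqVlt => /predU1P[->|ik].
  by near: n; exact: one.
have H : euler_bound k (fun x => pw n psi x - psi x) (fun x => e / (1 + x)) by near: n.
exact: H.
Unshelve. all: by end_near. Qed.

End PostWidderEstimate.

(** * Functionals on [S0space] evaluated at real functions *)

Section Functionals.
Set Implicit Arguments.
Unset Strict Implicit.
Context {R : realType}.
Local Notation C := R[i].
Implicit Types (u v g psi : R -> R) (c e l r x t : R).

Lemma decayingZ c u : decaying u -> decaying (fun t => c * u t).
Proof.
move=> [su Hu]; split; first exact: rsmoothZ.
move=> k; have [d d0 H] := Hu k; exists (`|c| * d); first exact: mulr_ge0.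
move=> i ik t t0; rewrite derive1nZ// normrM mulrCA -mulrA.
by rewrite ler_wpM2l// H.
Qed.

Lemma decaying0 : decaying (fun _ : R => 0 : R).
Proof.
split; first exact: rsmooth_cst.
move=> k; exists 0 => // j _ t _; rewrite mul0r.
by case: j => [|j]; rewrite ?derive1n_cst/= normr0 mulr0.
Qed.

Lemma decaying_sum (I : Type) (s : seq I) (u : I -> R -> R) :
  (forall i, decaying (u i)) -> decaying (fun t => \sum_(i <- s) u i t).
Proof.
move=> du; elim: s => [|i s IH].
  rewrite (_ : (fun t => _) = fun=> 0); last by apply/funext => t; rewrite big_nil.
  exact: decaying0.
rewrite (_ : (fun t => _) = fun t => u i t + \sum_(j <- s) u j t).
  exact: decayingD.
by apply/funext => t; rewrite big_cons.
Qed.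

Definition rcf u : R -> C := fun t => (u t)%:C.

Variable sigma0 : (R -> C) -> C.
Hypothesis sigma0_S0 : S0dual sigma0.

Lemma S0dual_linear c u v : decaying u -> decaying v ->
  sigma0 (rcf (fun t => c * u t + v t)) = c%:C * sigma0 (rcf u) + sigma0 (rcf v).
Proof.
move=> du dv; have [H _] := sigma0_S0.
have := H c%:C _ _ (decaying_S0space du) (decaying_S0space dv).
have E : (fun x => c%:C * (u x)%:C + (v x)%:C) = rcf (fun t => c * u t + v t).
  by apply/funext => t; rewrite /rcf rmorphD rmorphM.
have Ec : Num.conj (c%:C : C) = c%:C by exact: conjc_real.
by rewrite E Ec.
Qed.

Lemma S0dual_0 : sigma0 (rcf (fun=> 0)) = 0.
Proof.
have := S0dual_linear 1 decaying0 decaying0.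
rewrite (_ : (fun t => _) = fun=> 0); last by apply/funext => t; rewrite mulr0 addr0.
by rewrite mul1r => /esym/eqP; rewrite -subr_eq0 addrK => /eqP.
Qed.

Lemma S0dual_sum (I : Type) (s : seq I) (c : I -> R) (u : I -> R -> R) :
  (forall i, decaying (u i)) ->
  sigma0 (rcf (fun t => \sum_(i <- s) c i * u i t)) =
  \sum_(i <- s) (c i)%:C * sigma0 (rcf (u i)).
Proof.
move=> du; elim: s => [|i s IH].
  rewrite big_nil -[RHS]S0dual_0; congr sigma0; apply/funext => t.
  by rewrite /rcf big_nil.
rewrite big_cons -IH -S0dual_linear//.
  by congr sigma0; apply/funext => t; rewrite /rcf big_cons.
by apply: decaying_sum => j; exact: decayingZ.
Qed.

Lemma S0dual_cvg (u : nat -> R -> R) v : (forall j, decaying (u j)) -> decaying v ->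
  S0null (fun j => rcf (fun t => u j t - v t)) -> forall e, 0 < e ->
  \forall j \near \oo, cabs (sigma0 (rcf (u j)) - sigma0 (rcf v)) <= e.
Proof.
move=> du dv nuv e e0; have [_ H] := sigma0_S0.
have E j : (fun t => u j t - v t) = fun t => (-1) * v t + u j t.
  by apply/funext => t; rewrite mulN1r addrC.
have D j : decaying (fun t => u j t - v t).
  by rewrite E; apply: decayingD => //; exact: decayingZ.
have {}H := H _ (fun j => decaying_S0space (D j)) nuv.
move/cvgrPdist_le: H => /(_ e e0); apply: filterS => j.
rewrite sub0r normrN ger0_norm ?cabs_ge0// -[fun t => _]/(rcf (fun t => u j t - v t)).
by rewrite E S0dual_linear// rmorphN1 mulN1r addrC.
Qed.

(** The seminorms see only [t > 0], so the constant sequence [u] is a null sequence and its constant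
    value must tend to 0. *)
Lemma S0dual_eq0 u : rsmooth u -> (forall t, 0 < t -> u t = 0) -> sigma0 (rcf u) = 0.
Proof.
move=> su u0.
have eb k e : 0 <= e -> euler_bound k u (fun t => e * logw t).
  move=> e0 i _ t t0.
  rewrite (@derive1n_eq0 _ _ _ [set x : R | 0 < x])// normr0 mulr0.
  by rewrite mulr_ge0// ltW// logw_gt0.
have [_ /(_ (fun=> rcf u))H] := sigma0_S0.
have : cabs (sigma0 (rcf u)) @[_ --> \oo] --> (0 : R).
  apply: H => [j|].
    by apply: S0space_real => // k; exists 0; exact: eb.
  by apply: (@S0null_real _ (fun=> u)) => k e e0; apply: nearW => j; apply: eb; exact: ltW.
have : cabs (sigma0 (rcf u)) @[_ --> \oo] --> cabs (sigma0 (rcf u)) by exact: cvg_cst.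
move=> c1 c2; have : cabs (sigma0 (rcf u)) = 0.
  by apply: (@cvg_unique _ _ _ _ _ _ c1 c2); exact: Rhausdorff.
by move=> E; apply/eqP; rewrite -normr_eq0 -cabs_norm E.
Qed.

End Functionals.

(** * Strict positivity from a lower bound on the density *)

Section LowerBound.
Set Implicit Arguments.
Unset Strict Implicit.
Context {R : realType}.
Local Notation C := R[i].
Local Notation mu := (@lebesgue_measure R).
Implicit Types (u v g psi : R -> R) (a b c e l r x t : R).

Lemma ae_ge0_Rintegral (D : set R) u : measurable D -> measurable_fun D u ->
  {ae mu, forall t, D t -> 0 <= u t} -> 0 <= \int[mu]_(t in D) u t.
Proof.
move=> mD mu_ H; rewrite /Rintegral.
have -> : (\int[mu]_(t in D) (u t)%:E = \int[mu]_(t in D) `|u t|%:E)%E.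
  apply: ae_eq_integral => //.
  - exact/measurable_EFinP.
  - by apply/measurable_EFinP; exact: measurableT_comp.
  - have aeF : Filter (nbhs (almost_everywhere mu)) by exact: ae_filter_ringOfSetsType.
    by move: H; apply: filterS => t Ht Dt; rewrite ger0_norm// Ht.
by apply/fine_ge0/integral_ge0 => t _; rewrite lee_fin.
Qed.

Lemma segint_gt0 a b u x : continuous u -> (forall t, 0 <= u t) ->
  a < x < b -> 0 < u x -> 0 < segint a b u.
Proof.
move=> cu u0 /andP[ax xb] ux.
have : \forall t \near x, u x / 2 < u t.
  by have /cvgr_gt := cu x; apply; rewrite ltr_pdivrMr// ltr_pMr// ltr1n.
move=> /nbhs_ballP[e /= e0 He].
pose d := Num.min e (Num.min (x - a) (b - x)) / 2.
have d0 : 0 < d by rewrite divr_gt0// !lt_min e0 !subr_gt0 ax.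
have [de da db] : [/\ d < e, d <= x - a & d <= b - x].
  have H1 : Num.min e (Num.min (x - a) (b - x)) <= e by rewrite ge_min lexx.
  have H2 : Num.min e (Num.min (x - a) (b - x)) <= x - a by rewrite !ge_min lexx orbT.
  have H3 : Num.min e (Num.min (x - a) (b - x)) <= b - x by rewrite !ge_min lexx !orbT.
  by rewrite /d in d0 *; split; lra.
apply: (@lt_le_trans _ _ (segint (x - d) (x + d) (fun=> u x / 2))).
  by rewrite segint_cst; [rewrite mulr_gt0// ?divr_gt0//; lra|lra].
apply: (@le_trans _ _ (segint (x - d) (x + d) u)).
  apply: le_segint => //; first exact: cst_continuous.
  move=> t /andP[t1 t2]; apply/ltW/He.
  by rewrite /ball/= ltr_norml; apply/andP; split; lra.
rewrite -lee_fin !EFin_segint//; apply: ge0_subset_integral => //.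
- apply/measurable_EFinP; apply: measurable_funTS; exact: continuous_measurable_fun.
- by move=> t _; rewrite lee_fin.
- move=> t; rewrite /= !in_itv/= => /andP[t1 t2]; apply/andP; split; lra.
Qed.

Lemma L1loc_integrable (U : set R) u l r : locally_integrable U u -> `[l, r] `<=` U ->
  mu.-integrable `[l, r] (EFin \o u).
Proof.
move=> [mu_ oU H] lrU; apply/integrableP; split.
  by apply/measurable_EFinP; exact: (measurable_funS (open_measurable oU) lrU mu_).
apply: le_lt_trans (H _ lrU (@segment_compact _ l r)).
by rewrite le_eqVlt; apply/orP; left; apply/eqP; apply: eq_integral => t _.
Qed.

(** On [U] the functional is integration against [s], so with the sign [sg] its value at [psi^2] is
    at least [c] times the integral of [psi^2]. Continuity of [psi] at [x] makes that integral
    positive. *)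
Lemma L1loc_lower_bound (U : set R) (sigma0 : (R -> C) -> C) (s : R -> C) (sg c : R)
    psi l r x : open U -> is_L1loc_on U sigma0 s -> 0 < c ->
  {ae mu, forall t, U t -> c <= sg * Re (s t)} ->
  rsmooth psi -> supp_in l r psi -> `[l, r] `<=` U -> l < x < r -> psi x != 0 ->
  0 < sg * Re (sigma0 (rcf (fun t => psi t * psi t))).
Proof.
move=> oU [liR _ sE] c0 Hs sp psi0 lrU lxr psix.
have cp := rsmooth_continuous sp.
have sp2 : rsmooth (fun t => psi t * psi t) by exact: rsmoothM.
have cp2 := rsmooth_continuous sp2.
rewrite sE; last first.
  split; first exact: csmooth_real.
  exists `[l, r]%classic; split => //; first exact: segment_compact.
  by move=> t; rewrite /= in_itv/= => /negP tlr; rewrite /rcf psi0// mul0r.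
rewrite /cint /=.
have -> : \int[mu]_(t in U) Re (s t * (rcf (fun t => psi t * psi t) t)^*) =
    \int[mu]_(t in `[l, r]) (Re (s t) * (psi t * psi t)).
  rewrite -[RHS]/(segint l r _) -(@segint_supp _ U)//.
    by apply: eq_Rintegral => t _; rewrite cReM /= oppr0 mulr0 subr0.
  by move=> t _ /psi0 ->; rewrite mulr0 mulr0.
have mI : measurable (`[l, r]%classic : set R) by exact: measurable_itv.
have iZ d (u : R -> R) : mu.-integrable `[l, r] (EFin \o u) ->
    mu.-integrable `[l, r] (EFin \o (fun t => d * u t)).
  move=> iu; apply: (@eq_integrable _ (measurableTypeR R) R mu _ mI _ _ _
    (@integrableZl _ (measurableTypeR R) R mu _ mI d _ iu)) => t _.
  by rewrite /= EFinM.
have iR := L1loc_integrable liR lrU.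
have mp2 : measurable_fun `[l, r] (fun t => psi t * psi t).
  by apply: measurable_funTS; exact: continuous_measurable_fun.
have bp2 : [bounded psi t * psi t | t in `[l, r]%classic].
  have [M M0 HM] := @segment_bounded _ l r _ cp2.
  exists M; split; first exact: num_real.
  by move=> y My t /=; rewrite in_itv/= => /HM /le_trans; apply; exact: ltW.
have iRp : mu.-integrable `[l, r] (EFin \o (fun t => Re (s t) * (psi t * psi t))).
  have H := @integrableMl _ (measurableTypeR R) R mu _ mI _ _ iR mp2 bp2.
  apply: (@eq_integrable _ (measurableTypeR R) R mu _ mI _ _ _ H) => t _.
  by rewrite /= EFinM.
have ip2 : mu.-integrable `[l, r] (EFin \o (fun t => psi t * psi t)).
  exact: segint_integrable.
rewrite -RintegralZl//.
have i1 : mu.-integrable `[l, r] (EFin \o (fun t => sg * (Re (s t) * (psi t * psi t)))).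
  exact: iZ.
have i2 : mu.-integrable `[l, r] (EFin \o (fun t => c * (psi t * psi t))).
  exact: iZ.
apply: (@lt_le_trans _ _ (c * segint l r (fun t => psi t * psi t))).
  rewrite mulr_gt0//; apply: (segint_gt0 cp2 _ lxr).
    by move=> t; rewrite -expr2 sqr_ge0.
  by rewrite -expr2 exprn_even_gt0.
rewrite -segintZ// -subr_ge0 -RintegralB//.
apply: ae_ge0_Rintegral => //.
  by apply: measurable_funB; apply/measurable_EFinP; [case/integrableP: i1|case/integrableP: i2].
have aeF : Filter (nbhs (almost_everywhere mu)) by exact: ae_filter_ringOfSetsType.
move: Hs; apply: filterS => t Ht tlr; rewrite mulrA -mulrBl mulr_ge0//.
  by rewrite subr_ge0 Ht//; exact: lrU.
by rewrite -expr2 sqr_ge0.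
Qed.

End LowerBound.

(** * Perturbed diagonal matrices, disjoint bumps and products of approximants *)

Section GramMatrices.
Set Implicit Arguments.
Unset Strict Implicit.
Context {R : realType}.
Implicit Types (u v psi : R -> R) (m l r d x t : R).

(** By [|a_i a_k| <= (a_i^2 + a_k^2) / 2], errors of size [m / (2 n)] in all [n^2] entries consume
    at most half of the diagonal bound [m]. *)
Lemma gram_coercive n (G D : 'I_n -> 'I_n -> R) m (a : 'I_n -> R) : 0 <= m ->
  (forall i, m <= D i i) -> (forall i k, i != k -> D i k = 0) ->
  (forall i k, `|G i k - D i k| <= m / 2 / n%:R) ->
  m / 2 * \sum_i a i ^+ 2 <= \sum_i \sum_k a i * a k * G i k.
Proof.
move=> m0 mD D0 GD.
have [n0|n0] := posnP n.
  by move: G D a mD D0 GD; rewrite n0 => G D a _ _ _; rewrite !big_ord0 mulr0.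
pose S := \sum_i a i ^+ 2.
have ED : \sum_i \sum_k a i * a k * D i k = \sum_i a i ^+ 2 * D i i.
  apply: eq_bigr => i _; rewrite (bigD1 i)//= big1 ?addr0 ?expr2// => k ki.
  by rewrite D0 ?mulr0// eq_sym.
have H1 : m * S <= \sum_i \sum_k a i * a k * D i k.
  rewrite ED /S mulr_sumr ler_sum// => i _.
  by rewrite mulrC ler_wpM2l ?sqr_ge0.
have H2 : - (m / 2 * S) <= \sum_i \sum_k a i * a k * (G i k - D i k).
  have -> : - (m / 2 * S) =
      \sum_(i < n) \sum_(k < n) - ((a i ^+ 2 + a k ^+ 2) / 2 * (m / 2 / n%:R)).
    set q := m / 2 / n%:R.
    transitivity (\sum_(i < n) - ((a i ^+ 2 *+ n + S) / 2 * q)); last first.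
      apply: eq_bigr => i _.
      by rewrite sumrN -mulr_suml -mulr_suml big_split/= sumr_const card_ord.
    rewrite sumrN -mulr_suml -mulr_suml big_split/= sumr_const card_ord sumrMnl -/S.
    rewrite -[S *+ n]mulr_natr /q; field.
    by rewrite pnatr_eq0 -lt0n.
  rewrite ler_sum// => i _; rewrite ler_sum// => k _.
  have A : `|a i * a k| <= (a i ^+ 2 + a k ^+ 2) / 2.
    rewrite normrM ler_pdivlMr// -[a i ^+ 2]real_normK ?num_real//.
    rewrite -[a k ^+ 2]real_normK ?num_real// -subr_ge0.
    rewrite (_ : _ - _ = (`|a i| - `|a k|) ^+ 2) ?sqr_ge0//; ring.
  have := ler_pM (normr_ge0 _) (normr_ge0 _) A (GD i k).
  by rewrite -normrM ler_norml => /andP[].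
have -> : \sum_i \sum_k a i * a k * G i k =
    \sum_i \sum_k a i * a k * D i k + \sum_i \sum_k a i * a k * (G i k - D i k).
  rewrite -big_split/=; apply: eq_bigr => i _; rewrite -big_split/=.
  by apply: eq_bigr => k _; rewrite -mulrDr addrC subrK.
apply: le_trans (lerD H1 H2); rewrite -/S; lra.
Qed.

(** One bump for each of [n] equal cells of [[l, r]]. Disjointness is stated as vanishing products
    because these are the off-diagonal arguments of the limiting Gram matrix. *)
Lemma disjoint_bumps n l r : l < r -> exists psi : 'I_n -> R -> R,
  [/\ forall i, rsmooth (psi i), forall i, supp_in l r (psi i),
      forall i, exists2 x, l < x < r & psi i x != 0 &
      forall i k t, i != k -> psi i t * psi k t = 0].
Proof.
move=> lr; have [n0|n0] := posnP n.
  have no (i : 'I_n) : False by case: i => i; rewrite n0.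
  by exists (fun=> fun=> 0); split=> i; case: (no i).
pose d := (r - l) / n%:R.
have nR : (0 : R) < n%:R by rewrite ltr0n.
have d0 : 0 < d by rewrite divr_gt0// subr_gt0.
have nd : n%:R * d = r - l by rewrite /d mulrCA divff ?mulr1// gt_eqF.
pose lo (i : nat) := l + i%:R * d.
pose psi (i : 'I_n) t := bump (1 * t + - lo i) * bump (-1 * t + lo i.+1).
have lo_l i : l <= lo i by rewrite lerDl mulr_ge0// ltW.
have lo_r (i : 'I_n) : lo i.+1 <= r.
  by rewrite /lo -lerBrDl -nd ler_pM2r// ler_nat.
have out (i : 'I_n) t : ~~ (lo i < t < lo i.+1) -> psi i t = 0.
  rewrite negb_and -!leNgt /psi => /orP[h|h].
    by rewrite bump_le0 ?mul0r// mul1r subr_le0.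
  by rewrite [X in _ * X]bump_le0 ?mulr0// mulN1r addrC subr_le0.
exists psi; split.
- by move=> i; apply: rsmoothM; exact: rsmooth_bump.
- move=> i t tlr; apply: out; apply: contra tlr => /andP[h1 h2].
  by rewrite (le_trans (lo_l i) (ltW h1)) (le_trans (ltW h2) (lo_r i)).
- move=> i; have E : lo i.+1 = lo i + d by rewrite /lo -natr1; ring.
  exists (lo i + d / 2).
    have h1 := lo_l i; have h2 := lo_r i; apply/andP; split; lra.
  by rewrite /psi mulf_neq0// gt_eqF// bump_gt0//; lra.
- move=> i k t; wlog ik : i k / (i < k)%N => [H ik|_].
    have := ik; rewrite neq_ltn => /orP[ik'|ki]; first exact: H.
    by rewrite mulrC; apply: H => //; rewrite eq_sym.
  have [/andP[_ t1]|/out ->] := boolP (lo i < t < lo i.+1); last by rewrite mul0r.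
  rewrite [psi k t]out ?mulr0// negb_and -!leNgt; apply/orP; left.
  by rewrite (le_trans (ltW t1))// lerD2l ler_pM2r// ler_nat.
Qed.

(** With [p], [q] the approximants of [u], [v], write [p q - u v = (p - u)(q - v) + (p - u) v + u (q
    - v)]. Only the differences depend on [j], so no separate uniform bound on the approximants is
    required. *)
Lemma pw_prod_null u v : rtest u -> rtest v ->
  S0null (fun j => rcf (fun t => pw j u t * pw j v t - u t * v t)).
Proof.
move=> tu tv; apply: (@S0null_real _ (fun j t => pw j u t * pw j v t - u t * v t)) => k e e0.
have [su Hu] := decaying_rtest tu; have [sv Hv] := decaying_rtest tv.
have [cu cu0 bu] := Hu k; have [cv cv0 bv] := Hv k.
pose B := 2 ^+ k * (1 + cu + cv).
have B0 : 0 < B by rewrite mulr_gt0 ?exprn_gt0// ltr_pwDl// ltr_pwDl.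
(* [d <= 1] makes the quadratic term [(p - u)(q - v)] linear in [d]. *)
pose d := Num.min 1 (e / B).
have d0 : 0 < d by rewrite lt_min ltr01 divr_gt0.
have d1 : d <= 1 by rewrite ge_min lexx.
have dB : d * B <= e by rewrite -ler_pdivlMr// ge_min lexx orbT.
near=> j.
have Eu : euler_bound k (fun x => pw j u x - u x) (fun x => d / (1 + x)).
  by near: j; exact: pw_cvg.
have Ev : euler_bound k (fun x => pw j v x - v x) (fun x => d / (1 + x)).
  by near: j; exact: pw_cvg.
have spu := rsmooth_pw j tu; have spv := rsmooth_pw j tv.
have sdu := rsmoothB spu su; have sdv := rsmoothB spv sv.
have P1 := euler_boundM sdu sdv Eu Ev.
have P2 := euler_boundM sdu sv Eu bv.
have P3 := euler_boundM su sdv bu Ev.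
have := euler_boundD (rsmoothM sdu sdv) (rsmoothD (rsmoothM sdu sv) (rsmoothM su sdv)) P1
  (euler_boundD (rsmoothM sdu sv) (rsmoothM su sdv) P2 P3).
rewrite (_ : (fun t => _ + _) = fun t => pw j u t * pw j v t - u t * v t); last first.
  by apply/funext => t; move: (pw j u t) (pw j v t) => p q; ring.
apply: euler_bound_le => t t0.
have t1 : 0 < 1 + t by rewrite addr_gt0.
apply: (@le_trans _ _ (e * (1 + t)^-1)); last by rewrite ler_wpM2l ?(ltW e0)// inv_le_logw.
rewrite [leLHS](_ : _ = (2 ^+ k * (d + cv + cu)) * (d / (1 + t)) * (1 + t)^-1); last by ring.
rewrite ler_wpM2r ?invr_ge0 ?(ltW t1)//.
rewrite mulrA ler_pdivrMr//; apply: (@le_trans _ _ (d * B)).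
  rewrite mulrC ler_pM2l// /B ler_pM2l ?exprn_gt0//; lra.
by apply: (le_trans dB); rewrite ler_peMr ?(ltW e0)// lerDl ltW.
Unshelve. all: by end_near. Qed.

End GramMatrices.

(** * The quadratic form of [h] in terms of [sigma0] *)

Section Forms.
Set Implicit Arguments.
Unset Strict Implicit.
Context {R : realType}.
Local Notation C := R[i].
Variables (h : (R -> C) -> C) (sigma : (C -> C) -> C) (sigma0 : (R -> C) -> C).
Hypothesis h_real : real_distribution h.
Hypothesis h_sigma : is_sigma_function h sigma.
Hypothesis sigma_S0 : represented_in_S0dual sigma sigma0.
Implicit Types (u v g psi : R -> R) (f : R -> C) (c e l r x t : R).

Let sigma0_S0 : S0dual sigma0 := proj1 sigma_S0.

Lemma sigma_functionE F : Ccinfty Rplus F ->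
  h F = sigma0 (fun x => laplace F x%:C).
Proof.
move=> cF; have [_ <-] := h_sigma => //; have [_ E] := sigma_S0.
by rewrite /laplace_adj E//; exact: Yspace_laplace.
Qed.

Lemma rtest0 : rtest (fun _ : R => 0 : R).
Proof.
exists 1, 1; split=> //; exact: rsmooth_cst.
Qed.

Lemma rlap0 x : rlap (fun _ : R => 0) x = 0.
Proof.
have := rlapZ 0 x rtest0; rewrite [RHS]mul0r => E; rewrite -[RHS]E.
by congr (rlap _ x); apply/funext => t; rewrite mul0r.
Qed.

Lemma Ccinfty_rcf u : rtest u -> Ccinfty Rplus (rcf u).
Proof. by move=> tu; apply/Ccinfty_Rplus_rtest; split=> //; exact: rtest0. Qed.

Lemma sigma_function_rcf u : rtest u -> h (rcf u) = sigma0 (rcf (rlap u)).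
Proof.
move=> tu; rewrite sigma_functionE; last exact: Ccinfty_rcf.
by congr sigma0; apply/funext => x; rewrite laplace_real /= rlap0.
Qed.

(** The product of the transforms is the transform of [rconv u v], a real test function, on which
    the real functional [h] has a real value. *)
Lemma sigma0_rlap_real u v : rtest u -> rtest v ->
  Im (sigma0 (rcf (fun x => rlap u x * rlap v x))) = 0.
Proof.
move=> tu tv; have tuv := rtest_rconv tu tv.
have -> : sigma0 (rcf (fun x => rlap u x * rlap v x)) = h (rcf (rconv u v)).
  rewrite sigma_function_rcf//; congr sigma0; apply/funext => x.
  by rewrite /rcf rlap_rconv.
have := h_real (Ccinfty_rcf tuv).
rewrite [X in _ = h X](_ : _ = rcf (rconv u v)); last first.
  by apply/funext => t; rewrite /rcf; exact: conjc_real.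
case: (h _) => p q /= [] /eqP; rewrite eq_sym -subr_eq0 opprK -mulr2n mulrn_eq0/=.
by move/eqP.
Qed.

Lemma form_sigma0 f : Ccinfty Rplus f -> h (lconv f f) =
  sigma0 (rcf (fun x => rlap (fun t => Re (f t)) x * rlap (fun t => Re (f t)) x +
                        rlap (fun t => Im (f t)) x * rlap (fun t => Im (f t)) x)).
Proof.
move=> cf; rewrite sigma_functionE; last exact: Ccinfty_lconv.
congr sigma0; apply/funext => x; rewrite laplace_lconv// laplace_real.
apply/eqP; rewrite eq_complex cReM cImM /=.
by apply/andP; split; apply/eqP; ring.
Qed.

Lemma sgr_complex (b : bool) : (-1) ^+ b = ((-1) ^+ b : R)%:C :> C.
Proof. by rewrite rmorphXn rmorphN1. Qed.

Lemma le0_sgrM (b : bool) (z : C) : (0 <= (-1) ^+ b * z) =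
  (Im z == 0) && (0 <= (-1) ^+ b * Re z).
Proof.
rewrite sgr_complex lecE cReM cImM /= !mul0r subr0 addr0.
by rewrite mulf_eq0 signr_eq0.
Qed.

Lemma lt0_sgrM (b : bool) (z : C) : (0 < (-1) ^+ b * z) =
  (Im z == 0) && (0 < (-1) ^+ b * Re z).
Proof.
rewrite sgr_complex ltcE cReM cImM /= !mul0r subr0 addr0.
by rewrite mulf_eq0 signr_eq0.
Qed.

Lemma form_ge0 (minus : bool) :
  nonneg_distribution Rplus (fun phi => (-1) ^+ minus * sigma0 phi) ->
  forall f, Ccinfty Rplus f -> 0 <= (-1) ^+ minus * h (lconv f f).
Proof.
move=> sigma_ge0 f cf; rewrite form_sigma0//.
have /Ccinfty_Rplus_rtest[tu tv] := cf.
set g := fun x => _ + _.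
have dg : decaying g.
  by apply: decayingD; apply: decayingM; exact: decaying_rlap.
have g0 t : 0 <= g t by rewrite addr_ge0// -expr2 sqr_ge0.
have [phi [tphi phi0 phig]] := decaying_cutoff dg g0.
have dphi j := decaying_rtest (tphi j).
have pos j : (Im (sigma0 (rcf (phi j))) == 0) &&
    (0 <= (-1) ^+ minus * Re (sigma0 (rcf (phi j)))).
  rewrite -le0_sgrM; apply: sigma_ge0; first exact: Ccinfty_rcf.
  by move=> t; rewrite /rcf lecR.
have lim e : 0 < e -> exists j, cabs (sigma0 (rcf (phi j)) - sigma0 (rcf g)) <= e.
  move=> e0; have [N _ HN] := S0dual_cvg sigma0_S0 dphi dg phig e0.
  by exists N; exact: HN (leqnn N).
(* Positivity in [R[i]] includes a vanishing imaginary part, so both components have to pass to the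
   limit. *)
rewrite le0_sgrM; apply/andP; split.
  rewrite -normr_le0; apply/ler_addgt0Pr => e e0; rewrite add0r.
  have [j Hj] := lim e e0; have /andP[/eqP I0 _] := pos j.
  apply: le_trans Hj; apply: le_trans (Im_le_cabs _).
  by rewrite cImD cImN I0 add0r normrN.
apply/ler_addgt0Pr => e e0.
have [j Hj] := lim e e0; have /andP[_ p0] := pos j.
apply: (le_trans p0); rewrite -lerBlDl -mulrBr.
apply: le_trans Hj; apply: le_trans (Re_le_cabs _).
by rewrite (le_trans (ler_norm _))// normrM normrX normrN1 expr1n mul1r cReD cReN.
Qed.

Lemma rtest_sum (I : Type) (s : seq I) (a : I -> R) (u : I -> R -> R) :
  (forall i, rtest (u i)) -> rtest (fun t => \sum_(i <- s) a i * u i t).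
Proof.
move=> tu; elim: s => [|i s IH].
  by under eq_fun do rewrite big_nil; exact: rtest0.
by under eq_fun do rewrite big_cons; apply: rtestD => //; exact: rtestZ.
Qed.

Lemma rlap_sum (I : Type) (s : seq I) (a : I -> R) (u : I -> R -> R) x :
  (forall i, rtest (u i)) ->
  rlap (fun t => \sum_(i <- s) a i * u i t) x = \sum_(i <- s) a i * rlap (u i) x.
Proof.
move=> tu; elim: s => [|i s IH].
  by under eq_fun do rewrite big_nil; rewrite big_nil rlap0.
under eq_fun do rewrite big_cons.
rewrite big_cons rlapD; [by rewrite rlapZ ?IH|exact: rtestZ|exact: rtest_sum].
Qed.

Definition span_fun n (u : 'I_n -> R -> R) (c : 'I_n -> C) : R -> C :=
  fun t => \sum_i c i * (u i t)%:C.

Definition gram n (w : 'I_n -> R -> R) i k : R :=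
  Re (sigma0 (rcf (fun x => w i x * w k x))).

(* The Gram matrix is real symmetric, so the form of a complex combination is the sum of the forms of its real and imaginary parts. *)
Lemma form_span n (u : 'I_n -> R -> R) (c : 'I_n -> C) (G := gram (fun i => rlap (u i))) :
  (forall i, rtest (u i)) -> Ccinfty Rplus (span_fun u c) /\
  h (lconv (span_fun u c) (span_fun u c)) =
    (\sum_i \sum_k Re (c i) * Re (c k) * G i k +
     \sum_i \sum_k Im (c i) * Im (c k) * G i k)%:C.
Proof.
move=> tu; set f := span_fun u c.
have fRe : (fun t => Re (f t)) = fun t => \sum_i Re (c i) * u i t.
  apply/funext => t; rewrite /f /span_fun (big_morph _ (@cReD R) (erefl (Re (0 : C)))).
  by apply: eq_bigr => i _; rewrite cReM /= mulr0 subr0.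
have fIm : (fun t => Im (f t)) = fun t => \sum_i Im (c i) * u i t.
  apply/funext => t; rewrite /f /span_fun (big_morph _ (@cImD R) (erefl (Im (0 : C)))).
  by apply: eq_bigr => i _; rewrite cImM /= mulr0 add0r.
have cf : Ccinfty Rplus f.
  by apply/Ccinfty_Rplus_rtest; rewrite fRe fIm; split; exact: rtest_sum.
split=> //; rewrite form_sigma0// fRe fIm.
have dG (i k : 'I_n) : decaying (fun x => rlap (u i) x * rlap (u k) x).
  by apply: decayingM; exact: decaying_rlap.
(* The coefficient 1 on the outer sum fits [S0dual_sum], which is then applied once to each of the
   nested sums. *)
have quad (a : 'I_n -> R) : (fun x => rlap (fun t => \sum_i a i * u i t) x *
    rlap (fun t => \sum_i a i * u i t) x) =
    fun x => \sum_i 1 * \sum_k a i * a k * (rlap (u i) x * rlap (u k) x).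
  apply/funext => x; rewrite rlap_sum// mulr_suml; apply: eq_bigr => i _.
  by rewrite mul1r mulr_sumr; apply: eq_bigr => k _; ring.
have dq (a : 'I_n -> R) i : decaying (fun x => \sum_k a i * a k * (rlap (u i) x * rlap (u k) x)).
  by apply: decaying_sum => k; exact: decayingZ.
have Q (a : 'I_n -> R) : sigma0 (rcf (fun x => rlap (fun t => \sum_i a i * u i t) x *
    rlap (fun t => \sum_i a i * u i t) x)) = (\sum_i \sum_k a i * a k * G i k)%:C.
  rewrite quad S0dual_sum// rmorph_sum/=; apply: eq_bigr => i _.
  rewrite mul1r S0dual_sum// rmorph_sum/=; apply: eq_bigr => k _.
  rewrite [RHS]rmorphM/=; congr (_ * _); rewrite /G /gram.
  by have := sigma0_rlap_real (tu i) (tu k); case: (sigma0 _) => p q /= ->.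
rewrite rmorphD/= -!Q.
have D (a : 'I_n -> R) : decaying (fun x => rlap (fun t => \sum_i a i * u i t) x *
    rlap (fun t => \sum_i a i * u i t) x).
  by have := decaying_rlap (rtest_sum (index_enum _) a tu) => d; exact: decayingM.
have := S0dual_linear sigma0_S0 1 (D (fun i => Re (c i))) (D (fun i => Im (c i))).
rewrite [1%:C * _]mul1r => <-; congr sigma0; apply/funext => x.
by rewrite /rcf mul1r.
Qed.

(** The given functions need not be Laplace transforms of test functions. For one large [N] their
    Post-Widder images are, and the Gram matrix is still definite, which yields a space of dimension
    [n + 1] for every [n]. *)
Lemma Nsign_infty (minus : bool) :
  (forall n, exists psi : 'I_n.+1 -> R -> R, [/\ forall i, rtest (psi i),
    forall i k t, i != k -> psi i t * psi k t = 0 &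
    forall i, 0 < (-1) ^+ minus * gram psi i i]) ->
  Nsign minus h = +oo%E.
Proof.
move=> H; apply/eqyP => A A0; pose n := Num.bound A.
have [psi [tpsi psi0 psi_gt0]] := H n.
pose sg : R := (-1) ^+ minus.
pose D i k := sg * gram psi i k.
have sg1 : `|sg| = 1 by rewrite normrX normrN1 expr1n.
have D0 i k : i != k -> D i k = 0.
  move=> ik; rewrite /D /gram (_ : rcf _ = rcf (fun=> 0)).
    by rewrite S0dual_0// mulr0.
  by apply/funext => t; rewrite /rcf psi0.
have [m m0 mD] : exists2 m, 0 < m & forall i, m <= D i i.
  have [i0 _ Hi0] := @arg_minP _ _ _ (@ord0 n) xpredT (fun i => D i i) isT.
  by exists (D i0 i0) => [|i]; [exact: psi_gt0|exact: Hi0].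
have dw N i : decaying (pw N (psi i)).
  by apply: decaying_rlap; apply: rtest_derive1n; exact: rtest_pwF.
have e0 : 0 < m / 2 / n.+1%:R by rewrite !divr_gt0.
have : \forall N \near \oo, forall i k,
    `|sg * gram (fun i => pw N (psi i)) i k - D i k| <= m / 2 / n.+1%:R.
  apply: filter_forall => i; apply: filter_forall => k.
  have := S0dual_cvg sigma0_S0 (fun N => decayingM (dw N i) (dw N k))
    (decayingM (decaying_rtest (tpsi i)) (decaying_rtest (tpsi k)))
    (pw_prod_null (tpsi i) (tpsi k)) e0.
  apply: filterS => N; apply: le_trans.
  rewrite -mulrBr normrM sg1 mul1r /gram -cReN -cReD.
  exact: Re_le_cabs.
move=> [N _ /(_ N (leqnn N)) GD].
pose u i := derive1n N.+1 (pwF N (psi i)).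
have tu i : rtest (u i) by apply: rtest_derive1n; exact: rtest_pwF.
pose G := gram (fun i => rlap (u i)).
have formE (c : 'I_n.+1 -> C) := form_span c tu.
have coer (a : 'I_n.+1 -> R) : m / 2 * \sum_i a i ^+ 2 <=
    sg * \sum_i \sum_k a i * a k * G i k.
  apply: le_trans (gram_coercive a (ltW m0) mD D0 GD) _.
  rewrite mulr_sumr le_eqVlt; apply/orP; left; apply/eqP; apply: eq_bigr => i _.
  by rewrite mulr_sumr; apply: eq_bigr => k _; rewrite mulrCA.
have pos (c : 'I_n.+1 -> C) i : c i != 0 ->
    0 < (-1) ^+ minus * h (lconv (span_fun u c) (span_fun u c)).
  move=> ci; have [_ ->] := formE c; rewrite lt0_sgrM eqxx/= -/sg -/G mulrDr.
  apply: lt_le_trans (lerD (coer (fun i => Re (c i))) (coer (fun i => Im (c i)))).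
  rewrite -mulrDr mulr_gt0 ?divr_gt0// -big_split/= (bigD1 i)//=.
  rewrite ltr_pwDl//; last by apply: sumr_ge0 => k _; rewrite addr_ge0 ?sqr_ge0.
  rewrite lt_neqAle addr_ge0 ?sqr_ge0// andbT eq_sym -sqr_cabs sqrf_eq0.
  by rewrite -(inj_eq (@complexI R)) cabs_norm normr_eq0.
(* Linear independence follows from definiteness: a nontrivial combination that vanishes identically
   would have form 0, contrary to [pos]. *)
have span0 (c : 'I_n.+1 -> C) : span_fun u c = (fun=> 0) -> forall i, c i = 0.
  move=> c0 i; apply/eqP; apply: contraT => /pos; have [cf _] := formE c.
  rewrite form_sigma0// c0 /= (_ : rcf _ = rcf (fun=> 0)).
    by rewrite S0dual_0// mulr0 ltxx.
  by apply/funext => x; rewrite /rcf rlap0 mulr0 addr0.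
pose M : set (R -> C) := [set f | exists c : 'I_n.+1 -> C, f = span_fun u c].
apply: (@le_trans _ _ (n.+1%:R)%:E).
  rewrite lee_fin; apply: ltW; apply: (lt_le_trans (archi_boundP (ltW A0))).
  by rewrite ler_nat.
apply: (@le_trans _ _ (ldim M)).
  apply: ereal_sup_ubound; exists n.+1 => //=.
  exists (fun i => rcf (u i)); split => [i|c c0 i].
    exists (fun k => (k == i)%:R); apply/funext => t.
    rewrite /span_fun (bigD1 i)//= eqxx mul1r big1 ?addr0// => k /negbTE ->.
    by rewrite mul0r.
  by apply: span0; apply/funext => t; exact: c0.
apply: ereal_sup_ubound; exists M => //; split.
- split; first by exists (fun=> 0); apply/funext => t; rewrite /span_fun big1// => i _; rewrite mul0r.
  move=> a _ _ [c ->] [c' ->]; exists (fun i => a * c i + c' i); apply/funext => t.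
  rewrite /span_fun mulr_sumr -big_split/=; apply: eq_bigr => i _.
  by rewrite mulrDl mulrA.
- by move=> _ [c ->]; have [] := formE c.
- move=> _ [c ->] fn0.
  have [/forallP c0|] := boolP [forall i, c i == 0].
    exfalso; apply: fn0; apply/funext => t; rewrite /span_fun big1// => i _.
    by rewrite (eqP (c0 i)) mul0r.
  by rewrite negb_forall => /existsP[i /pos].
Qed.

End Forms.

Theorem theorem4p7 (R : realType) (h : (R -> R[i]) -> R[i])
    (sigma : (R[i] -> R[i]) -> R[i]) (sigma0 : (R -> R[i]) -> R[i])
    (minus : bool)
    (h_dual : Ccinfty_dual Rplus h)
    (h_real : real_distribution h)
    (h_sigma : is_sigma_function h sigma)
    (sigma_S0 : represented_in_S0dual sigma sigma0) :
  (nonneg_distribution Rplus (fun phi => (-1) ^+ minus * sigma0 phi) ->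
     forall f, Ccinfty Rplus f -> 0 <= (-1) ^+ minus * h (lconv f f)) /\
  (forall (Delta : set R) (s : R -> R[i]) (c0 : R),
     is_interval Delta -> Delta° !=set0 ->
     is_L1loc_on Delta° sigma0 s ->
     0 < c0 ->
     {ae (@lebesgue_measure R),
       forall t, Delta t -> c0%:C <= (-1) ^+ minus * s t} ->
     Nsign minus h = +oo%E).
Proof.
split; first exact: (form_ge0 h_sigma sigma_S0).
move=> Delta s c0 _ [x0 x0D] sL1 c0_gt0 s_ge.
have oD : open (Delta°) := @open_interior _ Delta.
have s_Re : {ae (@lebesgue_measure R), forall t, Delta° t -> c0 <= (-1) ^+ minus * Re (s t)}.
  have aeF : Filter (nbhs (almost_everywhere (@lebesgue_measure R))).
    exact: ae_filter_ringOfSetsType.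
  move: s_ge; apply: filterS => t Ht /(@interior_subset _ _ _) /Ht.
  by rewrite sgr_complex lecE => /andP[_]; rewrite cReM /= mul0r subr0.
(* A neighbourhood of [x0] may contain 0, so the segment is taken on the side of [x0] that points
   away from 0. *)
have [l [r [lr lrD lr0]]] : exists l r : R, [/\ l < r, `[l, r] `<=` Delta° & 0 < l \/ r < 0].
  have /nbhs_ballP[e /= e0 He] : nbhs x0 (Delta°) by exact: open_nbhs_nbhs.
  have [x00|x00] := leP 0 x0.
    exists (x0 + e / 4), (x0 + e / 2); split; [lra| |left; lra].
    move=> t; rewrite /= in_itv/= => /andP[t1 t2]; apply: He.
    by rewrite /ball/= ltr_norml; apply/andP; split; lra.
  exists (x0 - e / 2), (x0 - e / 4); split; [lra| |right; lra].
  move=> t; rewrite /= in_itv/= => /andP[t1 t2]; apply: He.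
  by rewrite /ball/= ltr_norml; apply/andP; split; lra.
have pos psi : rsmooth psi -> supp_in l r psi -> (exists2 x, l < x < r & psi x != 0) ->
    0 < (-1) ^+ minus * Re (sigma0 (rcf (fun t => psi t * psi t))).
  move=> sp psi0 [x lxr psix].
  exact: (L1loc_lower_bound oD sL1 c0_gt0 s_Re sp psi0 lrD lxr psix).
case: lr0 => [l0|r0].
  apply: (Nsign_infty h_real h_sigma sigma_S0) => n.
  have [psi [sp psi0 psix psiM]] := @disjoint_bumps R n.+1 l r lr.
  exists psi; split => // i; last exact: pos.
  by exists l, r; split => //; exact: ltW.
(* [sigma0] does not see functions supported in the negative half-line, so [Delta] cannot reach into it. *)
have [psi [sp psi0 psix _]] := @disjoint_bumps R 1 l r lr.
have := pos _ (sp ord0) (psi0 ord0) (psix ord0).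
rewrite (S0dual_eq0 (proj1 sigma_S0)) ?mulr0 ?ltxx//; first exact: rsmoothM.
move=> t t0; rewrite psi0 ?mul0r// negb_and -!ltNge; apply/orP; right.
exact: lt_trans t0.
Qed.
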